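(* Assume $f\in C^1([0,\infty))$ satisfies (F1)--(F4). Let $\mathcal G$ be a generalized star graph whose essential reduction is isometric to $\mathbb R_+=[0,\infty)$. Then $$d_\lambda(\mathcal G)=d_\lambda^+\qquad\text{for every }\lambda\in(-mc^2,mc^2).$$
   Context: Constants $m>0$, $c>0$ are fixed. $F(t)=\int_0^t f(s)s\,ds$ for $t\ge0$, and the hypotheses on $f\in C^1([0,\infty))$ are: (F1) $f(0)=0$ and $f(t)\ge0$ for $t\ge0$; (F2) there exist $p>2$, $C>0$ with $f(t)\le C(1+t^{p-2})$ for $t\ge0$; (F3) there exists $\theta>2$ with $0<\theta F(t)\le f(t)t^2$ for $t>0$; (F4) $f$ is nondecreasing on $(0,\infty)$. Graphs. A generalized star graph $\mathcal G$ is a connected noncompact metric graph with finitely many bounded edges, whose union (the compact core) $\mathcal K$ is nonempty, and finitely many half-lines $e_1,\dots,e_M$ with pairwise disjoint interiors, such that $\mathcal G=\mathcal K\cup\bigcup_j e_j$ and $\mathcal K\cap e_j=\{v_j\}$. Loops and multiple edges are allowed. Each edge carries an oriented arclength coordinate. A spinor on $\mathcal G$ is $u=(u_e)_e$ with $u_e=(u_e^1,u_e^2)^T:e\to\mathbb C^2$. The Dirac-Kirchhoff condition at a vertex $v$ is: $u_e^1(v)=u_f^1(v)$ for all edge ends $e,f$ incident at $v$, and $\sum_{e\succ v}\nu_{v,e}u_e^2(v)=0$, the sum being over edge ends incident at $v$ (a loop contributes two), with $\nu_{v,e}=1$ if the coordinate on that edge end is outgoing from $v$ and $\nu_{v,e}=-1$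 otherwise. At a terminal (degree-one) vertex this reads $u^2(v)=0$. At a degree-two vertex the condition is purely transmissive. The essential reduction of $\mathcal G$ is the metric graph obtained by suppressing every transmissive vertex of degree two and replacing each resulting chain of edges by one edge of the same total length. Variational setting. Let $\sigma_1=\begin{pmatrix}0&1\\1&0\end{pmatrix}$, $\sigma_3=\begin{pmatrix}1&0\\0&-1\end{pmatrix}$. For $X=\mathcal G$ or $X=\mathbb R_+$, let $\mathcal D_X$ be the self-adjoint operator in $L^2(X,\mathbb C^2)$ acting (edgewise) as $-ic\sigma_1u'+mc^2\sigma_3u$, with domain the edgewise $H^1$ spinors satisfying the Dirac-Kirchhoff condition at every vertex if $X=\mathcal G$, and $\{u=(u_1,u_2)^T\in H^1(\mathbb R_+,\mathbb C^2):u_2(0)=0\}$ if $X=\mathbb R_+$. Its spectrum does not meet $(-mc^2,mc^2)$. Put $Y_X=\mathrm{dom}(|\mathcal D_X|^{1/2})$ with norm $\|u\|_{Y_X}=\||\mathcal D_X|^{1/2}u\|_{L^2(X)}$, and $Y_X=Y_X^+\oplus Y_X^-$ the splitting into positive and negative spectral subspaces, $u=u^++u^-$. For $\lambda\in(-mc^2,mc^2)$ let $$J_{\lambda,X}(u)=\tfrac12\big(\|u^+\|_{Y_X}^2-\|u^-\|_{Y_X}^2\big)+\tfrac\lambda2\|u\|_{L^2(X)}^2-\int_XF(|u|)\,dx,$$ a $C^1$ functional on $Y_X$ (viewed as a real Hilbert space), and $$\mathcal N_{\lambda,X}=\{u\in Y_X\setminus Y_X^-: J'_{\lambda,X}(u)[u]=0,\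 J'_{\lambda,X}(u)[\eta]=0\ \forall\eta\in Y_X^-\}.$$ Then $d_\lambda(\mathcal G)=\inf_{\mathcal N_{\lambda,\mathcal G}}J_{\lambda,\mathcal G}$ and $d_\lambda^+=\inf_{\mathcal N_{\lambda,\mathbb R_+}}J_{\lambda,\mathbb R_+}$. *)

(* Defs.v *)
From HB Require Import structures.
From mathcomp Require Import all_boot all_order all_algebra.
From mathcomp Require Import complex.
From mathcomp Require Import all_classical all_reals all_analysis.

Set Implicit Arguments.
Unset Strict Implicit.
Unset Printing Implicit Defensive.
Import Order.TTheory GRing.Theory Num.Theory.
Import numFieldNormedType.Exports.

Local Open Scope classical_set_scope.
Local Open Scope complex_scope.
Local Open Scope ring_scope.

(* Shadows the homonymous operations of numClosedFieldType. *)
Local Notation Re := complex.Re.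
Local Notation Im := complex.Im.

Section Nonlinearity.
Context {R : realType}.
Implicit Types f g : R -> R.

(* The values of [f] on the negative axis are never used: at [0] the limit of
   the difference quotient is one-sided. *)
Definition C1_nonneg f := exists g,
  (forall x : R, 0 <= x ->
     (f y - f x) / (y - x) @[y --> within [set y | 0 <= y] x^'] --> g x) /\
  {within `[0, +oo[, continuous g}.

Definition primF f (t : R) : R :=
  (\int[lebesgue_measure]_(s in `[0, t]) (f s * s))%R.

Definition F1 f := f 0 = 0 /\ forall t : R, 0 <= t -> 0 <= f t.

Definition F2 f := exists p C : R,
  [/\ 2 < p, 0 < C & forall t : R, 0 <= t -> f t <= C * (1 + t `^ (p - 2))].

Definition F3 f := exists2 theta : R, 2 < theta &
  forall t : R, 0 < t -> 0 < theta * primF f t <= f t * t ^+ 2.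

Definition F4 f := forall s t : R, 0 < s -> s <= t -> f s <= f t.

End Nonlinearity.

(* An edge with both ends in the graph is bounded and its arclength coordinate
   runs over [0, len e], from its tail to its head.  An edge lacking a head
   (resp. a tail, resp. both) is a half-line [0, +oo[ (resp. a half-line
   ]-oo, 0], resp. a line); [len] is then irrelevant.  Loops and multiple
   edges are allowed. *)
Record mgraph (R : realType) := MGraph {
  vert : finType;
  edge : finType;
  tail : edge -> option vert;
  head : edge -> option vert;
  len : edge -> R;
  len_gt0 : forall e, 0 < len e }.

Section MetricGraph.
Context {R : realType} (G : mgraph R).

Definition edge_dom (e : edge G) : set R :=
  match tail e, head e with
  | Some _, Some _ => `[0, len e]
  | Some _, None => `[0, +oo[
  | None, Some _ => `]-oo, 0]
  | None, None => setT
  end.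

Definition bounded_edge (e : edge G) : bool := tail e && head e.

Definition halfline_edge (e : edge G) : bool := (tail e : bool) (+) head e.

(* An edge end is a pair (e, b), the tail end for b = false and the head end
   for b = true.  The same pair also stands for the edge e traversed from that
   end to the opposite one. *)
Definition end_vert (d : edge G * bool) : option (vert G) :=
  if d.2 then head d.1 else tail d.1.

Definition opp_vert (d : edge G * bool) : option (vert G) :=
  end_vert (d.1, ~~ d.2).

Definition end_pos (d : edge G * bool) : R :=
  if d.2 && tail d.1 then len d.1 else 0.

Definition degree (v : vert G) : nat := #|[pred d : edge G * bool | end_vert d == Some v]|.

Definition adjacent : rel (vert G) := fun v w =>
  [exists d : edge G * bool, (end_vert d == Some v) && (opp_vert d == Some w)].

Definition generalized_star : Prop :=
  [/\ forall e : edge G, bounded_edge e || halfline_edge e,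
      exists e : edge G, bounded_edge e,
      exists e : edge G, halfline_edge e,
      forall v w : vert G, connect adjacent v w
    & forall (d : edge G * bool) (v : vert G),
        halfline_edge d.1 -> end_vert d = Some v ->
        exists2 d' : edge G * bool, bounded_edge d'.1 & end_vert d' = Some v].

Definition on_graph (p : edge G * R) : Prop := edge_dom p.1 p.2.

(* [route p q r]: one can go from p to q along a path of length r. *)
Inductive route (p : edge G * R) : edge G * R -> R -> Prop :=
| route_nil : route p p 0
| route_along e x y r : route p (e, x) r -> edge_dom e y ->
    route p (e, y) (r + `|x - y|)
| route_vertex d d' v r : route p (d.1, end_pos d) r ->
    end_vert d = Some v -> end_vert d' = Some v ->
    route p (d'.1, end_pos d') r.

Definition gdist (p q : edge G * R) : \bar R :=
  ereal_inf [set r%:E | r in [set r | route p q r]].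

(* Points representing the same vertex are at distance 0, so that [phi] below
   descends to the metric space G. *)
Definition isometric_to_halfline : Prop := exists phi : edge G * R -> R,
  [/\ forall p, on_graph p -> 0 <= phi p,
      forall p q, on_graph p -> on_graph q ->
        gdist p q = (`|phi p - phi q|)%:E
    & forall r : R, 0 <= r -> exists2 p, on_graph p & phi p = r].

End MetricGraph.

(* G' is the essential reduction of G: its vertices are the vertices of G of
   degree different from 2, and its edges are the chains of edges of G linked
   through vertices of degree 2; every edge of G belongs to exactly one chain,
   exactly once. *)
Definition essential_reduction {R : realType} (G G' : mgraph R) : Prop :=
  exists (vmap : vert G' -> vert G) (chain : edge G' -> seq (edge G * bool)),
  [/\ injective vmap,
      forall v, (exists v', vmap v' = v) <-> degree v != 2,
      perm_eq (flatten [seq map fst (chain e) | e <- enum (edge G')])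
              (enum (edge G))
    & forall e : edge G', exists d s,
        [/\ chain e = d :: s,
            path (fun d1 d2 => [exists v, [&& degree v == 2,
                    opp_vert d1 == Some v & end_vert d2 == Some v]]) d s,
            end_vert d = omap vmap (tail e),
            opp_vert (last d s) = omap vmap (head e)
          & bounded_edge e -> len e = \sum_(a <- chain e) len a.1]].

(* Spinors on the disjoint union of the sets [D e]; only the values [u e x]
   with [D e x] matter, and only up to equality almost everywhere. *)
Definition spinor (R : realType) (E : finType) := E -> R -> 'cV[R[i]]_2.

Section Spinors.
Context {R : realType} {E : finType} (D : E -> set R).
Implicit Types u v w : spinor R E.

Definition sqnorm2 (z : 'cV[R[i]]_2) : R :=
  \sum_(k < 2) (Re (z k 0) ^+ 2 + Im (z k 0) ^+ 2).

Definition cint (A : set R) (h : R -> R[i]) : R[i] :=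
  (\int[lebesgue_measure]_(x in A) Re (h x))%R +i*
  (\int[lebesgue_measure]_(x in A) Im (h x))%R.

Definition inL2 u : Prop := forall e,
  (forall k : 'I_2, measurable_fun (D e) (fun x => Re (u e x k 0)) /\
                    measurable_fun (D e) (fun x => Im (u e x k 0))) /\
  (\int[lebesgue_measure]_(x in D e) (sqnorm2 (u e x))%:E < +oo)%E.

Definition aeeq u v : Prop :=
  forall e, {ae lebesgue_measure, forall x, D e x -> u e x = v e x}.

Definition inner u v : R[i] :=
  \sum_e cint (D e) (fun x => \sum_(k < 2) (u e x k 0)^* * v e x k 0).

Definition normL2 u : R := Num.sqrt (Re (inner u u)).

(* [u] is an absolutely continuous primitive of [g] on every [D e]. *)
Definition primitive_of u (g : spinor R E) : Prop :=
  forall e (k : 'I_2) x y, D e x -> D e y -> x <= y ->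
    u e y k 0 - u e x k 0 = cint `[x, y] (fun t => g e t k 0).

End Spinors.

Definition sigma1 (R : realType) : 'M[R[i]]_2 :=
  \matrix_(i, j) (i != j)%:R.

Definition sigma3 (R : realType) : 'M[R[i]]_2 :=
  \matrix_(i, j) (if i == j then (-1) ^+ i else 0).

(* Operators in L^2 are represented by their graphs, i.e. by relations.  The
   domain consists of the (classes of) edgewise H^1 spinors [u] whose
   absolutely continuous representative [ut] satisfies [bc]. *)
Definition dirac_op {R : realType} {E : finType} (D : E -> set R) (m c : R)
    (bc : spinor R E -> Prop) (u w : spinor R E) : Prop :=
  [/\ inL2 D u, inL2 D w & exists ut u' : spinor R E,
    [/\ aeeq D u ut, inL2 D u', primitive_of D ut u', bc ut
      & aeeq D w (fun e x =>
          - ('i%C * c%:C) *: (sigma1 R *m u' e x)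
          + (m * c ^+ 2)%:C *: (sigma3 R *m ut e x))]].

Definition dirac_kirchhoff {R : realType} (G : mgraph R)
    (u : spinor R (edge G)) : Prop :=
  forall v : vert G,
    (forall d d' : edge G * bool,
        end_vert d = Some v -> end_vert d' = Some v ->
        u d.1 (end_pos d) 0 0 = u d'.1 (end_pos d') 0 0) /\
    \sum_(d : edge G * bool | end_vert d == Some v)
       (if d.2 then -1 else 1) * u d.1 (end_pos d) 1 0 = 0.

Definition dirac_graph {R : realType} (G : mgraph R) (m c : R) :=
  dirac_op (@edge_dom R G) m c (@dirac_kirchhoff R G).

Definition halfline_dom {R : realType} : unit -> set R := fun=> `[0, +oo[%classic.

Definition dirac_halfline {R : realType} (m c : R) :=
  dirac_op (@halfline_dom R) m c (fun u => u tt 0 1 0 = 0).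

(* [smeas u] is the scalar measure A |-> <u, proj A u>. *)
Record projection_family (R : realType) (E : finType) := ProjectionFamily {
  proj : set R -> spinor R E -> spinor R E;
  smeas : spinor R E -> {measure set (measurableTypeR R) -> \bar R} }.

Section Spectral.
Context {R : realType} {E : finType} (D : E -> set R).
Implicit Types (u v w : spinor R E) (P : projection_family R E).

(* Everywhere defined symmetric maps are linear, so each [proj P A] is an
   orthogonal projection. *)
Definition projection_valued_measure P : Prop :=
  [/\ forall A u, measurable A -> inL2 D u -> inL2 D (proj P A u),
      forall A u v, measurable A -> inL2 D u -> inL2 D v ->
        inner D (proj P A u) v = inner D u (proj P A v),
      forall A B u, measurable A -> measurable B -> inL2 D u ->
        aeeq D (proj P A (proj P B u)) (proj P (A `&` B) u),
      forall u, inL2 D u -> aeeq D (proj P setT u) u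
    & forall A u, measurable A -> inL2 D u ->
        smeas P u A = (Re (inner D u (proj P A u)))%:E].

Definition calc_dom P (g : R -> R) u : Prop :=
  inL2 D u /\ (\int[smeas P u]_t (g t ^+ 2)%:E < +oo)%E.

(* The graph of the operator g(T) = int g dP, described through its
   sesquilinear form <v, g(T) u> = int g d<v, P u>; the complex measure
   <v, P u> is written with the polarization identity ([inner] is
   antilinear in its first argument). *)
Definition calculus P (g : R -> R) u w : Prop :=
  [/\ calc_dom P g u, inL2 D w & forall v, calc_dom P g v ->
    inner D v w = 4^-1 * \sum_(k < 4) 'i%C ^+ k *
      ((\int[smeas P (fun e x => u e x + 'i%C ^+ k *: v e x)]_t g t)%R)%:C].

Definition spectral_measure_of (T : spinor R E -> spinor R E -> Prop) P :=
  projection_valued_measure P /\ forall u w, T u w <-> calculus P idfun u w.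

(* In this section [P] is the spectral measure of the Dirac operator. *)

Definition sqrt_abs (t : R) : R := Num.sqrt `|t|.

Definition inY P u : Prop := exists w, calculus P sqrt_abs u w.

Definition normY P u : R :=
  normL2 D (xget (fun _ _ => 0) [set w | calculus P sqrt_abs u w]).

Definition pos_part P u := proj P `]0, +oo[ u.
Definition neg_part P u := proj P `]-oo, 0[ u.

Definition inYneg P u : Prop := inY P u /\ aeeq D (neg_part P u) u.

Definition action (f : R -> R) (lam : R) P u : R :=
  2^-1 * (normY P (pos_part P u) ^+ 2 - normY P (neg_part P u) ^+ 2)
  + lam / 2 * normL2 D u ^+ 2
  - \sum_e (\int[lebesgue_measure]_(x in D e)
              primF f (Num.sqrt (sqnorm2 (u e x))))%R.

(* J'(u)[eta] = 0; since J is C^1 on the form domain, J'(u)[eta] is the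
   derivative at 0 of t |-> J(u + t eta). *)
Definition critical_along f lam P u (eta : spinor R E) : Prop :=
  is_derive (0 : R) (1 : R)
    (fun t : R => action f lam P (fun e x => u e x + t%:C *: eta e x)) (0 : R).

Definition nehari f lam P u : Prop :=
  [/\ inY P u, ~ inYneg P u, critical_along f lam P u u
    & forall eta, inYneg P eta -> critical_along f lam P u eta].

(* By the spectral theorem, a self-adjoint [T] has exactly one spectral measure
   [P] (up to the choice of representatives almost everywhere), so that this is
   the infimum of the action on the Nehari set of [T]. *)
Definition action_level f lam (T : spinor R E -> spinor R E -> Prop) : \bar R :=
  ereal_inf [set j | exists2 P, spectral_measure_of T P &
                     exists2 u, nehari f lam P u & j = (action f lam P u)%:E].

End Spectral.

Definition d_graph {R : realType} (G : mgraph R) (m c : R) f lam : \bar R :=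
  action_level (@edge_dom R G) f lam (dirac_graph m c).

Definition d_halfline {R : realType} (m c : R) f lam : \bar R :=
  action_level (@halfline_dom R) f lam (dirac_halfline m c).

(* Main.v *)
From HB Require Import structures.
From mathcomp Require Import all_boot all_order all_algebra.
From mathcomp Require Import complex ring lra.
From mathcomp Require Import all_classical all_reals all_analysis measurable_realfun.
Require Import Defs.

(** The graph is a half-line in disguise, and the spinors on it are spinors on the
    half-line.

    Geometry.  A vertex of a graph isometric to the half-line has degree at most
    two, since near it there are at most two points at a given small distance
    ([isometric_degree_le2]).  The essential reduction therefore has no branching,
    and neither has the graph itself ([reduction_degree_le2]).  The chain of edges
    that contains a half-line cannot be unbounded at both extremities, because a
    line is not isometric to a half-line ([isometric_no_line]); it starts at a
    terminal vertex, and by connectedness it is the whole graph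
    ([reduction_ray_walk]).

    Operators.  Arclength along this walk cuts the half-line into the edges.  When
    the second component is negated on the edges traversed backwards, the
    Dirac-Kirchhoff condition at a vertex of degree two is continuity, and at the
    terminal vertex it is the boundary condition of the half-line
    ([kirchhoff_ray]).  Restriction and gluing are thus unitary and intertwine the
    two Dirac operators ([dirac_toGraph], [dirac_toHalf]).  They transport spectral
    measures, hence the form norms, the splitting into positive and negative parts
    and the Nehari sets ([transport_level]).

    Potential.  The integral of F(|u|) over the half-line is the sum of its
    integrals over the edges when it converges.  Convergence on the form domain is
    an embedding theorem, obtained here from the abstract spectral measure alone.
    Decompose the spectrum dyadically.  The part y of u with frequencies of order
    2^k has square norm of order 2^-k, and pairing it with the image of z under the
    operator costs at most 2^k (|z|^2 + |y|^2).  Testing with profiles z whose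
    derivative is concentrated where y is large shows that y is bounded,
    independently of k ([essential_bound_on_window]).  The frequencies up to 2^k
    therefore contribute O(k) to |u|, while the rest has square norm O(2^-k); hence
    the distribution function of |u| decays exponentially
    ([level_set_measure]), all the moments of |u| are finite
    ([moment_integrable]), and F(|u|), which has polynomial growth, is integrable
    ([primF_integrable]). *)

Set Implicit Arguments.
Unset Strict Implicit.
Unset Printing Implicit Defensive.
Import Order.TTheory GRing.Theory Num.Theory.
Import numFieldNormedType.Exports.

Local Open Scope classical_set_scope.
Local Open Scope complex_scope.
Local Open Scope ring_scope.

Local Notation Re := complex.Re.
Local Notation Im := complex.Im.
Local Notation leb := (@lebesgue_measure _).

(** * Integrals and scalar products of spinors *)

Section AlmostEverywhere.
Context {R : realType}.
Implicit Types P Q : R -> Prop.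

Lemma ae_mono P Q S : (forall x, P x -> Q x -> S x) ->
  {ae (@lebesgue_measure R), forall x, P x} ->
  {ae (@lebesgue_measure R), forall x, Q x} ->
  {ae (@lebesgue_measure R), forall x, S x}.
Proof.
move=> PQS; have F := @ae_filter_ringOfSetsType _ _ _ (@lebesgue_measure R).
by move=> p q; apply: (@filterS2 _ _ F _ _ _ PQS p q).
Qed.

Lemma ae_mono1 P Q : (forall x, P x -> Q x) ->
  {ae (@lebesgue_measure R), forall x, P x} ->
  {ae (@lebesgue_measure R), forall x, Q x}.
Proof. by move=> PQ p; apply: (ae_mono _ p p) => x + _; exact: PQ. Qed.

Lemma ae_all P : (forall x, P x) -> {ae (@lebesgue_measure R), forall x, P x}.
Proof. by move=> p; apply: aeW. Qed.

End AlmostEverywhere.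

Section RealIntegrable.
Context {R : realType} (A : set R) (mA : measurable A).
Implicit Types f g : R -> R.

Lemma intD f g : leb.-integrable A (EFin \o f) -> leb.-integrable A (EFin \o g) ->
  leb.-integrable A (EFin \o (fun x => f x + g x)).
Proof. by move=> fi gi; have := @integrableD _ _ _ leb A mA _ _ fi gi. Qed.

Lemma intZ (r : R) f : leb.-integrable A (EFin \o f) ->
  leb.-integrable A (EFin \o (fun x => r * f x)).
Proof. by move=> fi; have := @integrableZl _ _ _ leb A mA r _ fi. Qed.

Lemma int_measurable f : leb.-integrable A (EFin \o f) -> measurable_fun A f.
Proof. by move=> /integrableP[/measurable_EFinP]. Qed.

Lemma int_le f g : measurable_fun A f -> (forall x, A x -> `|f x| <= g x) ->
  leb.-integrable A (EFin \o g) -> leb.-integrable A (EFin \o f).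
Proof.
move=> mf fg; apply: le_integrable => //; first exact/measurable_EFinP.
by move=> x Ax; rewrite /= lee_fin (le_trans (fg x Ax)) // ler_norm.
Qed.

Lemma int_ge0P f : measurable_fun A f -> (forall x, A x -> 0 <= f x) ->
  leb.-integrable A (EFin \o f) <-> (\int[leb]_(x in A) (f x)%:E < +oo)%E.
Proof.
move=> mf f0.
have -> : (\int[leb]_(x in A) (f x)%:E = \int[leb]_(x in A) `|(f x)%:E|)%E.
  by apply: eq_integral => x /[!inE] Ax /=; rewrite ger0_norm // f0.
split=> [/integrableP[]//|h]; apply/integrableP; split => //.
exact/measurable_EFinP.
Qed.

Lemma eq_int f g : {in A, f =1 g} -> leb.-integrable A (EFin \o f) ->
  leb.-integrable A (EFin \o g).
Proof. by move=> fg; apply: eq_integrable => // x xA /=; rewrite fg. Qed.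

Lemma RintD f g : leb.-integrable A (EFin \o f) -> leb.-integrable A (EFin \o g) ->
  (\int[leb]_(x in A) (f x + g x) =
   \int[leb]_(x in A) f x + \int[leb]_(x in A) g x)%R.
Proof. by move=> fi gi; rewrite (@RintegralD _ _ _ leb A _ _ mA fi gi). Qed.

Lemma RintZ (r : R) f : leb.-integrable A (EFin \o f) ->
  (\int[leb]_(x in A) (r * f x) = r * \int[leb]_(x in A) f x)%R.
Proof. by move=> fi; rewrite (@RintegralZl _ _ _ leb A _ r mA fi). Qed.

Lemma integral_ae f g : measurable_fun A f -> measurable_fun A g ->
  {ae leb, forall x, A x -> f x = g x} ->
  (\int[leb]_(x in A) (f x)%:E = \int[leb]_(x in A) (g x)%:E)%E.
Proof.
move=> /measurable_EFinP mf /measurable_EFinP mg fg.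
rewrite (@ae_eq_integral _ _ _ leb A (EFin \o g) (EFin \o f) mA mf mg) //.
by apply: ae_mono1 fg => x fg Ax /=; rewrite fg.
Qed.

Lemma Rint_ae f g : measurable_fun A f -> measurable_fun A g ->
  {ae leb, forall x, A x -> f x = g x} ->
  (\int[leb]_(x in A) f x = \int[leb]_(x in A) g x)%R.
Proof. by move=> mf mg fg; rewrite /Rintegral (integral_ae mf mg fg). Qed.

End RealIntegrable.

Lemma intS {R : realType} (A B : set R) (f : R -> R) : measurable A ->
  measurable B -> B `<=` A -> leb.-integrable A (EFin \o f) ->
  leb.-integrable B (EFin \o f).
Proof. by move=> mA mB BA; exact: (@integrableS _ _ _ leb _ _ _ mA mB BA). Qed.

Section Dot.
Context {R : realType}.
Implicit Types (z w : 'cV[R[i]]_2) (a : R[i]).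

(** The real part of the hermitian product of C^2.  The action is a real
    functional, so that most of the estimates only see this part. *)
Definition dot z w : R :=
  \sum_(k < 2) (Re (z k 0) * Re (w k 0) + Im (z k 0) * Im (w k 0)).

Lemma dotC z w : dot z w = dot w z.
Proof. by apply: eq_bigr => k _; ring. Qed.

Lemma dotDl z1 z2 w : dot (z1 + z2) w = dot z1 w + dot z2 w.
Proof.
rewrite /dot -big_split; apply: eq_bigr => k _ /=; rewrite !mxE.
by case: (z1 k 0) (z2 k 0) => [a b] [c d] /=; ring.
Qed.

Lemma dotZl a z w : dot (a *: z) w =
  Re a * dot z w + Im a * dot ('i%C *: z) w.
Proof.
rewrite /dot !mulr_sumr -big_split; apply: eq_bigr => k _ /=; rewrite !mxE.
by case: (z k 0) a => [x y] [c d] /=; ring.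
Qed.

Lemma dotNl z w : dot (- z) w = - dot z w.
Proof.
rewrite /dot -sumrN; apply: eq_bigr => k _; rewrite !mxE.
by case: (z k 0) => [x y] /=; ring.
Qed.

Lemma dotZr_real (r : R) z w : dot z (r%:C *: w) = r * dot z w.
Proof. by rewrite dotC dotZl dotC /= mul0r addr0. Qed.

Lemma dotZZ a z : dot (a *: z) (a *: z) = (Re a ^+ 2 + Im a ^+ 2) * dot z z.
Proof.
rewrite /dot mulr_sumr; apply: eq_bigr => k _; rewrite !mxE.
by case: (z k 0) a => [x y] [c d] /=; ring.
Qed.

Lemma sqnorm2E z : sqnorm2 z = dot z z.
Proof. by rewrite /sqnorm2 /dot; apply: eq_bigr => k _; rewrite !expr2. Qed.

Lemma sqnorm2_ge0 z : 0 <= sqnorm2 z.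
Proof. by apply: sumr_ge0 => k _; rewrite addr_ge0 // sqr_ge0. Qed.

Lemma sqnorm2_eq0 z : sqnorm2 z = 0 -> z = 0.
Proof.
move=> /eqP; rewrite psumr_eq0; last by move=> k _; rewrite addr_ge0 ?sqr_ge0.
move=> /allP z0; apply/colP => k; rewrite mxE.
have := z0 k (mem_index_enum _); rewrite paddr_eq0 ?sqr_ge0 // !sqrf_eq0.
by case: (z k 0) => x y /= /andP[/eqP -> /eqP ->].
Qed.

Lemma dot_le z w : `|dot z w| <= (sqnorm2 z + sqnorm2 w) / 2.
Proof.
have P : 0 <= sqnorm2 (z + w) by exact: sqnorm2_ge0.
have M : 0 <= sqnorm2 (z + - w) by exact: sqnorm2_ge0.
move: P M; rewrite !sqnorm2E !dotDl ![dot _ (_ + _)]dotC !dotDl !dotNl.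
by rewrite ![dot _ (- _)]dotC !dotNl (dotC w z) ler_norml => ? ?; apply/andP; split; lra.
Qed.

Lemma sqnorm2D_le z w : sqnorm2 (z + w) <= 2 * sqnorm2 z + 2 * sqnorm2 w.
Proof.
rewrite !sqnorm2E dotDl ![dot _ (_ + _)]dotC !dotDl (dotC w z) -!sqnorm2E.
by have := dot_le z w; rewrite ler_norml => /andP[? ?]; lra.
Qed.

End Dot.

Section L2.
Context {R : realType} {E : finType} (D : E -> set R).
Context (mD : forall e, measurable (D e)).
Implicit Types u v w : spinor R E.

Definition rinner u v : R :=
  \sum_e (\int[leb]_(x in D e) dot (u e x) (v e x))%R.

(** The imaginary part of the hermitian product is again a real scalar product,
    after a rotation of the first argument: every fact on [inner] reduces to
    facts on [rinner]. *)
Lemma innerE u v :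
  inner D u v = rinner u v +i* rinner (fun e x => 'i%C *: u e x) v.
Proof.
rewrite /inner /rinner; apply/eqP; rewrite eq_complex /=; apply/andP; split.
  rewrite raddf_sum /=; apply/eqP; apply: eq_bigr => e _; rewrite /cint /=.
  apply: eq_Rintegral => x _; rewrite raddf_sum; apply: eq_bigr => k _ /=.
  by case: (u e x k 0) (v e x k 0) => [a b] [c d] /=; ring.
rewrite raddf_sum /=; apply/eqP; apply: eq_bigr => e _; rewrite /cint /=.
apply: eq_Rintegral => x _; rewrite raddf_sum; apply: eq_bigr => k _ /=.
by rewrite mxE; case: (u e x k 0) (v e x k 0) => [a b] [c d] /=; ring.
Qed.

Lemma Re_inner u v : Re (inner D u v) = rinner u v.
Proof. by rewrite innerE. Qed.

Lemma measurable_dot u v e : inL2 D u -> inL2 D v ->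
  measurable_fun (D e) (fun x => dot (u e x) (v e x)).
Proof.
move=> /(_ e)[mu _] /(_ e)[mv _]; rewrite /dot.
apply: measurable_sum => k; have [mu1 mu2] := mu k; have [mv1 mv2] := mv k.
by apply: measurable_funD; apply: measurable_funM.
Qed.

Lemma inL2_int u e : inL2 D u ->
  leb.-integrable (D e) (EFin \o (fun x => sqnorm2 (u e x))).
Proof.
move=> uL; apply/int_ge0P => //; last by have [] := uL e.
  have := measurable_dot (e := e) uL uL.
  by apply: eq_measurable_fun => x _; rewrite sqnorm2E.
by move=> x _; exact: sqnorm2_ge0.
Qed.

Lemma dot_int u v e : inL2 D u -> inL2 D v ->
  leb.-integrable (D e) (EFin \o (fun x => dot (u e x) (v e x))).
Proof.
move=> uL vL; apply: (@int_le _ _ (mD e) _ (fun x => 1 * sqnorm2 (u e x) + sqnorm2 (v e x))) => //.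
- exact: measurable_dot.
- move=> x _; rewrite (le_trans (dot_le _ _)) //.
  by have := sqnorm2_ge0 (u e x); have := sqnorm2_ge0 (v e x); lra.
- by apply: intD => //; [apply: intZ => //|]; exact: inL2_int.
Qed.

Lemma inL2_intro u :
  (forall e (k : 'I_2), measurable_fun (D e) (fun x => Re (u e x k 0)) /\
                    measurable_fun (D e) (fun x => Im (u e x k 0))) ->
  (forall e, exists2 g, leb.-integrable (D e) (EFin \o g) &
     forall x, D e x -> sqnorm2 (u e x) <= g x) -> inL2 D u.
Proof.
move=> mu gu e; split => //; have [g gi gu1] := gu e.
have ms : measurable_fun (D e) (fun x => sqnorm2 (u e x)).
  rewrite /sqnorm2; apply: measurable_sum => k; have [mu1 mu2] := mu e k.
  by apply: measurable_funD; exact: measurable_funX.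
apply/int_ge0P => //; first by move=> x _; exact: sqnorm2_ge0.
apply: int_le gi => // x Dx; rewrite ger0_norm ?sqnorm2_ge0 //; exact: gu1.
Qed.

Lemma inL2D u v : inL2 D u -> inL2 D v -> inL2 D (fun e x => u e x + v e x).
Proof.
move=> uL vL; apply: inL2_intro => e.
  have [mu fu] := uL e; have [mv fv] := vL e.
  move=> k; have [mu1 mu2] := mu k; have [mv1 mv2] := mv k; split.
    have := measurable_funD mu1 mv1; apply: eq_measurable_fun => x _ /=.
    by rewrite mxE raddfD.
  have := measurable_funD mu2 mv2; apply: eq_measurable_fun => x _ /=.
  by rewrite mxE raddfD.
exists (fun x => 2 * sqnorm2 (u e x) + 2 * sqnorm2 (v e x)).
  by apply: intD => //; apply: intZ => //; exact: inL2_int.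
by move=> x _; exact: sqnorm2D_le.
Qed.

Lemma inL2Z a u : inL2 D u -> inL2 D (fun e x => a *: u e x).
Proof.
move=> uL; apply: inL2_intro => e.
  move=> k; have [mu fu] := uL e; have [mu1 mu2] := mu k; split.
    have := measurable_funB (measurable_funM (@measurable_cst _ _ _ _ _ (Re a)) mu1)
                (measurable_funM (@measurable_cst _ _ _ _ _ (Im a)) mu2).
    apply: eq_measurable_fun => x _ /=.
    by rewrite mxE; case: a (u e x k 0) => [p q] [r s].
  have := measurable_funD (measurable_funM (@measurable_cst _ _ _ _ _ (Re a)) mu2)
              (measurable_funM (@measurable_cst _ _ _ _ _ (Im a)) mu1).
  apply: eq_measurable_fun => x _ /=.
  by rewrite mxE; case: a (u e x k 0) => [p q] [r s] /=; ring.
exists (fun x => (Re a ^+ 2 + Im a ^+ 2) * sqnorm2 (u e x)).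
  by apply: intZ => //; exact: inL2_int.
by move=> x _; rewrite !sqnorm2E dotZZ.
Qed.

Lemma rinnerC u v : rinner u v = rinner v u.
Proof. by apply: eq_bigr => e _; apply: eq_Rintegral => x _; exact: dotC. Qed.

Lemma rinnerDl u1 u2 v : inL2 D u1 -> inL2 D u2 -> inL2 D v ->
  rinner (fun e x => u1 e x + u2 e x) v = rinner u1 v + rinner u2 v.
Proof.
move=> u1L u2L vL; rewrite /rinner -big_split; apply: eq_bigr => e _ /=.
have i1 := dot_int e u1L vL; have i2 := dot_int e u2L vL.
rewrite -RintD //.
by apply: eq_Rintegral => x _; rewrite dotDl.
Qed.

Lemma rinnerDr u v1 v2 : inL2 D u -> inL2 D v1 -> inL2 D v2 ->
  rinner u (fun e x => v1 e x + v2 e x) = rinner u v1 + rinner u v2.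
Proof. by move=> *; rewrite rinnerC rinnerDl // !(rinnerC u). Qed.

Lemma rinnerZl a u v : inL2 D u -> inL2 D v ->
  rinner (fun e x => a *: u e x) v =
  Re a * rinner u v + Im a * rinner (fun e x => 'i%C *: u e x) v.
Proof.
move=> uL vL; have iuL := inL2Z 'i%C uL.
rewrite /rinner !mulr_sumr -big_split; apply: eq_bigr => e _ /=.
have i1 := dot_int e uL vL; have i2 := dot_int e iuL vL.
have j1 := intZ (mD e) (Re a) i1; have j2 := intZ (mD e) (Im a) i2.
rewrite -!RintZ // -RintD //.
by apply: eq_Rintegral => x _; rewrite dotZl.
Qed.

Lemma rinnerZZ a u : inL2 D u ->
  rinner (fun e x => a *: u e x) (fun e x => a *: u e x) =
  (Re a ^+ 2 + Im a ^+ 2) * rinner u u.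
Proof.
move=> uL; rewrite /rinner mulr_sumr; apply: eq_bigr => e _.
rewrite -RintZ //; last exact: dot_int.
by apply: eq_Rintegral => x _; rewrite dotZZ.
Qed.

Lemma rinner_ge0 u : 0 <= rinner u u.
Proof.
apply: sumr_ge0 => e _; apply: Rintegral_ge0 => x _.
by rewrite -sqnorm2E sqnorm2_ge0.
Qed.

Lemma rinner_eq0 u : inL2 D u -> rinner u u = 0 -> aeeq D u (fun _ _ => 0).
Proof.
move=> uL /eqP; rewrite psumr_eq0; last first.
  by move=> e _; apply: Rintegral_ge0 => x _; rewrite -sqnorm2E sqnorm2_ge0.
move=> /allP z0 e; have /eqP := z0 e (mem_index_enum _).
rewrite -[X in _ = X]/(fine 0%E) /Rintegral => /eqP.
have fi := @integrable_fin_num _ _ _ leb _ (mD e) _ (dot_int e uL uL).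
rewrite -eqe !fineK // => /eqP i0.
have : (\int[leb]_(x in D e) `|(EFin \o (fun x => dot (u e x) (u e x))) x| = 0)%E.
  rewrite -[RHS]i0; apply: eq_integral => x _ /=.
  by rewrite ger0_norm // -sqnorm2E sqnorm2_ge0.
have md : measurable_fun (D e) (EFin \o (fun x => dot (u e x) (u e x))).
  by apply/measurable_EFinP; exact: measurable_dot.
have [+ _] := @ae_eq_integral_abs _ _ _ leb _ (mD e) _ md.
move=> /[apply]; apply: ae_mono1 => x /= /[apply] -[].
by rewrite -sqnorm2E => /sqnorm2_eq0.
Qed.

Lemma eq_aeeq u v : (forall e x, D e x -> u e x = v e x) -> aeeq D u v.
Proof. by move=> h e; apply: ae_all => x; exact: h. Qed.

Lemma aeeq_refl u : aeeq D u u.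
Proof. exact: eq_aeeq. Qed.

Lemma aeeq_sym u v : aeeq D u v -> aeeq D v u.
Proof. by move=> h e; apply: ae_mono1 (h e) => x + Dx => ->. Qed.

Lemma aeeq_trans u v w : aeeq D u v -> aeeq D v w -> aeeq D u w.
Proof.
by move=> h1 h2 e; apply: ae_mono (h1 e) (h2 e) => x a b Dx; rewrite a // b.
Qed.

Lemma aeeqD u v u' v' : aeeq D u u' -> aeeq D v v' ->
  aeeq D (fun e x => u e x + v e x) (fun e x => u' e x + v' e x).
Proof.
by move=> h1 h2 e; apply: ae_mono (h1 e) (h2 e) => x a b Dx; rewrite a // b.
Qed.

Lemma aeeqZ a u u' : aeeq D u u' ->
  aeeq D (fun e x => a *: u e x) (fun e x => a *: u' e x).
Proof. by move=> h1 e; apply: ae_mono1 (h1 e) => x a' Dx; rewrite a'. Qed.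

Lemma eq_rinner u v u' v' : inL2 D u -> inL2 D v -> inL2 D u' -> inL2 D v' ->
  aeeq D u u' -> aeeq D v v' -> rinner u v = rinner u' v'.
Proof.
move=> uL vL uL' vL' hu hv; apply: eq_bigr => e _; apply: Rint_ae => //;
  [exact: measurable_dot|exact: measurable_dot|].
by apply: ae_mono (hu e) (hv e) => x a b Dx /=; rewrite a // b.
Qed.

Lemma eq_inner u v u' v' : inL2 D u -> inL2 D v -> inL2 D u' -> inL2 D v' ->
  aeeq D u u' -> aeeq D v v' -> inner D u v = inner D u' v'.
Proof.
move=> uL vL uL' vL' hu hv; rewrite !innerE (eq_rinner uL vL uL' vL') //.
rewrite (@eq_rinner _ v (fun e x => 'i%C *: u' e x) v') //;
  by [exact: inL2Z|exact: aeeqZ].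
Qed.

(** Spinors are only known up to negligible sets, and testing against all of
    L^2 is the way in which the identities between projections are obtained
    below. *)
Lemma rinner_inj u v : inL2 D u -> inL2 D v ->
  (forall w, inL2 D w -> rinner u w = rinner v w) -> aeeq D u v.
Proof.
move=> uL vL h; have nvL := inL2Z (-1) vL; have dL := inL2D uL nvL.
have : rinner (fun e x => u e x + -1 *: v e x) (fun e x => u e x + -1 *: v e x) = 0.
  by rewrite rinnerDl // rinnerZl //= h //; ring.
move=> /(rinner_eq0 dL) h0 e; apply: ae_mono1 (h0 e) => x h1 Dx.
by have := h1 Dx; rewrite scaleN1r => /subr0_eq.
Qed.

End L2.

(** * Projection-valued measures *)

Section MoreL2.
Context {R : realType} {E : finType} (D : E -> set R).
Context (mD : forall e, measurable (D e)).
Implicit Types u v w : spinor R E.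

Lemma rinnerNr u v : inL2 D u -> inL2 D v ->
  rinner D u (fun e x => -1 *: v e x) = - rinner D u v.
Proof. by move=> uL vL; rewrite rinnerC (rinnerZl mD _ vL uL) (rinnerC D v) /=; ring. Qed.

Lemma rinnerBB u v : inL2 D u -> inL2 D v ->
  rinner D (fun e x => u e x + -1 *: v e x) (fun e x => u e x + -1 *: v e x) =
  rinner D u u + rinner D v v - 2 * rinner D u v.
Proof.
move=> uL vL; have nL := inL2Z mD (-1) vL; have dL := inL2D mD uL nL.
rewrite (rinnerDl mD uL nL dL) (rinnerDr mD uL uL nL) (rinnerDr mD nL uL nL).
rewrite rinnerZZ // (rinnerZl mD _ vL uL) (rinnerC D u) (rinnerZl mD _ vL uL).
by rewrite (rinnerC D v) /=; ring.
Qed.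

Lemma rinnerDD u v : inL2 D u -> inL2 D v ->
  rinner D (fun e x => u e x + v e x) (fun e x => u e x + v e x) =
  rinner D u u + rinner D v v + 2 * rinner D u v.
Proof.
move=> uL vL; have dL := inL2D mD uL vL.
rewrite (rinnerDl mD uL vL dL) (rinnerDr mD uL uL vL) (rinnerDr mD vL uL vL).
by rewrite (rinnerC D v u); ring.
Qed.

End MoreL2.

Section SpectralFamily.
Context {R : realType} {E : finType} (D : E -> set R).
Context (mD : forall e, measurable (D e)).
Context (P : projection_family R E) (hP : projection_valued_measure D P).
Implicit Types (u v w : spinor R E) (A B : set R).

Lemma projL2 A u : measurable A -> inL2 D u -> inL2 D (proj P A u).
Proof. by case: hP => + _ _ _ _; apply. Qed.

Lemma proj_inner A u v : measurable A -> inL2 D u -> inL2 D v ->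
  inner D (proj P A u) v = inner D u (proj P A v).
Proof. by case: hP => _ + _ _ _; apply. Qed.

Lemma proj_rinner A u v : measurable A -> inL2 D u -> inL2 D v ->
  rinner D (proj P A u) v = rinner D u (proj P A v).
Proof. by move=> *; rewrite -!Re_inner proj_inner. Qed.

Lemma proj_irinner A u v : measurable A -> inL2 D u -> inL2 D v ->
  rinner D (fun e x => 'i%C *: proj P A u e x) v =
  rinner D (fun e x => 'i%C *: u e x) (proj P A v).
Proof. by move=> mA uL vL; have := proj_inner mA uL vL; rewrite !innerE => -[]. Qed.

Lemma proj_comp A B u : measurable A -> measurable B -> inL2 D u ->
  aeeq D (proj P A (proj P B u)) (proj P (A `&` B) u).
Proof. by case: hP => _ _ + _ _; apply. Qed.

(** A projection family is a family of maps on representatives, not on classes;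
    symmetry makes these maps compatible with almost everywhere equality, and
    linear. *)
Lemma proj_aeeq A u v : measurable A -> inL2 D u -> inL2 D v -> aeeq D u v ->
  aeeq D (proj P A u) (proj P A v).
Proof.
move=> mA uL vL uv; apply: (rinner_inj mD); [exact: projL2|exact: projL2|].
move=> w wL; rewrite !proj_rinner //.
by apply: (eq_rinner mD) => //; [exact: projL2|exact: projL2|exact: aeeq_refl].
Qed.

Lemma projD A u v : measurable A -> inL2 D u -> inL2 D v ->
  aeeq D (proj P A (fun e x => u e x + v e x))
         (fun e x => proj P A u e x + proj P A v e x).
Proof.
move=> mA uL vL; have uvL := inL2D mD uL vL.
have uL' := projL2 mA uL; have vL' := projL2 mA vL.
apply: (rinner_inj mD); [exact: projL2|exact: inL2D|].
move=> w wL; have wL' := projL2 mA wL.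
by rewrite proj_rinner // (rinnerDl mD uL vL wL') (rinnerDl mD uL' vL' wL) !(proj_rinner mA).
Qed.

Lemma projZ A a u : measurable A -> inL2 D u ->
  aeeq D (proj P A (fun e x => a *: u e x)) (fun e x => a *: proj P A u e x).
Proof.
move=> mA uL; have auL := inL2Z mD a uL; have uL' := projL2 mA uL.
apply: (rinner_inj mD); [exact: projL2|exact: inL2Z|].
move=> w wL; have wL' := projL2 mA wL.
by rewrite proj_rinner // (rinnerZl mD a uL wL') (rinnerZl mD a uL' wL) (proj_rinner mA) // (proj_irinner mA).
Qed.

Lemma rinner_proj2 A B u : measurable A -> measurable B -> inL2 D u ->
  rinner D (proj P A u) (proj P B u) = rinner D u (proj P (A `&` B) u).
Proof.
move=> mA mB uL; rewrite proj_rinner //; last exact: projL2.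
apply: (eq_rinner mD) => //; try by do ?apply: projL2 => //; exact: measurableI.
  exact: aeeq_refl.
exact: proj_comp.
Qed.

Lemma smeasE A u : measurable A -> inL2 D u ->
  smeas P u A = (rinner D u (proj P A u))%:E.
Proof. by case: hP => _ _ _ _ h mA uL; rewrite h // Re_inner. Qed.

Lemma smeas_norm A u : measurable A -> inL2 D u ->
  smeas P u A = (rinner D (proj P A u) (proj P A u))%:E.
Proof. by move=> mA uL; rewrite smeasE // rinner_proj2 // setIid. Qed.

Lemma smeasT u : inL2 D u -> smeas P u setT = (rinner D u u)%:E.
Proof.
move=> uL; rewrite smeasE //; congr EFin; case: hP => _ _ _ hT _.
by apply: (eq_rinner mD) => //; [exact: projL2|exact: aeeq_refl|exact: hT].
Qed.

Lemma smeas_le A u : measurable A -> inL2 D u ->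
  (smeas P u A <= (rinner D u u)%:E)%E.
Proof. by move=> mA uL; rewrite -smeasT //; apply: le_measure; rewrite ?inE. Qed.

Lemma smeas_aeeq A u v : measurable A -> inL2 D u -> inL2 D v -> aeeq D u v ->
  smeas P u A = smeas P v A.
Proof.
move=> mA uL vL uv; rewrite !smeasE //; congr EFin.
by apply: (eq_rinner mD) => //; [exact: projL2|exact: projL2|exact: proj_aeeq].
Qed.

Lemma smeas_proj A B u : measurable A -> measurable B -> inL2 D u ->
  smeas P (proj P A u) B = smeas P u (A `&` B).
Proof.
move=> mA mB uL; have mAB := measurableI _ _ mA mB.
have uL' := projL2 mA uL; rewrite !smeas_norm //; congr EFin.
apply: (eq_rinner mD); try by do ?apply: projL2 => //; exact: measurableI.
  by rewrite setIC; exact: proj_comp.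
by rewrite setIC; exact: proj_comp.
Qed.

Lemma smeasZ A a u : measurable A -> inL2 D u ->
  smeas P (fun e x => a *: u e x) A = ((Re a ^+ 2 + Im a ^+ 2)%:E * smeas P u A)%E.
Proof.
move=> mA uL; have auL := inL2Z mD a uL; have uL' := projL2 mA uL.
rewrite !smeas_norm // -EFinM -(rinnerZZ mD) //; congr EFin.
by apply: (eq_rinner mD); do ?[exact: projL2|exact: inL2Z|exact: projZ].
Qed.

(** Both terms of the left-hand side are nonnegative measures, so that each of
    them is controlled by the measures of [u] and [v]; this is what makes the
    domains of the functional calculus stable under sums. *)
Lemma smeas_parallelogram A u v : measurable A -> inL2 D u -> inL2 D v ->
  (smeas P (fun e x => u e x + v e x)%R A +
   smeas P (fun e x => u e x + -1 *: v e x)%R A =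
   smeas P u A + smeas P u A + (smeas P v A + smeas P v A))%E.
Proof.
move=> mA uL vL; have nL := inL2Z mD (-1) vL.
have uL' := projL2 mA uL; have vL' := projL2 mA vL.
have dL := inL2D mD uL nL; have sL := inL2D mD uL vL.
have nL' := inL2Z mD (-1) vL'.
have dL' := inL2D mD uL' nL'; have sL' := inL2D mD uL' vL'.
rewrite !smeas_norm // -!EFinD; congr EFin.
have dE : aeeq D (proj P A (fun e x => u e x + -1 *: v e x))
                 (fun e x => proj P A u e x + -1 *: proj P A v e x).
  apply: aeeq_trans (projD mA uL nL) _; apply: aeeqD; first exact: aeeq_refl.
  exact: projZ.
have sE := projD mA uL vL.
rewrite (eq_rinner mD (projL2 mA sL) (projL2 mA sL) sL' sL' sE sE).
rewrite (eq_rinner mD (projL2 mA dL) (projL2 mA dL) dL' dL' dE dE).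
by rewrite rinnerDD // rinnerBB //; ring.
Qed.

(** The square norm of the difference is computed with the spectral measure of
    [u], which is additive. *)
Lemma proj_additive A B u : measurable A -> measurable B -> inL2 D u ->
  A `&` B = set0 ->
  aeeq D (proj P (A `|` B) u) (fun e x => proj P A u e x + proj P B u e x).
Proof.
move=> mA mB uL AB0; have mU := measurableU _ _ mA mB.
have AL := projL2 mA uL; have BL := projL2 mB uL; have UL := projL2 mU uL.
have sL := inL2D mD AL BL; have dL := inL2D mD UL (inL2Z mD (-1) sL).
have N0 C F : measurable C -> measurable F ->
    rinner D (proj P C u) (proj P F u) = fine (smeas P u (C `&` F)).
  by move=> mC mF; rewrite rinner_proj2 // smeasE //; exact: measurableI.
have : rinner D
   (fun e x => proj P (A `|` B) u e x + -1 *: (proj P A u e x + proj P B u e x))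
   (fun e x => proj P (A `|` B) u e x + -1 *: (proj P A u e x + proj P B u e x)) = 0.
  rewrite rinnerBB // rinnerDD // (rinnerDr mD UL AL BL) !N0 // !setIid AB0.
  rewrite (setIidr (@subsetUl _ A B)) (setIidr (@subsetUr _ A B)) measure0.
  have : smeas P u (A `|` B) = (smeas P u A + smeas P u B)%E by rewrite measureU.
  by rewrite !smeasE // -EFinD => -[->] /=; ring.
move=> /(rinner_eq0 mD dL) h0 e; apply: ae_mono1 (h0 e) => x h1 Dx.
by have := h1 Dx; rewrite scaleN1r => /subr0_eq.
Qed.

End SpectralFamily.

(** * Functional calculus and the form norm *)

Section Calculus.
Context {R : realType} {E : finType} (D : E -> set R).
Context (mD : forall e, measurable (D e)).
Context (P : projection_family R E) (hP : projection_valued_measure D P).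
Context (g : R -> R) (mg : measurable_fun setT g).
Implicit Types (u v w : spinor R E) (A B : set R).

Let mg2 : measurable_fun setT (fun t => (g t ^+ 2)%:E).
Proof. by apply/measurable_EFinP; exact: measurable_funX. Qed.

Lemma calc_dom_aeeq u v : inL2 D v -> aeeq D u v -> calc_dom D P g u ->
  calc_dom D P g v.
Proof.
move=> vL uv [uL fin]; split => //; apply: le_lt_trans fin.
rewrite le_eqVlt; apply/orP; left; apply/eqP.
by apply: eq_measure_integral => A mA _; apply: (smeas_aeeq mD hP) => //; exact: aeeq_sym.
Qed.

Lemma calc_domD u v : calc_dom D P g u -> calc_dom D P g v ->
  calc_dom D P g (fun e x => u e x + v e x).
Proof.
move=> [uL fu] [vL fv]; have dL := inL2D mD uL vL; split => //.
set s1 := smeas P _; pose s2 := smeas P (fun e x => u e x + -1 *: v e x).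
have g0 (t : R) : setT t -> (0 <= (g t ^+ 2)%:E)%E by rewrite lee_fin sqr_ge0.
have : (\int[measure_add s1 s2]_t (g t ^+ 2)%:E =
  \int[measure_add (measure_add (smeas P u) (smeas P u))
                   (measure_add (smeas P v) (smeas P v))]_t (g t ^+ 2)%:E)%E.
  apply: eq_measure_integral => A mA _.
  transitivity (s1 A + s2 A)%E; first exact: measure_addE.
  rewrite (smeas_parallelogram mD hP) //.
  by apply/esym/(etrans (measure_addE _ _ _)); congr adde; exact: measure_addE.
rewrite !ge0_integral_measure_add // => h.
have : (\int[s1]_t (g t ^+ 2)%:E + \int[s2]_t (g t ^+ 2)%:E < +oo)%E.
  by rewrite h; apply: lte_add_pinfty; apply: lte_add_pinfty.
by apply: le_lt_trans; rewrite leeDl // integral_ge0.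
Qed.

Lemma calc_domZ a u : calc_dom D P g u -> calc_dom D P g (fun e x => a *: u e x).
Proof.
move=> [uL fu]; split; first exact: inL2Z.
have g0 (t : R) : setT t -> (0 <= (g t ^+ 2)%:E)%E by rewrite lee_fin sqr_ge0.
have k0 : 0 <= Re a ^+ 2 + Im a ^+ 2 by rewrite addr_ge0 ?sqr_ge0.
rewrite [ltLHS](_ : _ = \int[mscale (NngNum k0) (smeas P u)]_t (g t ^+ 2)%:E)%E.
  by rewrite ge0_integral_mscale //= lte_mul_pinfty // lee_fin.
by apply: eq_measure_integral => A mA _; rewrite (smeasZ mD hP).
Qed.

Lemma calc_dom_proj A (M : R) u : measurable A -> inL2 D u ->
  (forall t, A t -> `|g t| <= M) -> calc_dom D P g (proj P A u).
Proof.
move=> mA uL gM; have uL' := projL2 hP mA uL; split => //.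
have g0 (t : R) : setT t -> (0 <= (g t ^+ 2)%:E)%E by rewrite lee_fin sqr_ge0.
have mC : measurable (~` A) by exact: measurableC.
have -> : (\int[smeas P (proj P A u)]_t (g t ^+ 2)%:E =
    \int[smeas P (proj P A u)]_(t in A) (g t ^+ 2)%:E)%E.
  have AC : [disjoint A & ~` A] by apply/disj_setPS => x [].
  have mU : measurable_fun (A `|` ~` A) (fun t => (g t ^+ 2)%:E) by rewrite setUv.
  have g0U (t : R) : (A `|` ~` A) t -> (0 <= (g t ^+ 2)%:E)%E by rewrite lee_fin sqr_ge0.
  have := @ge0_integral_setU _ _ _ (smeas P (proj P A u)) A (~` A) mA mC _ mU g0U AC.
  rewrite setUv => ->; rewrite [X in (_ + X)%E]null_set_integral ?adde0 //.
    exact: measurable_funTS.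
  by rewrite (smeas_proj mD hP) // setICr measure0.
have mgA : measurable_fun A (fun t => (g t ^+ 2)%:E) by exact: measurable_funTS.
have : (\int[smeas P (proj P A u)]_(t in A) `|(g t ^+ 2)%:E| <=
        (M ^+ 2)%:E * smeas P (proj P A u) A)%E.
  apply: integral_le_bound => //; first by rewrite lee_fin sqr_ge0.
  apply: aeW => t At; rewrite lee_fin ger0_norm ?sqr_ge0 // -[g t ^+ 2]real_normK ?num_real //.
  by rewrite lerXn2r ?nnegrE // ?gM // (le_trans _ (gM t At)).
under eq_integral do rewrite gee0_abs ?lee_fin ?sqr_ge0 //.
move=> h; apply: le_lt_trans h _.
by rewrite (smeasE hP) // -EFinM ltry.
Qed.

(** The spectral truncations to the sets where [g] is bounded lie in the domain;
    testing with the truncations of the difference of two candidates shows that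
    its spectral measure vanishes on each of these sets, hence everywhere. *)
Lemma calculus_unique u w1 w2 : calculus D P g u w1 -> calculus D P g u w2 ->
  aeeq D w1 w2.
Proof.
move=> [_ w1L h1] [_ w2L h2].
have nL := inL2Z mD (-1) w2L; have dL := inL2D mD w1L nL.
set d := (fun e x => _) in dL.
pose A N := [set t | `|g t| <= N%:R].
have mA N : measurable (A N).
  rewrite -[A N]setTI; apply: measurable_fun_le => //.
  by apply: measurableT_comp.
have sA N : smeas P d (A N) = 0%E.
  have cd : calc_dom D P g (proj P (A N) d).
    by apply: (calc_dom_proj (M := N%:R)).
  have pL := projL2 hP (mA N) dL.
  have : inner D (proj P (A N) d) w1 = inner D (proj P (A N) d) w2.
    by rewrite h1 // h2.
  rewrite !innerE => -[e _].
  rewrite (smeasE hP) // (rinnerC D) (rinnerDr mD pL w1L nL) e.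
  by rewrite (rinnerNr mD) // subrr.
have : smeas P d setT = 0%E.
  have -> : [set: R] = \bigcup_N A N.
    apply/seteqP; split => // t _; exists (Num.bound `|g t|) => //=.
    by rewrite /A /= ltW // archi_boundP.
  apply/negligibleP; first exact: bigcupT_measurable.
  by apply: negligible_bigcup => N; apply/negligibleP; [exact: mA|exact: sA].
rewrite (smeasT mD hP) // => -[] /(rinner_eq0 mD dL) h0 e.
apply: ae_mono1 (h0 e) => x h Dx.
by have := h Dx; rewrite /d scaleN1r => /subr0_eq.
Qed.

End Calculus.

Section NormY.
Context {R : realType} {E : finType} (D : E -> set R).
Context (mD : forall e, measurable (D e)).
Context (P : projection_family R E) (hP : projection_valued_measure D P).
Implicit Types (u v w : spinor R E) (A B : set R).

Lemma measurable_sqrt_abs : measurable_fun setT (@sqrt_abs R).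
Proof.
apply: continuous_measurable_fun => t.
apply: (@continuous_comp _ _ _ (@Num.norm R R) (@Num.sqrt R)).
  exact: norm_continuous.
exact: sqrt_continuous.
Qed.

Lemma normL2E u : normL2 D u = Num.sqrt (rinner D u u).
Proof. by rewrite /normL2 Re_inner. Qed.

Lemma normY_calculus u w : calculus D P (@sqrt_abs R) u w -> normY D P u = normL2 D w.
Proof.
move=> uw; have := @xgetI _ (fun=> fun=> 0) [set w | calculus D P (@sqrt_abs R) u w] w uw.
rewrite /normY; set w' := xget _ _ => /= uw'; rewrite !normL2E; congr Num.sqrt.
have e := calculus_unique mD hP measurable_sqrt_abs uw' uw.
case: uw uw' => _ wL _ [_ wL' _].
exact: (eq_rinner mD).
Qed.

(** The default value: outside of the form domain the norm is that of the zero
    spinor chosen by [xget]. *)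
Lemma normY_none u : ~ (exists w, calculus D P (@sqrt_abs R) u w) -> normY D P u = 0.
Proof.
move=> h; rewrite /normY xgetPN; last by move=> w uw; apply: h; exists w.
rewrite normL2E /rinner big1 ?sqrtr0 // => e _.
have -> : (fun=> dot 0 0) = (fun=> 0) :> (R -> R).
  by apply/funext => x; rewrite /dot big1 // => k _; rewrite !mxE /=; ring.
by rewrite /Rintegral integral0.
Qed.

End NormY.

(** * Spectral localization *)

(** Only the real part of the polarization identity is used below, and it
    involves the spectral measures of [u + v] and [u - v] alone. *)
Lemma Re_polarization_sum (R : realType) (F : nat -> R) :
  Re (\sum_(k < 4) 'i%C ^+ k * (F k)%:C) = F 0%N - F 2%N.
Proof.
rewrite !big_ord_recl big_ord0; set a := F _; set b := F _; set c := F _; set d := F _.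
rewrite [_ ^+ lift _ (lift _ _)]sqr_i expr0 expr1.
rewrite [_ ^+ _](_ : _ = - 'i%C); last by rewrite /= !exprS expr0; simpc.
by simpc; rewrite /a /c /=; ring.
Qed.

Section Window.
Context {R : realType} {E : finType} (D : E -> set R).
Context (mD : forall e, measurable (D e)).
Context (P : projection_family R E) (hP : projection_valued_measure D P).
Implicit Types (u v w z : spinor R E).

Lemma calc_dom_integrable u : calc_dom D P idfun u ->
  (smeas P u).-integrable setT (EFin \o (@idfun R)).
Proof.
move=> [uL fu].
have m2 : measurable_fun setT (fun t : R => (t ^+ 2)%:E).
  by apply/measurable_EFinP; exact: measurable_funX.
apply/integrableP; split; first by apply/measurable_EFinP; exact: measurable_id.
have : (\int[smeas P u]_t (1%:E + (t ^+ 2)%:E) < +oo)%E.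
  rewrite ge0_integralD //; last by move=> t _; rewrite lee_fin sqr_ge0.
  apply: lte_add_pinfty => //; rewrite integral_cst // mul1e.
  by rewrite (smeasT mD hP) // ltry.
apply: le_lt_trans; apply: ge0_le_integral => //.
- by apply: measurableT_comp => //; apply/measurable_EFinP; exact: measurable_id.
- exact: emeasurable_funD.
- move=> t _; rewrite /= -EFinD lee_fin -[t ^+ 2]real_normK ?num_real //.
  by have := sqr_ge0 (`|t| - 1); rewrite sqrrB expr1n mulr1; have := normr_ge0 t; lra.
Qed.

(** A perturbation of [u] with spectrum in [A] does not change the spectral
    measure outside of [A], and inside of [A] the integrand is at most [M]; in
    the polarization identity the contributions of the complement of [A] thus
    cancel, although they need not be small. *)
Lemma window_split (A : set R) (M : R) u v a : measurable A ->
  (forall t, A t -> `|t| <= M) -> 0 <= M ->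
  calc_dom D P idfun u -> inL2 D v ->
  let x := (fun e y => u e y + a *: proj P A v e y) in
  exists2 r, (\int[smeas P x]_t t = \int[smeas P u]_(t in ~` A) t + r)%R &
             `|r| <= M * rinner D x x.
Proof.
move=> mA AM M0 ud vL x; have [uL _] := ud.
have pd : calc_dom D P idfun (proj P A v) by exact: (calc_dom_proj mD hP _ mA vL AM).
have pL := projL2 hP mA vL.
have xd : calc_dom D P idfun x.
  have mi : measurable_fun setT (@idfun R) by exact: measurable_id.
  exact: (calc_domD mD hP mi ud (calc_domZ mD hP mi a pd)).
have [xL _] := xd; have xi := calc_dom_integrable xd.
have mC : measurable (~` A) by exact: measurableC.
exists (\int[smeas P x]_(t in A) t)%R.
  have -> : (\int[smeas P u]_(t in ~` A) t = \int[smeas P x]_(t in ~` A) t)%R.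
    congr fine; apply: eq_measure_integral => B mB BA.
    apply: esym; rewrite !(smeas_norm mD hP) //; congr EFin.
    have N0 : aeeq D (proj P B (proj P A v)) (fun _ _ => 0).
      apply: (rinner_eq0 mD); first by do 2!apply: (projL2 hP) => //.
      have : smeas P (proj P A v) B = 0%E.
        rewrite (smeas_proj mD hP) // (_ : A `&` B = set0) ?measure0 //.
        by apply/disjoints_subset => t At Bt; exact: BA Bt At.
      by rewrite (smeas_norm mD hP) // => -[].
    have e1 : aeeq D (proj P B x) (proj P B u).
      apply: aeeq_trans (projD mD hP mB uL (inL2Z mD a pL)) _ => e.
      apply: ae_mono (projZ mD hP a mB pL e) (N0 e) => y e1 e2 Dy.
      by rewrite e1 // e2 // scaler0 addr0.
    by apply: (eq_rinner mD (projL2 hP mB xL) (projL2 hP mB xL) (projL2 hP mB uL) (projL2 hP mB uL)).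
  rewrite addrC; have AC : [disjoint A & ~` A] by apply/disj_setPS => t [].
  have := @Rintegral_setU _ _ _ (smeas P x) A (~` A) idfun mA mC _ AC.
  by rewrite setUv; apply.
have xiA : (smeas P x).-integrable A (EFin \o (@idfun R)).
  by apply: (integrableS _ _ _ xi).
rewrite -lee_fin (EFin_normr_Rintegral _ xiA) //.
apply: le_trans (le_abse_integral _ _ _) _ => //; first exact: (measurable_int _ xiA).
have : (\int[smeas P x]_(t in A) `|t%:E| <= M%:E * smeas P x A)%E.
  apply: integral_le_bound; [exact: mA| |by rewrite lee_fin|].
    by apply/measurable_EFinP; exact: measurable_id.
  by apply: aeW => t At; rewrite lee_fin AM.
move=> h; apply: le_trans h _; rewrite EFinM lee_pmul ?lee_fin //.
exact: (smeas_le mD hP).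
Qed.

(** On the spectral subspace of a window contained in [[-M, M]] the operator is
    bounded by [M]; stated for the pairing with an arbitrary [z] of the domain,
    whose image [w] under the operator is then moved to the other side. *)
Lemma window_bound (A : set R) (M : R) z w v : measurable A ->
  (forall t, A t -> `|t| <= M) -> 0 <= M ->
  calculus D P idfun z w -> inL2 D v ->
  `|rinner D (proj P A v) w| <=
    M / 2 * (rinner D z z + rinner D (proj P A v) (proj P A v)).
Proof.
move=> mA AM M0 [zd wL zw] vL; have [zL _] := zd.
have pd : calc_dom D P idfun (proj P A v) by exact: (calc_dom_proj mD hP _ mA vL AM).
have pL := projL2 hP mA vL.
have hw := congr1 (@complex.Re _) (zw _ pd); move: hw; rewrite Re_inner.
have -> : (4^-1 : R[i]) = (4^-1)%:C by rewrite fmorphV rmorph_nat.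
have [F FE] : exists F : nat -> R, forall k, F k =
  (\int[smeas P (fun e y => z e y + 'i%C ^+ k *: proj P A v e y)]_t t)%R.
  by exists (fun k => \int[smeas P (fun e y => z e y + 'i%C ^+ k *: proj P A v e y)]_t t)%R.
rewrite (eq_bigr (fun k : 'I_4 => 'i%C ^+ k * (F k)%:C)); last by move=> k _; rewrite FE.
move=> hw.
have {}hw : rinner D (proj P A v) w = 4^-1 * (F 0%N - F 2%N).
  by rewrite hw -Re_polarization_sum; case: (\sum_(k < 4) _) => p q /=; ring.
have [r0 e0] := window_split ('i%C ^+ 0) mA AM M0 zd vL.
rewrite -FE in e0.
have -> : (fun e y => z e y + 'i%C ^+ 0 *: proj P A v e y) =
          (fun e y => z e y + proj P A v e y).
  by apply/funext => e; apply/funext => y; rewrite expr0 scale1r.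
have [r2 e2] := window_split ('i%C ^+ 2) mA AM M0 zd vL.
rewrite -FE in e2; rewrite sqr_i (rinnerBB mD) // (rinnerDD mD) // hw e0 e2.
move: (rinner D z z) (rinner D z _) (rinner D _ _) => p q r.
rewrite !ler_norml => /andP[? ?] /andP[? ?].
by apply/andP; split; lra.
Qed.

End Window.

(** * Profiles with prescribed derivative *)

Lemma leb_le {R : realType} (A B : set R) : measurable A -> measurable B ->
  A `<=` B -> (leb A <= leb B)%E.
Proof. by move=> mA mB AB; apply: le_measure; rewrite ?inE. Qed.

Lemma int_indic {R : realType} (F G : set R) : measurable F -> measurable G ->
  (leb F < +oo)%E -> leb.-integrable G (EFin \o (\1_F : R -> R)).
Proof.
move=> mF mG Ffin; have m1 : measurable_fun G (\1_F : R -> R) by exact: measurable_indic.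
apply/(int_ge0P m1) => //; rewrite integral_indic //.
by apply: le_lt_trans Ffin; apply: leb_le => //; exact: measurableI.
Qed.

Section CumulativeShare.
Context {R : realType}.
Context (F : set R) (a b : R).
Context (mF : measurable F) (Fab : F `<=` `[a, b]) (F0 : (0 < leb F)%E).

Definition mass : R := fine (leb F).

Lemma mass_fin : leb F \is a fin_num.
Proof.
rewrite ge0_fin_numE //; apply: le_lt_trans (_ : leb `[a, b] < +oo)%E.
  exact: leb_le.
by rewrite lebesgue_measure_itv; case: ifP => // _; rewrite -EFinB ltry.
Qed.

Lemma mass_gt0 : 0 < mass.
Proof. by rewrite fine_gt0 // F0 ltey_eq mass_fin. Qed.

(** The fraction of the mass of [F] that lies to the left of [x]: a Lipschitz
    function, rising from 0 to 1 across [[a, b]] when [a] is nonnegative, whose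
    derivative is concentrated on the arbitrary measurable set [F]. *)
Definition share x : R := fine (leb (F `&` `[0, x])) / mass.
Definition share_density x : R := \1_F x / mass.

Let sub_fin (G : set R) : measurable G -> G `<=` F -> leb G \is a fin_num.
Proof.
move=> mG GF; rewrite ge0_fin_numE //; apply: le_lt_trans (_ : leb F < +oo)%E.
  exact: leb_le.
by rewrite -ge0_fin_numE // mass_fin.
Qed.

Let mI (x : R) : measurable (F `&` `[0, x]).
Proof. by apply: measurableI. Qed.

Lemma share_ge0 x : 0 <= share x.
Proof. by rewrite divr_ge0 ?fine_ge0 // ltW ?mass_gt0. Qed.

Lemma share_le1 x : share x <= 1.
Proof.
rewrite ler_pdivrMr ?mass_gt0 // mul1r fine_le ?mass_fin //.
  by apply: sub_fin => // y [].
by apply: leb_le => //; move=> y [].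
Qed.

Lemma share_homo : {homo share : x y / x <= y}.
Proof.
move=> x y xy; rewrite ler_pM2r ?invr_gt0 ?mass_gt0 //.
apply: fine_le; try by apply: sub_fin => // z [].
apply: leb_le; [exact: mI|exact: mI|].
by apply: setIS => z /=; rewrite !in_itv /= => /andP[-> /le_trans]; apply.
Qed.

Lemma share_before x : x < a -> share x = 0.
Proof.
move=> xa; rewrite /share (_ : _ `&` _ = set0) ?measure0 ?mul0r //.
apply/disjoints_subset => y /Fab /=; rewrite !in_itv /= => /andP[ay _].
by apply/negP; rewrite negb_and -!ltNge (lt_le_trans xa ay) orbT.
Qed.

Lemma share_after x : 0 <= a -> b <= x -> share x = 1.
Proof.
move=> a0 bx; rewrite /share (_ : _ `&` _ = F) ?divff ?gt_eqF ?mass_gt0 //.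
apply/setIidl => y /Fab /=; rewrite !in_itv /= => /andP[ay yb].
by rewrite (le_trans a0 ay) (le_trans yb bx).
Qed.

Lemma share_density_int (G : set R) : measurable G ->
  leb.-integrable G (EFin \o share_density).
Proof.
move=> mG; have H : leb.-integrable G (EFin \o (\1_F : R -> R)).
  by apply: int_indic => //; rewrite -ge0_fin_numE // mass_fin.
have := intZ mG mass^-1 H.
by apply: (eq_int mG) => x _; rewrite mulrC.
Qed.

Lemma Rint_share_density (G : set R) : measurable G ->
  (\int[leb]_(x in G) share_density x)%R = fine (leb (F `&` G)) / mass.
Proof.
move=> mG; transitivity (\int[leb]_(x in G) (mass^-1 * \1_F x))%R.
  by apply: eq_Rintegral => x _; rewrite mulrC.
rewrite RintZ //; last first.
  by apply: int_indic => //; rewrite -ge0_fin_numE // mass_fin.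
by rewrite /Rintegral integral_indic // mulrC.
Qed.

Lemma share_primitive x y : 0 <= x -> x <= y ->
  share y - share x = (\int[leb]_(t in `[x, y]) share_density t)%R.
Proof.
move=> x0 xy; rewrite -Rintegral_itv_obnd_cbnd; last exact: share_density_int.
rewrite Rint_share_density // -mulrBl; congr (_ / _).
rewrite -fineB; try by apply: sub_fin => // z [].
congr fine; have -> : F `&` `[0, y] = (F `&` `[0, x]) `|` (F `&` `]x, y]).
  rewrite -setIUr; congr (_ `&` _); apply/seteqP; split => z /=; rewrite !in_itv /=.
    by move=> /andP[-> zy]; case: (leP z x) => zx; [left|right].
  move=> [/andP[-> /le_trans ->]//|/andP[xz ->]].
  by rewrite (le_trans x0 (ltW xz)).
have mJ : measurable (F `&` `]x, y]) by apply: measurableI.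
have -> : (leb (F `&` `[0%R, x] `|` F `&` `]x, y]) =
           leb (F `&` `[0%R, x]) + leb (F `&` `]x, y]))%E.
  apply: measureU; [exact: mI|exact: mJ|].
  apply/disjoints_subset => z [_ /=]; rewrite in_itv /= => /andP[_ zx] [_ /=].
  by rewrite in_itv /= ltNge zx.
have fx : leb (F `&` `[0%R, x]) \is a fin_num by apply: sub_fin; [exact: mI|move=> z []].
by rewrite addeAC subee ?add0e.
Qed.

End CumulativeShare.

(** * Boundedness of frequency-localized spinors on the half-line *)

Section DiracTest.
Context {R : realType}.
Implicit Types (v q : 'cV[R[i]]_2) (h : R -> R).

Lemma ord2P (P : 'I_2 -> Prop) : P 0 -> P 1 -> forall k, P k.
Proof.
move=> p0 p1 [[|[|//]] i]; first by rewrite (_ : Ordinal i = 0) //; exact: val_inj.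
by rewrite (_ : Ordinal i = 1) //; exact: val_inj.
Qed.

Lemma sigma1E v k : (sigma1 R *m v) k 0 = v (1 - k) 0.
Proof.
rewrite !mxE !big_ord_recl big_ord0 !mxE; elim/ord2P: k => /=.
  by rewrite mul0r add0r addr0 mul1r; congr (v _ 0); exact: val_inj.
by rewrite mul1r mul0r addr0 addr0; congr (v _ 0); exact: val_inj.
Qed.

Lemma sigma3E v k : (sigma3 R *m v) k 0 = (-1) ^+ k * v k 0.
Proof.
rewrite !mxE !big_ord_recl big_ord0 !mxE; elim/ord2P: k => /=.
  by rewrite mul0r addr0 addr0.
by rewrite mul0r add0r addr0; congr (_ * v _ 0); exact: val_inj.
Qed.

Lemma sqnorm2_2 v : sqnorm2 v =
  Re (v 0 0) ^+ 2 + Im (v 0 0) ^+ 2 + (Re (v 1 0) ^+ 2 + Im (v 1 0) ^+ 2).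
Proof.
rewrite /sqnorm2 !big_ord_recl big_ord0 addr0; congr (_ + (Re (v _ 0) ^+ 2 + Im (v _ 0) ^+ 2));
  exact: val_inj.
Qed.

Lemma sqnorm2_sigma1 v : sqnorm2 (sigma1 R *m v) = sqnorm2 v.
Proof.
rewrite !sqnorm2_2 !sigma1E addrC.
by rewrite (_ : 1 - 1 = 0 :> 'I_2) ?subr0 //; exact: val_inj.
Qed.

Lemma sqnorm2_sigma3 v : sqnorm2 (sigma3 R *m v) = sqnorm2 v.
Proof.
by rewrite !sqnorm2_2 !sigma3E expr0 expr1 mul1r mulN1r; case: (v 1 0) => x y /=; ring.
Qed.

Lemma sigma11 v : sigma1 R *m (sigma1 R *m v) = v.
Proof. by apply/colP => k; rewrite !sigma1E; congr (v _ 0); ring. Qed.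

Lemma sqnorm2Z (a : R[i]) v : sqnorm2 (a *: v) = (Re a ^+ 2 + Im a ^+ 2) * sqnorm2 v.
Proof. by rewrite !sqnorm2E dotZZ. Qed.

Lemma inL2_real {E : finType} (D : E -> set R) (h : E -> R -> R) v :
  (forall e, measurable (D e)) -> (forall e, measurable_fun (D e) (h e)) ->
  (forall e, leb.-integrable (D e) (EFin \o (fun x => h e x ^+ 2))) ->
  inL2 D (fun e x => (h e x)%:C *: v).
Proof.
move=> mD mh h2; apply: (inL2_intro mD) => e.
  move=> k; split.
    have := measurable_funM (mh e) (@measurable_cst _ _ _ _ (D e) (Re (v k 0))).
    apply: eq_measurable_fun => x _ /=; rewrite mxE.
    by case: (v k 0) => p q /=; ring.
  have := measurable_funM (mh e) (@measurable_cst _ _ _ _ (D e) (Im (v k 0))).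
  apply: eq_measurable_fun => x _ /=; rewrite mxE.
  by case: (v k 0) => p q /=; ring.
exists (fun x => sqnorm2 v * h e x ^+ 2); first exact: intZ.
by move=> x _; rewrite sqnorm2Z /= expr0n addr0 mulrC.
Qed.

Lemma measurable_halfline e : measurable (@halfline_dom R e).
Proof. by rewrite /halfline_dom; exact: measurable_itv. Qed.

(** A scalar profile vanishing at 0, times a fixed vector, lies in the domain of
    the operator on the half-line whatever the vector, since it satisfies the
    boundary condition. *)
Lemma dirac_halfline_test (m c : R) (z' zt : R -> R) v :
  leb.-integrable (@halfline_dom R tt) (EFin \o z') ->
  leb.-integrable (@halfline_dom R tt) (EFin \o (fun x => z' x ^+ 2)) ->
  leb.-integrable (@halfline_dom R tt) (EFin \o (fun x => zt x ^+ 2)) ->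
  measurable_fun (@halfline_dom R tt) zt -> zt 0 = 0 ->
  (forall x y, 0 <= x -> x <= y -> zt y - zt x = (\int[leb]_(t in `[x, y]) z' t)%R) ->
  dirac_halfline m c (fun _ x => (zt x)%:C *: v)
    (fun _ x => (c * z' x)%:C *: (- 'i%C *: (sigma1 R *m v)) +
                (m * c ^+ 2 * zt x)%:C *: (sigma3 R *m v)).
Proof.
move=> i1 i2 j2 mz z0 prim.
have mz' : measurable_fun (@halfline_dom R tt) z' by exact: int_measurable i1.
have mD := measurable_halfline.
have zL : inL2 halfline_dom (fun (_ : unit) x => (zt x)%:C *: v) by exact: inL2_real.
have z'L : inL2 halfline_dom (fun (_ : unit) x => (z' x)%:C *: v) by exact: inL2_real.
split; [exact: zL| |].
  apply: (inL2D mD); apply: inL2_real => //.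
  - by move=> e; apply: measurable_funM => //; exact: measurable_cst.
  - move=> e; have := intZ (mD tt) (c ^+ 2) i2.
    by apply: eq_int => // x _; rewrite [RHS]exprMn.
  - by move=> e; apply: measurable_funM => //; exact: measurable_cst.
  - move=> e; have := intZ (mD tt) ((m * c ^+ 2) ^+ 2) j2.
    by apply: eq_int => // x _; rewrite [RHS]exprMn.
exists (fun _ x => (zt x)%:C *: v), (fun _ x => (z' x)%:C *: v); split; [exact: aeeq_refl|exact: z'L| | |].
- move=> e k x y; rewrite /halfline_dom /= !in_itv /= !andbT => x0 y0 xy.
  rewrite !mxE -mulrBl -rmorphB prim //.
  have i' : leb.-integrable `[x, y] (EFin \o z').
    apply: (intS (mD tt) _ _ i1) => // t; rewrite /halfline_dom /= !in_itv /= andbT => /andP[+ _].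
    exact: le_trans.
  rewrite /cint; case Ev : (v k 0) => [p q].
  apply/eqP; rewrite eq_complex /=; apply/andP; split; apply/eqP.
    transitivity ((\int[leb]_(t in `[x, y]) (p * z' t))%R).
      by rewrite RintZ //; ring.
    by apply: eq_Rintegral => t _; rewrite mxE Ev /=; ring.
  transitivity ((\int[leb]_(t in `[x, y]) (q * z' t))%R).
    by rewrite RintZ //; ring.
  by apply: eq_Rintegral => t _; rewrite mxE Ev /=; ring.
- by rewrite z0 mxE /= mul0r.
- apply: eq_aeeq => e x _; rewrite -!scalemxAr !scalerA; congr (_ *: _ + _ *: _).
    by rewrite rmorphM /=; ring.
  by rewrite !rmorphM.
Qed.

Lemma rinner_halfline (u v : spinor R unit) : rinner halfline_dom u v =
  (\int[leb]_(x in @halfline_dom R tt) dot (u tt x) (v tt x))%R.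
Proof. by rewrite /rinner (bigD1 tt) //= big1 ?addr0 // => -[]. Qed.

Lemma measurable_dot_cst {E : finType} (D : E -> set R) (u : spinor R E) q e :
  inL2 D u -> measurable_fun (D e) (fun x => dot (u e x) q).
Proof.
move=> /(_ e)[mu _]; rewrite /dot; apply: measurable_sum => k.
by have [? ?] := mu k; apply: measurable_funD; apply: measurable_funM => //;
  exact: measurable_cst.
Qed.

(** The pointwise lower bound of the pairing of [y] with the image of the test
    spinor.  The term in [dF] is the gain on the set where the component of [y]
    along [q] exceeds [K]; the terms in [dJ] and [zt] are estimated with the
    arithmetic-geometric inequality, [sqnorm2 y] being weighted by [1 / l]
    because it is of order [l] in the mean. *)
Lemma test_pointwise (m c l K dF dJ zt : R) (y q e : 'cV[R[i]]_2) :
  0 < m -> 0 < c -> 0 < l -> sqnorm2 q = 1 -> sqnorm2 e = 1 ->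
  0 <= dJ -> dJ <= l^-1 -> K * dF <= dF * dot y q ->
  c * K * dF + (- (c / 2) * dJ +
   ((- (c / (2 * l) + m * c ^+ 2 / 2)) * sqnorm2 y + - (m * c ^+ 2 / 2) * zt ^+ 2)) <=
  dot y ((c * (dF - dJ))%:C *: q + (m * c ^+ 2 * zt)%:C *: e).
Proof.
move=> m0 c0 l0 q1 e1 dJ0 dJl d3.
have -> : dot y ((c * (dF - dJ))%:C *: q + (m * c ^+ 2 * zt)%:C *: e) =
    c * (dF - dJ) * dot y q + m * c ^+ 2 * zt * dot y e.
  by rewrite -!dotZr_real !(dotC y) dotDl.
have d1 : `|dot y q| <= (sqnorm2 y + 1) / 2 by have := dot_le y q; rewrite q1.
have d2 : - ((sqnorm2 y + zt ^+ 2) / 2) <= zt * dot y e.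
  have := dot_le y (zt%:C *: e).
  by rewrite dotZr_real sqnorm2Z e1 /= expr0n /= addr0 mulr1 ler_norml => /andP[].
have s0 := sqnorm2_ge0 y.
move: (sqnorm2 y) (dot y q) (dot y e) d1 d2 d3 s0 => S p r d1 d2 d3 s0.
have d4 : dJ * p <= dJ / 2 + S / (2 * l).
  apply: le_trans (_ : dJ * ((S + 1) / 2) <= _).
    by rewrite ler_wpM2l // (le_trans (ler_norm _)).
  have := ler_wpM2r s0 dJl => h.
  have -> : S / (2 * l) = l^-1 * S / 2 by field; rewrite gt_eqF.
  by lra.
have d5 := ler_wpM2l (ltW c0) d3; have d6 := ler_wpM2l (ltW c0) d4.
have mc0 : 0 <= m * c ^+ 2 by rewrite mulr_ge0 ?sqr_ge0 // ltW.
have d7 := ler_wpM2l mc0 d2.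
have eS : c * (S / (2 * l)) = c / (2 * l) * S by ring.
rewrite mulrDr eS in d6.
move: (m * c ^+ 2) (c / (2 * l)) d6 d7 {mc0 eS} => M L d6 d7.
have -> : M * zt * r = M * (zt * r) by ring.
lra.
Qed.

Lemma test_arith (p1 p2 B M N Z c : R) : p1 <= B -> p2 <= 1 ->
  M * N <= M * B -> M * Z <= M * 1 -> c * p1 <= c * B -> 0 < c ->
  p2 + p1 < ((1 + B) * (c / 2 + 1 + M / 2) + c) * 1 +
  (- (c / 2) * 1 + (- (c * p1) / 2 - M * N / 2 + - (M * Z) / 2)).
Proof.
move=> h1 h2 h3 h4 h5 c0.
have -> : (1 + B) * (c / 2 + 1 + M / 2) = c / 2 + c * B / 2 + (1 + B) + M / 2 + M * B / 2.
  by ring.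
move: h3 h4 h5; rewrite mulr1; move: (M * N) (M * B) (M * Z) (c * p1) (c * B) => a b d e f.
by move=> *; lra.
Qed.

Section SupBound.
Context (m c : R) (m0 : 0 < m) (c0 : 0 < c) (y : spinor R unit) (B l a : R).
Context (a0 : 0 <= a) (l0 : 0 < l) (l1 : l <= 1) (B0 : 0 <= B).
Context (yL : inL2 (@halfline_dom R) y).
Context (yB : rinner (@halfline_dom R) y y <= B * l).
Context (yT : forall z w, dirac_halfline m c z w ->
  `|rinner halfline_dom y w| <= l^-1 * (rinner halfline_dom z z + rinner halfline_dom y y)).
Context (q : 'cV[R[i]]_2) (q1 : sqnorm2 q = 1).

Let H : set R := @halfline_dom R tt.
Let mH : measurable H. Proof. exact: measurable_halfline. Qed.
Let J : set R := `[a, a + l]%classic.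
Let mJ : measurable J. Proof. exact: measurable_itv. Qed.
Let JH : J `<=` H.
Proof.
move=> x; rewrite /J /H /halfline_dom /= !in_itv /= andbT => /andP[+ _].
exact: le_trans.
Qed.

(** The size of a spinor of square norm at most [B * l] and of frequency at most
    [1 / l]; the point is that it does not depend on [l], which is the scaling
    of the form norm in dimension one. *)
Definition sup_const : R := (1 + B) * (2^-1 + c^-1 + m * c / 2) + 1.

Let F : set R := J `&` [set x | sup_const < dot (y tt x) q].
Let mF : measurable F.
Proof.
have -> : F = J `&` (H `&` (fun x => dot (y tt x) q) @^-1` `]sup_const, +oo[).
  apply/seteqP; split => x [Jx h]; split => //.
    by split; [exact: JH|rewrite /= in_itv /= andbT].
  by case: h => _; rewrite /= in_itv /= andbT.
by apply: measurableI => //; apply: measurable_dot_cst yL _ _ _ => //; exact: measurable_itv.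
Qed.

Let lebJ : leb J = l%:E.
Proof.
rewrite /J lebesgue_measure_itv /= lte_fin ltrDl l0 -EFinD.
by congr EFin; ring.
Qed.

(** If the component of [y] along [q] exceeded [sup_const] on a nonnegligible
    subset [F] of the interval [J] of length [l], the profile with derivative
    (density of [F]) - (density of [J]) would be a test spinor of square norm at
    most [l], for which the pairing with [y] would exceed the bound that the
    frequency localization of [y] imposes. *)
Lemma essential_bound_on_window : leb F = 0%E.
Proof.
apply/eqP; apply/negPn/negP => /negP Fn0.
have F0 : (0 < leb F)%E by rewrite lt0e measure_ge0 andbT; apply/negP.
have J0 : (0 < leb J)%E by rewrite lebJ lte_fin.
have FJ : F `<=` J by move=> x [].
have JJ : J `<=` J by [].
have FH : F `<=` H by exact: subset_trans JH.
have mJl : mass J = l by rewrite /mass lebJ.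
have mF0 := mass_gt0 mF FJ F0.
pose dF := share_density F; pose dJ := share_density J.
pose phi x := dF x - dJ x; pose zt x := share F x - share J x.
(* The direction for which the derivative of the profile is paired with [q]. *)
pose eps := 'i%C *: (sigma1 R *m q) : 'cV_2.
have iF : leb.-integrable H (EFin \o dF) by have := share_density_int mF FJ mH.
have iJ : leb.-integrable H (EFin \o dJ) by have := share_density_int mJ JJ mH.
have mdF := int_measurable iF; have mdJ := int_measurable iJ.
have dF0 x : 0 <= dF x by rewrite /dF /share_density divr_ge0 // ltW.
have dFm x : dF x * dF x = (mass F)^-1 * dF x.
  by rewrite /dF /share_density indicE; case: (x \in F) => /=; ring.
have dJm x : dJ x * dJ x = l^-1 * dJ x.
  by rewrite /dJ /share_density mJl indicE; case: (x \in J) => /=; ring.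
have dJ0 x : 0 <= dJ x by rewrite /dJ /share_density mJl divr_ge0 // ltW.
have dJl x : dJ x <= l^-1.
  rewrite /dJ /share_density mJl indicE; case: (x \in J) => /=; rewrite ?mul1r //.
  by rewrite mul0r invr_ge0 ltW.
have iphi : leb.-integrable H (EFin \o phi).
  by have := intD mH iF (intZ mH (-1) iJ); apply: (eq_int mH) => x _ /=; rewrite mulN1r.
have iphi2 : leb.-integrable H (EFin \o (fun x => phi x ^+ 2)).
  have := intD mH (intZ mH (2 * (mass F)^-1) iF) (intZ mH (2 * l^-1) iJ).
  apply: (int_le mH); first by apply: measurable_funX; exact: measurable_funB.
  move=> x _; rewrite ger0_norm ?sqr_ge0 // -!mulrA -dFm -dJm /phi.
  by have := sqr_ge0 (dF x + dJ x); rewrite !expr2; lra.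
have mzt : measurable_fun H zt.
  apply: measurable_funB.
    by have h := share_homo mF FJ F0; apply: nondecreasing_measurable.
  by have h := share_homo mJ JJ J0; apply: nondecreasing_measurable.
have zt2 x : H x -> zt x ^+ 2 <= l * dJ x.
  rewrite /H /halfline_dom /= in_itv /= andbT => x0.
  have [xa|ax] := ltP x a.
    rewrite /zt (share_before FJ xa) (share_before JJ xa) subrr expr0n /=.
    by rewrite mulr_ge0 // ltW.
  have [xb|bx] := leP x (a + l); last first.
    rewrite /zt (share_after mF FJ F0 a0 (ltW bx)) (share_after mJ JJ J0 a0 (ltW bx)).
    by rewrite subrr expr0n /= mulr_ge0 // ltW.
  have -> : l * dJ x = 1.
    rewrite /dJ /share_density mJl indicE mem_set; last by rewrite /J /= in_itv /= ax xb.
    by rewrite mulrC mul1r mulVf ?gt_eqF.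
  rewrite -[_ ^+ 2]real_normK ?num_real // expr_le1 // ler_norml.
  have := share_ge0 F x; have := share_le1 mF FJ F0 x.
  have := share_ge0 J x; have := share_le1 mJ JJ J0 x.
  by rewrite /zt => ? ? ? ?; apply/andP; split; lra.
have izt2 : leb.-integrable H (EFin \o (fun x => zt x ^+ 2)).
  have := intZ mH l iJ; apply: (int_le mH); first exact: measurable_funX.
  by move=> x Hx; rewrite ger0_norm ?sqr_ge0 //; exact: zt2.
have z0 : zt 0 = 0.
  have sh0 (G : set R) : measurable G -> share G 0 = 0.
    move=> mG; have mG0 : measurable (G `&` `[0, 0]) by exact: measurableI.
    have h : (leb (G `&` `[0%R, 0%R]) <= leb [set 0%R : R])%E.
      by apply: leb_le => //; move=> x [_]; rewrite set_itv1.
    move: h; rewrite lebesgue_measure_set1 measure_le0 => /eqP h.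
    by rewrite /share h mul0r.
  by rewrite /zt !sh0 // subrr.
have prim s t : 0 <= s -> s <= t -> zt t - zt s = (\int[leb]_(x in `[s, t]) phi x)%R.
  move=> s0 st; have mst : measurable `[s, t] by exact: measurable_itv.
  have i1 := share_density_int mF FJ mst; have i2 := share_density_int mJ JJ mst.
  transitivity (\int[leb]_(x in `[s, t]) (dF x + -1 * dJ x))%R; last first.
    by apply: eq_Rintegral => x _; rewrite mulN1r.
  rewrite (RintD mst i1 (intZ mst (-1) i2)) RintZ // /zt.
  by rewrite -(share_primitive mF FJ s0 st) -(share_primitive mJ JJ s0 st); ring.
pose z : spinor R unit := fun _ x => (zt x)%:C *: eps.
have zw := dirac_halfline_test m c eps iphi iphi2 izt2 mzt z0 prim.
have e1 : sqnorm2 eps = 1 by rewrite sqnorm2Z sqnorm2_sigma1 q1 /= !expr2; ring.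
have e3 : sqnorm2 (sigma3 R *m eps) = 1 by rewrite sqnorm2_sigma3.
have eq : - 'i%C *: (sigma1 R *m eps) = q.
  by rewrite -scalemxAr scalerA sigma11 mulNr -expr2 sqr_i opprK scale1r.
move: (yT zw); rewrite eq; set w := (fun _ _ => _); move=> yw.
have Fint : (\int[leb]_(x in H) dF x = 1)%R.
  by rewrite (Rint_share_density mF FJ mH) (setIidl FH) divff // gt_eqF.
have Jint : (\int[leb]_(x in H) dJ x = 1)%R.
  by rewrite (Rint_share_density mJ JJ mH) (setIidl JH) -/(mass J) mJl divff // gt_eqF.
have Nl := yB; set N := rinner halfline_dom y y in Nl yw.
set Z := (\int[leb]_(x in H) zt x ^+ 2)%R.
have ZE : rinner halfline_dom z z = Z.
  rewrite rinner_halfline; apply: eq_Rintegral => x _.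
  by rewrite -sqnorm2E sqnorm2Z e1 /=; ring.
have Zl : Z <= l.
  have := intZ mH l iJ => ilJ.
  apply: le_trans (_ : (\int[leb]_(x in H) (l * dJ x))%R <= _).
    exact: (@le_Rintegral _ _ _ leb H _ _ mH izt2 ilJ zt2).
  by rewrite RintZ // Jint mulr1.
have yi : leb.-integrable H (EFin \o (fun x => sqnorm2 (y tt x))).
  by have := inL2_int tt yL.
have Nint : (\int[leb]_(x in H) sqnorm2 (y tt x) = N)%R.
  by rewrite /N rinner_halfline; apply: eq_Rintegral => x _; rewrite sqnorm2E.
have [_ wL _] := zw; rewrite eq -/w in wL.
pose G x := c * sup_const * dF x + (- (c / 2) * dJ x +
   ((- (c / (2 * l) + m * c ^+ 2 / 2)) * sqnorm2 (y tt x) + - (m * c ^+ 2 / 2) * zt x ^+ 2)).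
have iG3 := intD mH (intZ mH (- (c / (2 * l) + m * c ^+ 2 / 2)) yi) (intZ mH (- (m * c ^+ 2 / 2)) izt2).
have iG2 := intD mH (intZ mH (- (c / 2)) iJ) iG3.
have iG : leb.-integrable H (EFin \o G) := intD mH (intZ mH (c * sup_const) iF) iG2.
have GE : (\int[leb]_(x in H) G x)%R = c * sup_const * 1 + (- (c / 2) * 1 +
   ((- (c / (2 * l) + m * c ^+ 2 / 2)) * N + - (m * c ^+ 2 / 2) * Z)).
  rewrite (RintD mH (intZ mH (c * sup_const) iF) iG2) (RintZ mH _ iF) Fint.
  rewrite (RintD mH (intZ mH (- (c / 2)) iJ) iG3) (RintZ mH _ iJ) Jint.
  rewrite (RintD mH (intZ mH (- (c / (2 * l) + m * c ^+ 2 / 2)) yi) (intZ mH (- (m * c ^+ 2 / 2)) izt2)).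
  by rewrite (RintZ mH _ yi) Nint (RintZ mH _ izt2).
have Gle : (\int[leb]_(x in H) G x)%R <= rinner halfline_dom y w.
  rewrite rinner_halfline.
  have iyw := dot_int measurable_halfline tt yL wL.
  apply: (@le_Rintegral _ _ _ leb H _ _ mH iG iyw) => x Hx.
  apply: (test_pointwise (zt x) m0 c0 l0 q1 e3 (dJ0 x) (dJl x)).
  rewrite mulrC {1 2}/dF /share_density indicE.
  have [xF|xF] := boolP (x \in F); last by rewrite /= !mul0r.
  rewrite ler_wpM2l ?divr_ge0 ?ltW //.
  by move: xF; rewrite inE => -[_ /=].
have {}yw : rinner halfline_dom y w <= l^-1 * (Z + N) by rewrite -ZE (le_trans (ler_norm _)).
have := le_trans Gle yw; rewrite GE; apply/negP; rewrite -ltNge.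
have n1 : l^-1 * N <= B by rewrite mulrC ler_pdivrMr.
have n2 : l^-1 * Z <= 1 by rewrite mulrC ler_pdivrMr // mul1r.
have n3 : N <= B by rewrite (le_trans Nl) // ler_piMr.
have n4 : Z <= 1 by exact: le_trans l1.
have mc0 : 0 < m * c ^+ 2 by rewrite mulr_gt0 // exprn_gt0.
have k1 : m * c ^+ 2 * N <= m * c ^+ 2 * B by rewrite ler_pM2l.
have k2 : m * c ^+ 2 * Z <= m * c ^+ 2 * 1 by rewrite ler_pM2l.
have k3 : c * (l^-1 * N) <= c * B by rewrite ler_pM2l.
have -> : c * sup_const = (1 + B) * (c / 2 + 1 + m * c ^+ 2 / 2) + c.
  by rewrite /sup_const; field; rewrite gt_eqF.
have -> : - (c / (2 * l) + m * c ^+ 2 / 2) * N =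
    - (c * (l^-1 * N)) / 2 - (m * c ^+ 2 * N) / 2 by field; rewrite gt_eqF.
have -> : - (m * c ^+ 2 / 2) * Z = - (m * c ^+ 2 * Z) / 2 by ring.
rewrite mulrDr; move: n1 n2 k1 k2 k3.
move: (l^-1 * N) (l^-1 * Z) (m * c ^+ 2 * N) (m * c ^+ 2 * Z) (m * c ^+ 2) => p1 p2 p3 p4 M.
move=> h1 h2 h3 h4 h5; exact: test_arith.
Qed.

End SupBound.
End DiracTest.

(** * Polynomial against geometric growth *)

Section PolynomialGeometric.
Context {R : realType}.

Lemma bernoulli_ineq (d : R) k : 0 <= d -> 1 + k%:R * d <= (1 + d) ^+ k.
Proof.
move=> d0; elim: k => [|k IH]; first by rewrite mul0r addr0 expr0.
rewrite exprS -natr1; have := ler_wpM2l (addr_ge0 ler01 d0) IH; apply: le_trans.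
have k0 : 0 <= k%:R * (d * d) by rewrite mulr_ge0 ?mulr_ge0.
by rewrite mulrDl mul1r; lra.
Qed.

(** One factor of the polynomial is absorbed by the powers of the square root of
    [r], through the Bernoulli inequality, and the others by induction. *)
Lemma polynomial_le_geometric (N : nat) (r : R) : 1 < r ->
  exists2 C, 0 <= C & forall k : nat, k.+1%:R ^+ N <= C * r ^+ k.
Proof.
elim: N r => [|N IH] r r1.
  by exists 1 => // k; rewrite expr0 mul1r exprn_ege1 // ltW.
have s1 : 1 < Num.sqrt r by rewrite -sqrtr1 ltr_sqrt // (lt_trans ltr01).
have [C C0 hC] := IH _ s1.
exists (C * (1 + (Num.sqrt r - 1)^-1)).
  by rewrite mulr_ge0 // addr_ge0 // invr_ge0 subr_ge0 ltW.
move=> k; rewrite exprSr.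
have -> : r ^+ k = Num.sqrt r ^+ k * Num.sqrt r ^+ k.
  by rewrite -exprMn -expr2 sqr_sqrtr // ltW // (lt_trans ltr01).
rewrite mulrACA; apply: ler_pM => //.
have d0 : 0 < Num.sqrt r - 1 by rewrite subr_gt0.
have := bernoulli_ineq k (ltW d0); rewrite [1 + (_ - 1)]addrC subrK => h.
have c0 : 0 <= 1 + (Num.sqrt r - 1)^-1 by rewrite addr_ge0 // invr_ge0 ltW.
apply: le_trans (ler_wpM2l c0 h); rewrite -natr1.
have -> : (1 + (Num.sqrt r - 1)^-1) * (1 + k%:R * (Num.sqrt r - 1)) =
    1 + k%:R * (Num.sqrt r - 1) + (Num.sqrt r - 1)^-1 + k%:R by field; rewrite gt_eqF.
have : 0 <= k%:R * (Num.sqrt r - 1) by rewrite mulr_ge0 // ltW.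
have : 0 <= (Num.sqrt r - 1)^-1 by rewrite invr_ge0 ltW.
by lra.
Qed.

Lemma nneseries_geometric_lty (a : nat -> R) (C z : R) : 0 <= z < 1 ->
  (forall k, 0 <= a k <= C * z ^+ k) -> (\sum_(k <oo) (a k)%:E < +oo)%E.
Proof.
move=> /andP[z0 z1] ha.
have C0 : 0 <= C by have /andP[h1 h2] := ha 0%N; rewrite expr0 mulr1 in h2; exact: le_trans h2.
apply: (@le_lt_trans _ _ (C / (1 - z))%:E); last by rewrite ltry.
apply: lime_le; first by apply: is_cvg_nneseries => k _ _; rewrite lee_fin; case/andP: (ha k).
apply: nearW => n; rewrite sumEFin lee_fin.
have d0 : 0 < 1 - z by rewrite subr_gt0.
rewrite ler_pdivlMr //.
apply: (@le_trans _ _ ((\sum_(0 <= k < n) C * z ^+ k) * (1 - z))).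
  by rewrite ler_pM2r // ler_sum // => k _; case/andP: (ha k).
rewrite -mulr_sumr -mulrA ler_piMr //.
elim: n => [|n IH]; first by rewrite big_geq // mul0r.
suff -> : (\sum_(0 <= k < n.+1) z ^+ k) * (1 - z) = 1 - z ^+ n.+1.
  by rewrite gerBl exprn_ge0.
elim: {IH} n => [|n IH]; first by rewrite big_nat1 expr0 expr1 mul1r.
by rewrite big_nat_recr //= mulrDl IH [in RHS]exprS; ring.
Qed.

End PolynomialGeometric.

(** * Integrability in the form domain *)

Section Embedding.
Context {R : realType} (m c : R) (m0 : 0 < m) (c0 : 0 < c).
Context (P : projection_family R unit).
Local Notation H := (@halfline_dom R).
Context (hS : spectral_measure_of H (dirac_halfline m c) P).
Context (u : spinor R unit) (hu : calc_dom H P (@sqrt_abs R) u).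

Let hP : projection_valued_measure H P. Proof. by case: hS. Qed.
Let mH := @measurable_halfline R.
Let uL : inL2 H u. Proof. by case: hu. Qed.

(** The square of the norm of the form domain, including the L^2 part. *)
Definition form_size : R := rinner H u u + fine (\int[smeas P u]_t (sqrt_abs t ^+ 2)%:E)%E.

Let fin : (\int[smeas P u]_t (sqrt_abs t ^+ 2)%:E < +oo)%E. Proof. by case: hu. Qed.

Let int_ge0 : (0 <= \int[smeas P u]_t (sqrt_abs t ^+ 2)%:E)%E.
Proof. by apply: integral_ge0 => t _; rewrite lee_fin sqr_ge0. Qed.

Lemma form_size_ge0 : 0 <= form_size.
Proof. by rewrite addr_ge0 ?rinner_ge0 ?fine_ge0. Qed.

Lemma sqrt_abs2 (t : R) : sqrt_abs t ^+ 2 = `|t|.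
Proof. by rewrite /sqrt_abs sqr_sqrtr. Qed.

(** The Markov inequality for the spectral measure of [u]. *)
Lemma spectral_tail (A : set R) (T : R) : measurable A -> 0 <= T ->
  (forall t, A t -> T <= `|t|) ->
  T * rinner H (proj P A u) (proj P A u) <= form_size.
Proof.
move=> mA T0 AT; rewrite -lee_fin EFinM -(smeas_norm mH hP) //.
have ms : measurable_fun setT (fun t : R => (sqrt_abs t ^+ 2)%:E).
  by apply/measurable_EFinP; apply: measurable_funX; exact: measurable_sqrt_abs.
have h1 : (T%:E * smeas P u A <= \int[smeas P u]_(t in A) (sqrt_abs t ^+ 2)%:E)%E.
  rewrite -integral_cst //; apply: ge0_le_integral => //.
  - exact: measurable_funTS ms.
  - by move=> t At; rewrite lee_fin sqrt_abs2 AT.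
have h2 : (\int[smeas P u]_(t in A) (sqrt_abs t ^+ 2)%:E <=
           \int[smeas P u]_t (sqrt_abs t ^+ 2)%:E)%E.
  by apply: ge0_subset_integral => // t _; rewrite lee_fin sqr_ge0.
apply: le_trans h1 _; apply: le_trans h2 _.
rewrite -[leLHS]fineK ?ge0_fin_numE // lee_fin lerDr; exact: rinner_ge0.
Qed.

Let low k : set R := [set t | `|t| < 2 ^+ k.+1].
Let window k : set R := low k `\` (if k is k'.+1 then low k' else set0).

Let mlow k : measurable (low k).
Proof.
have -> : low k = `]- 2 ^+ k.+1, 2 ^+ k.+1[%classic.
  by apply/seteqP; split => t; rewrite /low /= in_itv /= ltr_norml.
exact: measurable_itv.
Qed.

Let mwindow k : measurable (window k).
Proof. by case: k => [|k]; apply: measurableD. Qed.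

Let low_succ k : low k.+1 = low k `|` window k.+1.
Proof.
apply/seteqP; split => t /=; last first.
  by case=> [h|[]//]; apply: lt_trans h _; rewrite ltr_eXn2l ?ltr1n.
by move=> h; have [l|l] := pselect (low k t); [left|right].
Qed.

Definition sup_bound : R := sup_const m c form_size.

Lemma sup_bound_ge1 : 1 <= sup_bound.
Proof.
have B0 : 0 <= 1 + form_size by rewrite addr_ge0 // form_size_ge0.
have k0 : 0 <= m * c / 2 by rewrite divr_ge0 // mulr_ge0 // ltW.
have k1 : 0 <= c^-1 by rewrite invr_ge0 ltW.
by rewrite /sup_bound /sup_const lerDr mulr_ge0 // addr_ge0 // addr_ge0.
Qed.

(** The part of [u] with frequencies of order [2 ^+ k] has square norm of order
    [2 ^- k]: it satisfies the hypotheses of [essential_bound_on_window] on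
    intervals of length [2 ^- k], with a bound independent of [k]. *)
Lemma window_essential_bound k (q : 'cV[R[i]]_2) : sqnorm2 q = 1 ->
  {ae leb, forall x, H tt x -> dot (proj P (window k) u tt x) q <= sup_bound}.
Proof.
move=> q1; set y := proj P _ u; pose l : R := (2 ^+ k)^-1.
have l0 : 0 < l by rewrite invr_gt0 exprn_gt0.
have l1 : l <= 1 by rewrite invf_le1 ?exprn_gt0 // exprn_ege1 // ler1n.
have yL : inL2 H y by exact: (projL2 hP).
have yB : rinner H y y <= form_size * l.
  rewrite ler_pdivlMr ?exprn_gt0 // mulrC.
  case: k @y @l l0 l1 yL => [|k] y l l0 l1 yL.
    rewrite expr0 mul1r -lee_fin -(smeas_norm mH hP) //.
    apply: le_trans (smeas_le mH hP _ uL) _ => //.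
    by rewrite lee_fin lerDl fine_ge0.
  apply: spectral_tail => // t [_]; rewrite /low /= => /negP.
  by rewrite -leNgt.
have yT z w : dirac_halfline m c z w ->
    `|rinner H y w| <= l^-1 * (rinner H z z + rinner H y y).
  case: hS => _ hT /hT zw.
  have := window_bound mH hP (M := 2 ^+ k.+1) (mwindow k) _ _ zw uL.
  rewrite -/y /l invrK exprSr mulfK //; apply.
    by move=> t [h _]; rewrite -exprSr; exact: ltW.
  by rewrite mulr_ge0 ?exprn_ge0.
have cover : @halfline_dom R tt `<=`
    \bigcup_n `[n%:R * l, n%:R * l + l]%classic.
  move=> x; rewrite /halfline_dom /= in_itv /= andbT => x0.
  exists (Num.truncn (x / l)) => //=; rewrite in_itv /=.
  have xl : 0 <= x / l by rewrite divr_ge0 // ltW.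
  have /andP[h1 h2] := truncn_itv xl.
  rewrite -ler_pdivlMr // h1 /= -[X in _ + X]mul1r -mulrDl -ler_pdivrMr //.
  by rewrite ltW // natr1.
have mdot : measurable_fun (H tt) (fun x => dot (y tt x) q) by exact: measurable_dot_cst.
have N0 : leb.-negligible (\bigcup_n (`[n%:R * l, n%:R * l + l]%classic `&`
    [set x | sup_bound < dot (y tt x) q])).
  apply: negligible_bigcup => n.
  have n0 : 0 <= n%:R * l by rewrite mulr_ge0 // ltW.
  have h := essential_bound_on_window m0 c0 n0 l0 l1 form_size_ge0 yL yB yT q1.
  apply/negligibleP; last exact: h.
  have -> : `[n%:R * l, n%:R * l + l] `&` [set x | sup_bound < dot (y tt x) q] =
     `[n%:R * l, n%:R * l + l] `&` (H tt `&` (fun x => dot (y tt x) q) @^-1` `]sup_bound, +oo[).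
    apply/seteqP; split => x [Jx hx]; split => //.
      split; last by rewrite /= in_itv /= andbT.
      move: Jx; rewrite /halfline_dom /= !in_itv /= andbT => /andP[+ _].
      exact: le_trans.
    by case: hx => _; rewrite /= in_itv /= andbT.
  by apply: measurableI; [exact: measurable_itv|apply: mdot => //; exact: measurable_itv].
apply: negligibleS N0 => x /= /not_implyP[Hx /negP]; rewrite -ltNge => hx.
by have [n _ Jn] := cover _ Hx; exists n.
Qed.

Lemma low_essential_bound k (q : 'cV[R[i]]_2) : sqnorm2 q = 1 ->
  {ae leb, forall x, H tt x -> dot (proj P (low k) u tt x) q <= k.+1%:R * sup_bound}.
Proof.
move=> q1; elim: k => [|k IH].
  have -> : low 0%N = window 0%N by rewrite /window setD0.
  by apply: ae_mono1 (window_essential_bound 0 q1) => x + Hx; rewrite mul1r; apply.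
have d0 : low k `&` window k.+1 = set0 by apply/disjoints_subset => t ? [].
have add := proj_additive mH hP (mlow k) (mwindow k.+1) uL d0 tt.
have both := ae_mono (fun x p q => conj p q) IH add.
apply: ae_mono both (window_essential_bound k.+1 q1) => x [h2 h3] h1 Hx.
by rewrite low_succ (h3 Hx) dotDl -natr1 mulrDl mul1r lerD // ?h1 ?h2.
Qed.

(** The bound for the frequencies below [2 ^+ k.+1] is the sum of [k.+1] window
    bounds, hence grows linearly only. *)
Lemma low_sqnorm2_bound k :
  {ae leb, forall x, H tt x ->
     sqnorm2 (proj P (low k) u tt x) <= 4 * (k.+1%:R * sup_bound) ^+ 2}.
Proof.
set K := k.+1%:R * sup_bound; set y := proj P (low k) u.
have absb (q : 'cV[R[i]]_2) : sqnorm2 q = 1 ->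
    {ae leb, forall x, H tt x -> dot (y tt x) q ^+ 2 <= K ^+ 2}.
  move=> q1; have nq1 : sqnorm2 (- q) = 1.
    by rewrite sqnorm2E dotNl dotC dotNl opprK -sqnorm2E.
  apply: ae_mono (low_essential_bound k q1) (low_essential_bound k nq1) => x h1 h2 Hx.
  have := h1 Hx; have := h2 Hx; rewrite -/y dotC dotNl dotC -/K => b1 b2.
  have K0 : 0 <= K by rewrite mulr_ge0 // (le_trans ler01) // sup_bound_ge1.
  rewrite -[_ ^+ 2]real_normK ?num_real // lerXn2r ?nnegrE //.
  by rewrite ler_norml b2 lerNl b1.
pose e (b : 'I_2) : 'cV[R[i]]_2 := delta_mx b 0.
have e1 b : sqnorm2 (e b) = 1.
  by rewrite sqnorm2_2 !mxE; elim/ord2P: b => /=; ring.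
have i1 b : sqnorm2 ('i%C *: e b) = 1 by rewrite sqnorm2Z e1 /=; ring.
have a0 := ae_mono (fun x p q => conj p q) (absb _ (e1 0)) (absb _ (i1 0)).
have a1 := ae_mono (fun x p q => conj p q) (absb _ (e1 1)) (absb _ (i1 1)).
apply: ae_mono a0 a1 => x [p1 p2] [p3 p4] Hx.
have d1 (z : 'cV[R[i]]_2) (b : 'I_2) : dot z (e b) = Re (z b 0).
  rewrite /dot (bigD1 b) //= big1 ?addr0; last first.
    by move=> j /negPf jb; rewrite !mxE jb /=; ring.
  by rewrite !mxE !eqxx /=; ring.
have d2 (z : 'cV[R[i]]_2) (b : 'I_2) : dot z ('i%C *: e b) = Im (z b 0).
  rewrite /dot (bigD1 b) //= big1 ?addr0; last first.
    by move=> j /negPf jb; rewrite !mxE jb /=; ring.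
  by rewrite !mxE !eqxx /=; ring.
move: (p1 Hx) (p2 Hx) (p3 Hx) (p4 Hx); rewrite !d1 !d2 sqnorm2_2 => *; lra.
Qed.

(** Four times the bound of [low_sqnorm2_bound]: where [|u|^2] exceeds this value
    the remaining high frequencies must contribute at least 1. *)
Definition threshold k : R := 16 * (k.+1%:R * sup_bound) ^+ 2.

(** Above the threshold the high-frequency part is at least 1, and its square
    norm is at most [form_size / 2 ^+ k.+1].  As the threshold grows
    quadratically in [k], the distribution function of [|u|^2] decays
    exponentially in its square root. *)
Lemma level_set_measure k :
  (leb (H tt `&` [set x | (threshold k < sqnorm2 (u tt x))%R]) <=
   (form_size / 2 ^+ k.+1)%:E)%E.
Proof.
set G := H tt `&` _.
have ms : measurable_fun (H tt) (fun x => sqnorm2 (u tt x)) := int_measurable (inL2_int tt uL).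
have mG : measurable G.
  have -> : G = H tt `&` (fun x => sqnorm2 (u tt x)) @^-1` `]threshold k, +oo[.
    by apply/seteqP; split => x [Hx h]; split => //;
      move: h; rewrite /= in_itv /= andbT.
  by apply: ms => //; exact: measurable_itv.
pose high := ~` low k.
have mh : measurable high by exact: measurableC.
set y := proj P high u; have yL : inL2 H y by exact: (projL2 hP).
have yn : rinner H y y <= form_size / 2 ^+ k.+1.
  rewrite ler_pdivlMr ?exprn_gt0 // mulrC; apply: spectral_tail => // t.
  by rewrite /high /low /= => /negP; rewrite -leNgt.
have yi := inL2_int tt yL.
have -> : leb G = (\int[leb]_(x in H tt) (\1_G x)%:E)%E.
  have GH : G `<=` H tt by move=> x [].
  by rewrite (@integral_indic _ _ _ leb (H tt) (mH tt) G mG) (setIidl GH).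
apply: (@le_trans _ _ (\int[leb]_(x in H tt) (sqnorm2 (y tt x))%:E)%E); last first.
  rewrite -[leLHS]fineK; last exact: (@integrable_fin_num _ _ _ leb _ (mH tt) _ yi).
  rewrite lee_fin; apply: le_trans yn; rewrite rinner_halfline le_eqVlt; apply/orP; left.
  by apply/eqP/eq_Rintegral => x _; rewrite sqnorm2E.
have dec : aeeq H (fun e x => proj P (low k) u e x + y e x) u.
  have d0 : low k `&` high = set0 by rewrite /high setICr.
  have := proj_additive mH hP (mlow k) mh uL d0; rewrite /high setUv => add.
  apply: aeeq_trans (aeeq_sym add) _.
  by case: hP => _ _ _ h _; exact: h.
apply: (@ae_ge0_le_integral _ _ _ leb (H tt) (mH tt)) => //.
- by apply/measurable_EFinP; exact: measurable_indic.
- by move=> x _; rewrite lee_fin sqnorm2_ge0.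
- by apply/measurable_EFinP; exact: int_measurable yi.
have := ae_mono (fun x p q => conj p q) (dec tt) (low_sqnorm2_bound k).
apply: ae_mono1 => x [h1 h2] Hx; rewrite lee_fin indicE.
have [|xG] := boolP (x \in G); last by rewrite sqnorm2_ge0.
rewrite inE => -[_ /=]; rewrite -(h1 Hx) => h3.
have := sqnorm2D_le (proj P (low k) u tt x) (y tt x).
have := h2 Hx; move: h3; rewrite /threshold => h3 h4 h5.
have : 1 <= (k.+1%:R * sup_bound) ^+ 2.
  rewrite exprn_ege1 //; apply: le_trans (_ : sup_bound <= _); first exact: sup_bound_ge1.
  by rewrite ler_peMl ?ler1n // (le_trans ler01) // sup_bound_ge1.
move: (sqnorm2 (_ + _)) h3 h5 => S h3 h5 h6; rewrite /=; lra.
Qed.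

(** This replaces the Sobolev embedding of the form domain into the spaces L^q:
    the level sets decay faster than any power of their level, so that the sum
    over the layers between successive thresholds converges. *)
Lemma moment_integrable n :
  leb.-integrable (H tt) (EFin \o (fun x => sqnorm2 (u tt x) ^+ n.+1)).
Proof.
pose S x := sqnorm2 (u tt x).
have Si : leb.-integrable (H tt) (EFin \o S) := inL2_int tt uL.
have mS : measurable_fun (H tt) S := int_measurable Si.
have S0 x : 0 <= S x by exact: sqnorm2_ge0.
pose G k := H tt `&` [set x | threshold k < S x].
have mG k : measurable (G k).
  have -> : G k = H tt `&` S @^-1` `]threshold k, +oo[.
    by apply/seteqP; split => x [Hx h]; split => //;
      move: h; rewrite /= in_itv /= andbT.
  by apply: mS => //; exact: measurable_itv.
have b1 := sup_bound_ge1; have b0 : 0 <= sup_bound by exact: le_trans b1.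
have t0 k : 0 <= threshold k by rewrite mulr_ge0 // sqr_ge0.
have mSn : measurable_fun (H tt) (fun x => S x ^+ n.+1) by exact: measurable_funX.
apply/(int_ge0P mSn); first by move=> x _; rewrite exprn_ge0.
pose h k x : \bar R := (threshold k.+1 ^+ n.+1 * \1_(G k) x)%:E.
have h0 k x : (0 <= h k x)%E by rewrite lee_fin mulr_ge0 ?exprn_ge0.
have mh k : measurable_fun (H tt) (h k).
  by apply/measurable_EFinP; apply: measurable_funM.
have mser : measurable_fun (H tt) (fun x => \sum_(k <oo) h k x)%E.
  exact: ge0_emeasurable_sum.
have ser0 x : (0 <= \sum_(k <oo) h k x)%E by apply: nneseries_ge0.
have mT : measurable_fun (H tt) (fun x => (threshold 0 ^+ n * S x)%:E).
  by apply/measurable_EFinP; apply: measurable_funM.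
apply: (@le_lt_trans _ _ (\int[leb]_(x in H tt)
   ((threshold 0 ^+ n * S x)%:E + \sum_(k <oo) h k x))%E).
  apply: (@ge0_le_integral _ _ _ leb (H tt) (mH tt)).
  - by move=> x _; rewrite lee_fin exprn_ge0.
  - exact/measurable_EFinP.
  - exact: emeasurable_funD.
  move=> x Hx; have [Sl|Sg] := leP (S x) (threshold 0).
    apply: (@le_trans _ _ (threshold 0 ^+ n * S x)%:E); last by rewrite leeDl.
    by rewrite lee_fin exprSr ler_wpM2r // lerXn2r ?nnegrE.
  (* The last threshold below the value selects the layer of [x]. *)
  have [k /andP[k1 k2]] : exists k, threshold k < S x <= threshold k.+1.
    have ex : exists k, S x <= threshold k.
      exists (Num.bound (S x)); have := archi_boundP (S0 x) => /ltW /le_trans; apply.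
      set N := Num.bound _; have N1 : N%:R <= N.+1%:R * sup_bound.
        by rewrite (le_trans (_ : _ <= N.+1%:R)) ?ler_nat // ler_peMr.
      have N2 : 1 <= N.+1%:R * sup_bound by rewrite mulr_ege1 // ler1n.
      rewrite /threshold (le_trans N1) //.
      have := ler_wpM2l (le_trans ler01 N2) N2; rewrite mulr1 -expr2.
      by have := sqr_ge0 (N.+1%:R * sup_bound); lra.
    case: (ex_minnP ex) => -[|k] hk mk; first by move: hk; rewrite leNgt Sg.
    exists k; rewrite hk andbT ltNge; apply/negP => /mk; by rewrite ltnn.
  apply: (@le_trans _ _ (h k x)).
    rewrite lee_fin indicE mem_set ?mulr1; last by split.
    by rewrite lerXn2r ?nnegrE.
  apply: (@le_trans _ _ (\sum_(k <oo) h k x)%E); last first.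
    by rewrite leeDr // lee_fin mulr_ge0 ?exprn_ge0.
  apply: le_trans (nneseries_lim_ge k.+1 _) => //; rewrite big_nat_recr //= leeDr //.
  exact: sume_ge0.
rewrite (@ge0_integralD _ _ _ leb (H tt) (mH tt)) //; last 1 first.
  by move=> x _; rewrite lee_fin mulr_ge0 ?exprn_ge0.
apply: lte_add_pinfty.
  have := intZ (mH tt) (threshold 0 ^+ n) Si => /integrable_lty; apply; exact: mH.
rewrite (@integral_nneseries _ _ _ leb (H tt) (mH tt)) //.
(* Any ratio between 1 and 2 would do: it has to beat the polynomial growth of the
   thresholds and to be beaten by the decay of the level sets. *)
have [C C0 hC] := polynomial_le_geometric (2 * n.+1) (r := 3 / 2) ltac:(lra).
have hint k : (\int[leb]_(x in H tt) h k x =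
    (threshold k.+1 ^+ n.+1 * fine (leb (G k)))%:E)%E.
  have GH : G k `<=` H tt by move=> x [].
  have Gfin : (leb (G k) < +oo)%E.
    by apply: le_lt_trans (level_set_measure k) _; rewrite ltry.
  have gi := int_indic (mG k) (mH tt) Gfin.
  have fi := @integrable_fin_num _ _ _ leb _ (mH tt) _ (intZ (mH tt) (threshold k.+1 ^+ n.+1) gi).
  rewrite -[LHS]fineK //; congr EFin.
  rewrite -[LHS]/(\int[leb]_(x in H tt) (threshold k.+1 ^+ n.+1 * \1_(G k) x))%R.
  by rewrite RintZ // /Rintegral (@integral_indic _ _ _ leb _ (mH tt) _ (mG k)) (setIidl GH).
rewrite (eq_eseriesr (fun k _ => hint k)).
apply: (nneseries_geometric_lty (C := (16 * sup_bound ^+ 2) ^+ n.+1 * C * form_size * (3 / 4))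
  (z := 3 / 4)); first by apply/andP; split; lra.
move=> k; apply/andP; split; first by rewrite mulr_ge0 ?exprn_ge0 ?fine_ge0.
have Gk : fine (leb (G k)) <= form_size / 2 ^+ k.+1.
  rewrite -lee_fin fineK; first exact: level_set_measure.
  by rewrite ge0_fin_numE //; apply: le_lt_trans (level_set_measure k) _; rewrite ltry.
have tE : threshold k.+1 ^+ n.+1 = (16 * sup_bound ^+ 2) ^+ n.+1 * k.+2%:R ^+ (2 * n.+1).
  by rewrite /threshold [k.+2%:R ^+ _]exprM -exprMn; congr (_ ^+ _); ring.
apply: (@le_trans _ _ (threshold k.+1 ^+ n.+1 * (form_size / 2 ^+ k.+1))).
  by rewrite ler_wpM2l ?exprn_ge0.
have K0 : 0 <= (16 * sup_bound ^+ 2) ^+ n.+1 * (form_size / 2 ^+ k.+1).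
  by rewrite mulr_ge0 ?divr_ge0 ?exprn_ge0 ?form_size_ge0 // mulr_ge0 // exprn_ge0.
have := ler_wpM2l K0 (hC k.+1); rewrite tE => hk.
have -> : (16 * sup_bound ^+ 2) ^+ n.+1 * k.+2%:R ^+ (2 * n.+1) * (form_size / 2 ^+ k.+1) =
  (16 * sup_bound ^+ 2) ^+ n.+1 * (form_size / 2 ^+ k.+1) * k.+2%:R ^+ (2 * n.+1) by ring.
apply: le_trans hk _; rewrite le_eqVlt; apply/orP; left; apply/eqP.
have -> : (3 / 4 : R) ^+ k = (3 / 2) ^+ k / 2 ^+ k.
  by rewrite -expr_div_n; congr (_ ^+ _); field.
by rewrite !exprS; field; rewrite expf_neq0.
Qed.

End Embedding.

(** * Integrability of the potential *)

Lemma int_cst_itv {R : realType} (a b k : R) :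
  leb.-integrable `[a, b] (EFin \o (fun _ : R => k)).
Proof.
have mt : measurable `[a, b] by exact: measurable_itv.
apply/integrableP; split; first by apply/measurable_EFinP; exact: measurable_cst.
have -> : (\int[leb]_(x in `[a, b]) `|(EFin \o (fun=> k)) x| =
           \int[leb]_(x in `[a, b]) (cst `|k|%:E) x)%E by [].
have fin : (leb `[a, b] < +oo)%E.
  by rewrite lebesgue_measure_itv /=; case: ifP => _; rewrite -?EFinB ltry.
by rewrite (@integral_cst _ _ _ leb _ mt) lte_mul_pinfty ?lee_fin.
Qed.

Section Nonlinearity.
Context {R : realType} (f : R -> R) (hF1 : F1 f) (hF2 : F2 f) (hF4 : F4 f).

Let f_homo : {homo (fun s => f (Num.max s 0)) : s t / s <= t}.
Proof.
case: hF1 => f0 fge0 s t st; have [t0|t0] := leP t 0.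
  by rewrite (max_idPr (le_trans st t0)).
have [s0|s0] := leP s 0; first by rewrite f0 fge0 // ltW.
exact: hF4.
Qed.

Let integrand_ge0 t s : `[0, t]%classic s -> 0 <= f s * s.
Proof.
by case: hF1 => _ fge0; rewrite /= in_itv /= => /andP[s0 _]; rewrite mulr_ge0 // fge0.
Qed.

Let integrand_int (t : R) : leb.-integrable `[0, t] (EFin \o (fun s => f s * s)).
Proof.
have mt : measurable `[0, t] by exact: measurable_itv.
have mf : measurable_fun `[0, t]%classic (fun s => f s * s).
  have : measurable_fun `[0, t]%classic (fun s => f (Num.max s 0) * s).
    by apply: measurable_funM => //; exact: nondecreasing_measurable.
  apply: eq_measurable_fun => s; rewrite inE /= in_itv /= => /andP[s0 _].
  by rewrite (max_idPl s0).
apply: (int_le mt (g := fun=> f t * t)) => //.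
  move=> s st; rewrite ger0_norm ?(integrand_ge0 st) //.
  move: st; rewrite /= in_itv /= => /andP[s0 st].
  have t0 := le_trans s0 st; have := f_homo st.
  rewrite (max_idPl s0) (max_idPl t0) => ft.
  by case: hF1 => _ fge0; rewrite ler_pM // fge0.
exact: int_cst_itv.
Qed.

Lemma primF_homo : {homo (primF f) : s t / s <= t}.
Proof.
move=> s t st; rewrite /primF /Rintegral.
have ms : measurable `[0, s] by exact: measurable_itv.
have mt : measurable `[0, t] by exact: measurable_itv.
apply: fine_le.
- exact: (@integrable_fin_num _ _ _ leb _ ms _ (integrand_int s)).
- exact: (@integrable_fin_num _ _ _ leb _ mt _ (integrand_int t)).
apply: (@ge0_subset_integral _ _ _ leb _ _ ms mt).
- exact: (measurable_int _ (integrand_int t)).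
- by move=> x xt; rewrite lee_fin (integrand_ge0 xt).
- by move=> x; rewrite /= !in_itv /= => /andP[-> /le_trans]; apply.
Qed.

Lemma measurable_primF_sqrt : measurable_fun setT (fun s : R => primF f (Num.sqrt s)).
Proof.
apply: (measurableT_comp (f := primF f)).
  by apply: nondecreasing_measurable => //; exact: primF_homo.
apply: continuous_measurable_fun => t; exact: sqrt_continuous.
Qed.

Lemma primF_ge0 t : 0 <= primF f t.
Proof. by apply: Rintegral_ge0 => s; exact: integrand_ge0. Qed.

Lemma primF_le t : 0 <= t -> primF f t <= f t * t ^+ 2.
Proof.
move=> t0; have mt : measurable `[0, t] by exact: measurable_itv.
have ci := int_cst_itv 0 t (f t * t).
apply: (@le_trans _ _ (\int[leb]_(s in `[0, t]) (f t * t))%R).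
  apply: (@le_Rintegral _ _ _ leb _ _ _ mt (integrand_int t) ci) => s.
  rewrite /= in_itv /= => /andP[s0 st].
  have := f_homo st; rewrite (max_idPl s0) (max_idPl t0) => ft.
  by case: hF1 => _ fge0; rewrite ler_pM // fge0.
have lt : fine (leb `[0, t]) = t.
  rewrite lebesgue_measure_itv /= lte_fin; case: ltP => [_|t0'] /=; first by rewrite subr0.
  by apply/eqP; rewrite eq_le t0 t0'.
by rewrite (@Rintegral_cst _ _ _ leb _ mt) lt expr2 mulrA.
Qed.

(** Monotonicity of [f] gives [F t <= f t * t ^+ 2], and a real power is below the
    next integer power except on [[0, 1]]. *)
Lemma primF_growth : exists n : nat, exists2 C : R, 0 <= C &
  forall S : R, 0 <= S -> primF f (Num.sqrt S) <= C * (2 * S + S ^+ n.+1).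
Proof.
have [p [C [p2 C0 hC]]] := hF2.
exists (Num.bound (p - 2)), C => [|S S0]; first exact: ltW.
set n := Num.bound _; set s := Num.sqrt S; have s0 : 0 <= s by exact: sqrtr_ge0.
have sS : s ^+ 2 = S by rewrite sqr_sqrtr.
apply: le_trans (primF_le s0) _; rewrite sS.
have hs : s `^ (p - 2) <= 1 + S ^+ n.
  have [s1|s1] := leP s 1.
    apply: (@le_trans _ _ 1); last by rewrite lerDl exprn_ge0.
    have : s `^ (p - 2) <= 1 `^ (p - 2).
      by rewrite ge0_ler_powR ?nnegrE // subr_ge0 ltW.
    by rewrite powR1.
  apply: (@le_trans _ _ (S ^+ n)); last by rewrite lerDr.
  rewrite -sS -exprM -powR_mulrn // ler_powR ?(ltW s1) //.
  have p20 : 0 <= p - 2 by rewrite subr_ge0 ltW.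
  rewrite (le_trans (ltW (archi_boundP p20))) // ler_nat leq_pmull //.
apply: le_trans (ler_wpM2r S0 (hC _ s0)) _.
have -> : 2 * S + S ^+ n.+1 = (1 + (1 + S ^+ n)) * S by rewrite exprS; ring.
by rewrite -mulrA ler_pM2l // ler_wpM2r // lerD2l.
Qed.

Lemma primF_integrable (m c : R) (P : projection_family R unit) (u : spinor R unit) :
  0 < m -> 0 < c ->
  spectral_measure_of (@halfline_dom R) (dirac_halfline m c) P ->
  calc_dom (@halfline_dom R) P (@sqrt_abs R) u ->
  leb.-integrable (@halfline_dom R tt)
    (EFin \o (fun x => primF f (Num.sqrt (sqnorm2 (u tt x))))).
Proof.
move=> m0 c0 hS hu; have [n [C C0 hC]] := primF_growth.
have mH := @measurable_halfline R tt; have [uL _] := hu.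
have i0 := inL2_int tt uL; have i1 := moment_integrable m0 c0 hS hu n.
apply: (int_le mH _ _ (intZ mH C (intD mH (intZ mH 2 i0) i1))).
  exact: (measurableT_comp measurable_primF_sqrt (int_measurable i0)).
by move=> x _; rewrite ger0_norm ?primF_ge0 // hC // sqnorm2_ge0.
Qed.

End Nonlinearity.

(** * Invariance of the action level under unitary equivalence *)

Section CalculusCongruence.
Context {R : realType} {E : finType} (D : E -> set R).
Context (mD : forall e, measurable (D e)).
Context (P : projection_family R E) (hP : projection_valued_measure D P).
Context (g : R -> R).
Implicit Types (u v w : spinor R E).

Lemma Rintegral_smeas_aeeq u v (h : R -> R) : inL2 D u -> inL2 D v -> aeeq D u v ->
  (\int[smeas P u]_t h t = \int[smeas P v]_t h t)%R.
Proof.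
move=> uL vL uv; congr fine; apply: eq_measure_integral => A mA _.
by apply: (smeas_aeeq mD hP) => //; exact: aeeq_sym.
Qed.

Lemma calculus_aeeq u v w1 w2 : inL2 D v -> inL2 D w2 -> aeeq D u v ->
  aeeq D w1 w2 -> calculus D P g u w1 -> calculus D P g v w2.
Proof.
move=> vL w2L uv ww [ud w1L h]; have [uL _] := ud; split => //.
  exact: (calc_dom_aeeq mD hP vL uv).
move=> x xd; have [xL _] := xd.
rewrite -(eq_inner mD xL w1L xL w2L (aeeq_refl _ _) ww) h //.
congr (_ * _); apply: eq_bigr => k _; congr (_ * _%:C).
have ixL := inL2Z mD ('i%C ^+ k) xL.
apply: Rintegral_smeas_aeeq; [exact: inL2D|exact: inL2D|].
by apply: aeeqD => //; exact: aeeq_refl.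
Qed.

End CalculusCongruence.

Lemma action_congr {R : realType} (lam : R) (a b c d a' b' c' d' : R) :
  a = a' -> b = b' -> c = c' -> d = d' ->
  2^-1 * (a ^+ 2 - b ^+ 2) + lam / 2 * c ^+ 2 - d =
  2^-1 * (a' ^+ 2 - b' ^+ 2) + lam / 2 * c' ^+ 2 - d'.
Proof. by move=> -> -> -> ->. Qed.

Section ActionCongruence.
Context {R : realType} {E : finType} (D : E -> set R).
Context (mD : forall e, measurable (D e)).
Context (P : projection_family R E) (hP : projection_valued_measure D P).
Implicit Types (u v w : spinor R E).

Lemma eq_normL2 u v : inL2 D u -> inL2 D v -> aeeq D u v -> normL2 D u = normL2 D v.
Proof. by move=> uL vL uv; rewrite !normL2E; congr Num.sqrt; exact: (eq_rinner mD). Qed.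

Lemma eq_normY u v : inL2 D u -> inL2 D v -> aeeq D u v -> normY D P u = normY D P v.
Proof.
move=> uL vL uv.
have [[w uw]|h] := pselect (exists w, calculus D P (@sqrt_abs R) u w).
  have [_ wL _] := uw.
  rewrite (normY_calculus mD hP uw); apply/esym/(normY_calculus mD hP).
  by apply: (calculus_aeeq mD hP vL wL uv _ uw); exact: aeeq_refl.
rewrite (normY_none h) normY_none // => -[w vw]; apply: h; exists w.
have [_ wL _] := vw.
by apply: (calculus_aeeq mD hP uL wL (aeeq_sym uv) _ vw); exact: aeeq_refl.
Qed.

Context (f : R -> R) (lam : R).
Context (mF : measurable_fun setT (fun s : R => primF f (Num.sqrt s))).

Lemma measurable_potential u e : inL2 D u ->
  measurable_fun (D e) (fun x => primF f (Num.sqrt (sqnorm2 (u e x)))).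
Proof. by move=> uL; exact: (measurableT_comp mF (int_measurable (inL2_int e uL))). Qed.

Lemma eq_action u v : inL2 D u -> inL2 D v -> aeeq D u v ->
  action D f lam P u = action D f lam P v.
Proof.
move=> uL vL uv; have mpos : measurable (`]0, +oo[%classic : set R) by exact: measurable_itv.
have mneg : measurable (`]-oo, 0[%classic : set R) by exact: measurable_itv.
have epos : normY D P (pos_part P u) = normY D P (pos_part P v).
  exact: (eq_normY (projL2 hP mpos uL) (projL2 hP mpos vL) (proj_aeeq mD hP mpos uL vL uv)).
have eneg : normY D P (neg_part P u) = normY D P (neg_part P v).
  exact: (eq_normY (projL2 hP mneg uL) (projL2 hP mneg vL) (proj_aeeq mD hP mneg uL vL uv)).
have epot : \sum_e (\int[leb]_(x in D e) primF f (Num.sqrt (sqnorm2 (u e x))))%R =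
            \sum_e (\int[leb]_(x in D e) primF f (Num.sqrt (sqnorm2 (v e x))))%R.
  apply: eq_bigr => e _.
  apply: (Rint_ae (mD e) (@measurable_potential u e uL) (@measurable_potential v e vL)).
  by apply: ae_mono1 (uv e) => x ux Dx; rewrite ux.
exact: (action_congr _ epos eneg (eq_normL2 uL vL uv) epot).
Qed.

End ActionCongruence.

(** A unitary map and its inverse, given on representatives: linearity holds
    everywhere, while the two maps are only mutually inverse up to negligible
    sets. *)
Record spinor_equiv {R : realType} {E1 E2 : finType} (D1 : E1 -> set R)
    (D2 : E2 -> set R) (V : spinor R E1 -> spinor R E2)
    (W : spinor R E2 -> spinor R E1) : Prop := SpinorEquiv {
  equiv_linear : forall a u v, V (fun e x => u e x + a *: v e x) =
                               (fun e x => V u e x + a *: V v e x);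
  equiv_linear' : forall a u v, W (fun e x => u e x + a *: v e x) =
                               (fun e x => W u e x + a *: W v e x);
  equiv_L2 : forall u, inL2 D2 (V u) <-> inL2 D1 u;
  equiv_L2' : forall u, inL2 D1 (W u) <-> inL2 D2 u;
  equiv_inner : forall u v, inL2 D1 u -> inL2 D1 v ->
     inner D2 (V u) (V v) = inner D1 u v;
  equiv_inner' : forall u v, inL2 D2 u -> inL2 D2 v ->
     inner D1 (W u) (W v) = inner D2 u v;
  equiv_aeeq : forall u v, aeeq D1 u v -> aeeq D2 (V u) (V v);
  equiv_aeeq' : forall u v, aeeq D2 u v -> aeeq D1 (W u) (W v);
  equivK : forall u, aeeq D1 (W (V u)) u;
  equivK' : forall u, aeeq D2 (V (W u)) u }.

Lemma spinor_equiv_sym {R : realType} {E1 E2 : finType} (D1 : E1 -> set R)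
    (D2 : E2 -> set R) V W : spinor_equiv D1 D2 V W -> spinor_equiv D2 D1 W V.
Proof. by case. Qed.

Section Transport.
Context {R : realType} {E1 E2 : finType} (D1 : E1 -> set R) (D2 : E2 -> set R).
Context (mD1 : forall e, measurable (D1 e)) (mD2 : forall e, measurable (D2 e)).
Context (V : spinor R E1 -> spinor R E2) (W : spinor R E2 -> spinor R E1).
Context (eqv : spinor_equiv D1 D2 V W).
Context (T1 : spinor R E1 -> spinor R E1 -> Prop) (T2 : spinor R E2 -> spinor R E2 -> Prop).
Context (hT : forall u w, T2 u w <-> T1 (W u) (W w)).

Definition transport (P : projection_family R E1) : projection_family R E2 :=
  ProjectionFamily (fun A u => V (proj P A (W u))) (fun u => smeas P (W u)).

Section OneFamily.
Context (P : projection_family R E1) (hP : projection_valued_measure D1 P).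
Let Q := transport P.

Let VL u : inL2 D1 u -> inL2 D2 (V u). Proof. by move/(equiv_L2 eqv). Qed.
Let WL u : inL2 D2 u -> inL2 D1 (W u). Proof. by move/(equiv_L2' eqv). Qed.

Lemma transport_pvm : projection_valued_measure D2 Q.
Proof.
have K u : inL2 D1 u -> inL2 D1 (W (V u)) by move=> uL; do 2!auto.
have K' u : inL2 D2 u -> inL2 D2 (V (W u)) by move=> uL; do 2!auto.
have adj u v : inL2 D1 u -> inL2 D2 v -> inner D2 (V u) v = inner D1 u (W v).
  move=> uL vL; rewrite -(equiv_inner eqv uL (WL vL)).
  apply: (eq_inner mD2 (VL uL) vL (VL uL) (K' _ vL)); first exact: aeeq_refl.
  exact: aeeq_sym (equivK' eqv v).
have adj' u v : inL2 D1 u -> inL2 D2 v -> inner D2 v (V u) = inner D1 (W v) u.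
  move=> uL vL; rewrite -(equiv_inner eqv (WL vL) uL).
  apply: (eq_inner mD2 vL (VL uL) (K' _ vL) (VL uL)); last exact: aeeq_refl.
  exact: aeeq_sym (equivK' eqv v).
split=> /=.
- by move=> A u mA uL; apply: VL; apply: (projL2 hP) => //; exact: WL.
- move=> A u v mA uL vL; have uL' := WL uL; have vL' := WL vL.
  have pu := projL2 hP mA uL'; have pv := projL2 hP mA vL'.
  by rewrite adj // adj' // (proj_inner hP).
- move=> A B u mA mB uL; have uL' := WL uL; have pu := projL2 hP mB uL'.
  apply: (equiv_aeeq eqv); apply: aeeq_trans (proj_comp hP mA mB uL').
  by apply: (proj_aeeq mD1 hP) => //; [auto|exact: (equivK eqv)].
- move=> u uL; apply: aeeq_trans (equivK' eqv u); apply: (equiv_aeeq eqv).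
  by case: hP => _ _ _ h _; apply: h; exact: WL.
- move=> A u mA uL; have uL' := WL uL; have pu := projL2 hP mA uL'.
  by rewrite adj' //; case: hP => _ _ _ _ ->.
Qed.

Lemma transport_calc_dom g u : calc_dom D2 Q g u <-> calc_dom D1 P g (W u).
Proof. by split=> -[uL fu]; split => //; move: uL; rewrite (equiv_L2' eqv). Qed.

Lemma transport_calculus g u w :
  calculus D2 Q g u w <-> calculus D1 P g (W u) (W w).
Proof.
split=> -[ud wL h].
  have [uL _] := ud; split; [exact/transport_calc_dom|exact: WL|].
  move=> v vd; have [vL _] := vd.
  have vd' : calc_dom D2 Q g (V v).
    apply/transport_calc_dom; apply: (calc_dom_aeeq mD1 hP _ _ vd); first by auto.
    exact: aeeq_sym (equivK eqv v).
  have -> : inner D1 v (W w) = inner D2 (V v) w.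
    rewrite -(equiv_inner' eqv (VL vL) wL).
    apply: (eq_inner mD1 vL (WL wL) (WL (VL vL)) (WL wL)); last exact: aeeq_refl.
    exact: aeeq_sym (equivK eqv v).
  rewrite h //; congr (_ * _); apply: eq_bigr => k _; congr (_ * _%:C).
  rewrite /Q /= (equiv_linear' eqv).
  have uL' := WL uL; have i1 := inL2Z mD1 ('i%C ^+ k) vL.
  have i2 := inL2Z mD1 ('i%C ^+ k) (WL (VL vL)).
  apply: (Rintegral_smeas_aeeq mD1 hP _ (inL2D mD1 uL' i2) (inL2D mD1 uL' i1)).
  by apply: aeeqD; [exact: aeeq_refl|apply: aeeqZ; exact: (equivK eqv)].
have wL' : inL2 D2 w by move: wL; rewrite (equiv_L2' eqv).
split; [exact/transport_calc_dom|by []|].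
move=> v vd; have [vL _] := vd.
rewrite -(equiv_inner' eqv) // h; last exact/transport_calc_dom.
congr (_ * _); apply: eq_bigr => k _; congr (_ * _%:C).
by rewrite /Q /= (equiv_linear' eqv).
Qed.

(** Conjugation by the unitary map turns a spectral measure of the first
    operator into one of the second; its scalar measures are unchanged. *)
Lemma transport_spectral : spectral_measure_of D1 T1 P -> spectral_measure_of D2 T2 Q.
Proof.
move=> [_ h]; split; first exact: transport_pvm.
by move=> u w; rewrite hT h transport_calculus.
Qed.

Lemma transport_normY u : inL2 D2 u -> normY D2 Q u = normY D1 P (W u).
Proof.
move=> uL; have hQ := transport_pvm.
have [[w uw]|h] := pselect (exists w, calculus D2 Q (@sqrt_abs R) u w).
  have [_ wL _] := uw; rewrite (normY_calculus mD2 hQ uw).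
  have uw' := (transport_calculus _ _ _).1 uw.
  by rewrite (normY_calculus mD1 hP uw') /normL2 (equiv_inner' eqv).
rewrite (normY_none h) normY_none // => -[w uw]; apply: h; exists (V w).
have [_ wL _] := uw; apply/transport_calculus.
apply: (calculus_aeeq mD1 hP _ _ _ _ uw); auto using aeeq_refl.
exact: aeeq_sym (equivK eqv w).
Qed.

Lemma transport_normY_proj A u : measurable A -> inL2 D1 u ->
  normY D2 Q (proj Q A (V u)) = normY D1 P (proj P A u).
Proof.
move=> mA uL; have K := WL (VL uL); have pK := projL2 hP mA K.
have pu := projL2 hP mA uL.
rewrite transport_normY /=; last exact: VL.
apply: (eq_normY mD1 hP) => //; first by auto.
apply: aeeq_trans (equivK eqv _) _.
by apply: (proj_aeeq mD1 hP) => //; exact: (equivK eqv).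
Qed.

End OneFamily.

Context (f : R -> R) (lam : R).
Context (mF : measurable_fun setT (fun s : R => primF f (Num.sqrt s))).
Context (potential : forall P u, spectral_measure_of D1 T1 P ->
  calc_dom D1 P (@sqrt_abs R) u ->
  \sum_e (\int[leb]_(x in D2 e) primF f (Num.sqrt (sqnorm2 (V u e x))))%R =
  \sum_e (\int[leb]_(x in D1 e) primF f (Num.sqrt (sqnorm2 (u e x))))%R).

Lemma transport_action P u : spectral_measure_of D1 T1 P ->
  calc_dom D1 P (@sqrt_abs R) u ->
  action D2 f lam (transport P) (V u) = action D1 f lam P u.
Proof.
move=> hS ud; have [hP _] := hS; have [uL _] := ud.
have mpos : measurable (`]0, +oo[%classic : set R) by exact: measurable_itv.
have mneg : measurable (`]-oo, 0[%classic : set R) by exact: measurable_itv.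
have eL : normL2 D2 (V u) = normL2 D1 u by rewrite /normL2 (equiv_inner eqv).
exact: (action_congr _ (transport_normY_proj hP mpos uL)
  (transport_normY_proj hP mneg uL) eL (potential hS ud)).
Qed.

(** The action of [u + t *: eta] is the same on both sides for every [t], hence so
    are the criticality conditions.  A test direction of the second space is only
    almost everywhere equal to a transported one. *)
Lemma transport_nehari P u : spectral_measure_of D1 T1 P ->
  nehari D1 f lam P u -> nehari D2 f lam (transport P) (V u).
Proof.
move=> hS [[w uw] nneg cu ceta]; have [hP _] := hS.
have hQ := transport_pvm hP; have [ud wL _] := uw; have [uL _] := ud.
have VL x : inL2 D1 x -> inL2 D2 (V x) by move/(equiv_L2 eqv).
have WL x : inL2 D2 x -> inL2 D1 (W x) by move/(equiv_L2' eqv).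
have ms := @measurable_sqrt_abs R.
have mneg : measurable (`]-oo, 0[%classic : set R) by exact: measurable_itv.
have uY : inY D2 (transport P) (V u).
  exists (V w); apply/(transport_calculus hP).
  by apply: (calculus_aeeq mD1 hP _ _ _ _ uw); auto; apply: aeeq_sym; exact: (equivK eqv).
have line eta : calc_dom D1 P (@sqrt_abs R) eta ->
   (fun t : R => action D2 f lam (transport P) (fun e x => V u e x + t%:C *: V eta e x)) =
   (fun t : R => action D1 f lam P (fun e x => u e x + t%:C *: eta e x)).
  move=> etad; apply/funext => t; rewrite -(equiv_linear eqv) transport_action //.
  exact: (calc_domD mD1 hP ms ud (calc_domZ mD1 hP ms _ etad)).
split; first exact: uY.
- move=> [_ h]; apply: nneg; split; first by exists w.
  have pK := projL2 hP mneg (WL _ (VL _ uL)).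
  have h1 := equiv_aeeq' eqv h; rewrite /neg_part /= in h1 *.
  apply: aeeq_trans (equivK eqv u); apply: aeeq_trans h1.
  apply: aeeq_trans (aeeq_sym (equivK eqv _)).
  by apply: (proj_aeeq mD1 hP); auto; apply: aeeq_sym; exact: (equivK eqv).
- by have := cu; rewrite /critical_along -(line _ ud).
- move=> eta' [[w' ew'] en'].
  have ew := (transport_calculus hP _ _ _).1 ew'; have [ed _ _] := ew.
  have [eL _] := ed; have [[eL' _] _ _] := ew'.
  have /ceta : inYneg D1 P (W eta').
    split; first by exists (W w').
    by apply: aeeq_trans (equiv_aeeq' eqv en'); apply: aeeq_sym; exact: (equivK eqv).
  have E : (fun t : R => action D1 f lam P (fun e x => u e x + t%:C *: W eta' e x)) =
    (fun t : R => action D2 f lam (transport P) (fun e x => V u e x + t%:C *: eta' e x)).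
    rewrite -(line _ ed); apply/funext => t; have tL := inL2Z mD2 t%:C (VL _ eL).
    have tL' := inL2Z mD2 t%:C eL'.
    apply: (eq_action mD2 hQ lam mF (inL2D mD2 (VL _ uL) tL) (inL2D mD2 (VL _ uL) tL')).
    by apply: aeeqD; [exact: aeeq_refl|apply: aeeqZ; exact: (equivK' eqv)].
  by move=> cr; exact: (eq_ind _ (fun h : R -> R => is_derive (0 : R) (1 : R) h (0 : R)) cr _ E).
Qed.

(** The inequality only asks that one of the two potentials be transported; the
    reverse inequality is obtained by exchanging the two spaces. *)
Lemma transport_level : (action_level D2 f lam T2 <= action_level D1 f lam T1)%E.
Proof.
apply: ereal_inf_le_tmp => _ [P hS [u hu ->]].
exists (transport P); first by case: (hS) => hP _; exact: transport_spectral.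
exists (V u); first exact: transport_nehari.
have [[w [ud _ _]] _ _ _] := hu.
by rewrite transport_action.
Qed.

End Transport.

(** * Isometries of the line *)

Section Isometry.
Context {R : realType} (s t : R) (hs : s = 1 \/ s = -1).

Definition line_isometry (x : R) : measurableTypeR R := s * x + t.

Lemma measurable_line_isometry : measurable_fun setT (line_isometry : measurableTypeR R -> measurableTypeR R).
Proof.
rewrite /line_isometry; have h : measurable_fun setT (fun x : R => s * x + t).
  by apply: measurable_funD => //; apply: measurable_funM => //; exact: measurable_id.
exact: h.
Qed.

Lemma leb_isometry (A : set R) : measurable A -> leb (line_isometry @^-1` A) = leb A.
Proof.
move=> mA; apply/esym; rewrite -[RHS]/(pushforward leb line_isometry A).
apply: lebesgue_measure_unique; [exact: measurable_line_isometry| |exact: mA].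
move=> mL _ [[a b]] _ <-.
have pre : line_isometry @^-1` `]a, b]%classic =
    if s == 1 then `]a - t, b - t]%classic else `[t - b, t - a[%classic.
  case: hs => s1; rewrite s1 ?eqxx.
    apply/seteqP; split => x; rewrite /line_isometry /= s1 !in_itv /=;
      by move=> /andP[h1 h2]; apply/andP; split; lra.
  have -> : (-1 == 1 :> R) = false by apply/eqP; lra.
  apply/seteqP; split => x; rewrite /line_isometry /= s1 !in_itv /=;
    by move=> /andP[h1 h2]; apply/andP; split; lra.
transitivity (leb (line_isometry @^-1` `]a, b]%classic)); last by [].
rewrite pre.
case: ifP => _; rewrite !lebesgue_measure_itv /= !lte_fin.
  by rewrite ltrBlDr subrK; case: ifP => // _; congr EFin; ring.
by rewrite ltrD2l ltrN2; case: ifP => // _; congr EFin; ring.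
Qed.

Lemma ge0_integral_isometry (A : set R) (h : R -> \bar R) : measurable A ->
  measurable_fun A h -> (forall y, A y -> (0 <= h y)%E) ->
  (\int[leb]_(x in line_isometry @^-1` A) h (line_isometry x) = \int[leb]_(y in A) h y)%E.
Proof.
move=> mA mh h0.
have := @ge0_integral_pushforward _ _ _ _ _ _ measurable_line_isometry leb A h mA mh.
move=> <-; last by move=> y; rewrite inE; exact: h0.
apply: eq_measure_integral; first exact: measurable_line_isometry.
by move=> mL B mB _; exact: leb_isometry.
Qed.

Lemma integral_isometry (A : set R) (h : R -> R) : measurable A ->
  measurable_fun A h ->
  (\int[leb]_(x in line_isometry @^-1` A) (h (line_isometry x))%:E =
   \int[leb]_(y in A) (h y)%:E)%E.
Proof.
move=> mA /measurable_EFinP mh; rewrite integralE [RHS]integralE; congr (_ - _)%E.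
  have hp : measurable_fun A ((EFin \o h)^\+)%E by exact: measurable_funepos.
  have p0 y : A y -> (0 <= (EFin \o h)^\+ y)%E by [].
  by apply: etrans (ge0_integral_isometry mA hp p0); apply: eq_integral => x _; rewrite !funeposE.
have hn : measurable_fun A ((EFin \o h)^\-)%E by exact: measurable_funeneg.
have n0 y : A y -> (0 <= (EFin \o h)^\- y)%E by [].
by apply: etrans (ge0_integral_isometry mA hn n0); apply: eq_integral => x _; rewrite !funenegE.
Qed.

Lemma measurable_isometry_preimage (A : set R) : measurable A ->
  measurable (line_isometry @^-1` A).
Proof.
by move=> mA; rewrite -[X in measurable X]setTI; exact: measurable_line_isometry.
Qed.

Lemma negligible_isometry (A : set R) : leb.-negligible A ->
  leb.-negligible (line_isometry @^-1` A).
Proof.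
move=> [B [mB B0 AB]]; exists (line_isometry @^-1` B); split.
- exact: measurable_isometry_preimage.
- by rewrite -[RHS]B0; exact: leb_isometry.
- by move=> x /AB.
Qed.

End Isometry.

(** * Reversal of an edge *)

Section Flip.
Context {R : realType}.
Implicit Types (z w : 'cV[R[i]]_2).

(** The change of the components of a spinor under reversal of the coordinate of
    its edge: the Dirac operator is invariant when the second component changes
    its sign. *)
Definition flip (b : bool) z : 'cV[R[i]]_2 :=
  \col_k (if b && (k == 1) then - z k 0 else z k 0).

Lemma flipE b z k : flip b z k 0 = if b && (k == 1) then - z k 0 else z k 0.
Proof. by rewrite mxE. Qed.

Lemma flipK b z : flip b (flip b z) = z.
Proof. by apply/colP => k; rewrite !flipE; case: (b && (k == 1)) => //; rewrite opprK. Qed.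

Lemma flipD b z w : flip b (z + w) = flip b z + flip b w.
Proof. by apply/colP => k; rewrite !mxE; case: ifP => // _; rewrite opprD. Qed.

Lemma flipZ b a z : flip b (a *: z) = a *: flip b z.
Proof. by apply/colP => k; rewrite !mxE; case: ifP => // _; rewrite mulrN. Qed.

Lemma dot_flip b z w : dot (flip b z) (flip b w) = dot z w.
Proof.
apply: eq_bigr => k _; rewrite !flipE; case: ifP => // _.
by case: (z k 0) (w k 0) => [p q] [r s] /=; ring.
Qed.

Lemma sqnorm2_flip b z : sqnorm2 (flip b z) = sqnorm2 z.
Proof. by rewrite !sqnorm2E dot_flip. Qed.

End Flip.

(** * Cutting the half-line into edges *)

Section Pieces.
Context {R : realType} {E : finType} (D : E -> set R) (b : E -> bool).
(* The isometry [tau e] maps the edge [e] onto the closed piece [Jc e] of the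
   half-line, reversing the orientation when [b e] holds, and the point of coordinate
   [pos e] to [off e].  The half-open pieces [J e], which may lack the endpoint
   [pt e], partition the half-line, and [sel] gives the piece of a point. *)
Context (off pos : E -> R) (J Jc : E -> set R) (pt : E -> R) (sel : R -> E).
Local Notation half := (@halfline_dom R).
Let H : set R := half tt.
Let mH : measurable H. Proof. exact: measurable_halfline. Qed.
Implicit Types (u v : spinor R E).

Definition sgn (c : bool) : R := if c then -1 else 1.

Definition tau e : R -> R := line_isometry (sgn (b e)) (off e - sgn (b e) * pos e).
Definition rho e : R -> R := line_isometry (sgn (b e)) (pos e - sgn (b e) * off e).

Context (mJ : forall e, measurable (J e)) (mJc : forall e, measurable (Jc e)).
Context (JcH : forall e, Jc e `<=` H) (JJc : forall e, J e `<=` Jc e).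
Context (Jpt : forall e y, Jc e y -> y <> pt e -> J e y).
Context (Jsel : forall e y, H y -> J e y <-> sel y = e).
Context (DE : forall e, D e = tau e @^-1` Jc e).

Lemma sgnP c : sgn c = 1 \/ sgn c = -1. Proof. by case: c; [right|left]. Qed.

Lemma sgn2 c : sgn c * sgn c = 1. Proof. by case: c; rewrite /sgn; ring. Qed.

Lemma rhoK e : cancel (rho e) (tau e).
Proof.
move=> y; rewrite /tau /rho /line_isometry mulrDr mulrBr !mulrA sgn2 !mul1r.
by ring.
Qed.

Lemma tauK e : cancel (tau e) (rho e).
Proof.
move=> y; rewrite /tau /rho /line_isometry mulrDr mulrBr !mulrA sgn2 !mul1r.
by ring.
Qed.

Lemma mD e : measurable (D e).
Proof. by rewrite DE; exact: measurable_isometry_preimage. Qed.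

Lemma JH e : J e `<=` H.
Proof. by move=> y /JJc /JcH. Qed.

Lemma tauH e x : D e x -> H (tau e x).
Proof. by rewrite DE => /JcH. Qed.

Lemma rhoD e y : J e y -> D e (rho e y).
Proof. by rewrite DE /= rhoK; exact: JJc. Qed.

Lemma H_bigsetU : \big[setU/set0]_(e <- enum E) J e = H.
Proof.
rewrite -bigcup_seq; apply/seteqP; split => [y [e _]|y Hy]; first exact: JH.
by exists (sel y); [rewrite /= mem_enum|exact/(Jsel _ Hy)].
Qed.

Lemma J_trivIset : trivIset [set` enum E] J.
Proof.
by move=> e e' _ _ [y [Jy Jy']]; move: (JH Jy) => Hy;
  rewrite -((Jsel _ Hy).1 Jy) -((Jsel _ Hy).1 Jy').
Qed.

Lemma measurable_pieces (h : R -> R) :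
  (forall e, measurable_fun (J e) h) -> measurable_fun H h.
Proof.
move=> mh _ Y mY; rewrite -H_bigsetU -bigcup_seq setI_bigcupl.
by rewrite bigcup_seq; apply: bigsetU_measurable => e _; apply: mh.
Qed.

Lemma measurable_tau e (h : R -> R) : measurable_fun H h ->
  measurable_fun (D e) (fun x => h (tau e x)).
Proof.
move=> mh; apply: (measurable_comp mH _ mh) => //.
  by move=> y [x Dx <-]; exact: tauH.
exact: measurable_funTS (measurable_line_isometry _ _).
Qed.

Lemma integral_Jc e (h : R -> R) : measurable_fun H h ->
  (\int[leb]_(y in Jc e) (h y)%:E = \int[leb]_(y in J e) (h y)%:E)%E.
Proof.
move=> mh; have mC : measurable (Jc e `\` J e) by exact: measurableD.
have mhe : measurable_fun (Jc e) (EFin \o h).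
  by apply/measurable_EFinP; exact: measurable_funS mh.
have N0 : leb (Jc e `\` J e) = 0%E.
  apply/eqP; rewrite -measure_le0 -(lebesgue_measure_set1 (pt e)); apply: leb_le => //.
  by move=> y [Jcy nJ]; apply: contrapT => /(Jpt Jcy).
have U : J e `|` (Jc e `\` J e) = Jc e by rewrite setDUK //; exact: JJc.
have := @integral_setU _ _ _ leb (J e) (Jc e `\` J e) (EFin \o h) (mJ e) mC.
rewrite U => /(_ mhe) -> //; last by apply/disj_setPS => y [? []].
rewrite [X in (_ + X)%E](@null_set_integral _ _ _ leb) ?adde0 //.
by apply: measurable_funS mhe => //; exact: subDsetl.
Qed.

(** The half-open pieces [J e] partition the half-line, whereas the edges are
    isometric to the closed pieces [Jc e]; the two differ by a null set. *)
Lemma integral_pieces (h : R -> R) : measurable_fun H h ->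
  (\int[leb]_(y in H) (h y)%:E = \sum_e \int[leb]_(x in D e) (h (tau e x))%:E)%E.
Proof.
move=> mh; have mhe : measurable_fun H (EFin \o h) by exact/measurable_EFinP.
have := @integral_bigsetU_EFin _ _ _ leb E J h (enum E) mJ (enum_uniq E) J_trivIset.
rewrite H_bigsetU => /(_ mhe) ->; rewrite big_enum; apply: eq_bigr => e _.
rewrite -integral_Jc // DE; apply/esym.
by apply: integral_isometry; [exact: sgnP|exact: mJc|exact: measurable_funS mh].
Qed.

Lemma int_tau e (h : R -> R) : leb.-integrable H (EFin \o h) ->
  leb.-integrable (D e) (EFin \o (fun x => h (tau e x))).
Proof.
move=> hi; have mh := int_measurable hi.
apply/integrableP; split; first by apply/measurable_EFinP; exact: measurable_tau.
have mn : measurable_fun H (fun y => `|h y|) by exact: measurableT_comp.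
case/integrableP: hi => _.
rewrite (_ : (fun x => _) = (fun x => (`|h x|)%:E)) //.
rewrite (integral_pieces mn) (bigD1 e) //=; apply: le_lt_trans; rewrite leeDl //.
by apply: sume_ge0 => e' _; apply: integral_ge0 => x _; rewrite lee_fin.
Qed.

Lemma Rint_pieces (h : R -> R) : leb.-integrable H (EFin \o h) ->
  (\int[leb]_(y in H) h y = \sum_e \int[leb]_(x in D e) h (tau e x))%R.
Proof.
move=> hi; have mh := int_measurable hi.
rewrite /Rintegral integral_pieces // -sum_fine // => e _.
exact: (@integrable_fin_num _ _ _ leb _ (mD e) _ (int_tau e hi)).
Qed.

Definition toHalf u : spinor R unit :=
  fun _ y => flip (b (sel y)) (u (sel y) (rho (sel y) y)).
Definition toGraph (u : spinor R unit) : spinor R E :=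
  fun e x => flip (b e) (u tt (tau e x)).

Lemma toHalfK (u : spinor R unit) : toHalf (toGraph u) = u.
Proof.
by apply/funext => -[]; apply/funext => y; rewrite /toHalf /toGraph rhoK flipK.
Qed.

Lemma toHalf_tau u e x : J e (tau e x) -> toHalf u tt (tau e x) = flip (b e) (u e x).
Proof.
move=> Jx; have Hx : H (tau e x) by exact: JH Jx.
by rewrite /toHalf ((Jsel e Hx).1 Jx) tauK.
Qed.

Lemma toGraphK u e x : D e x -> x <> rho e (pt e) -> toGraph (toHalf u) e x = u e x.
Proof.
rewrite DE => Dx np; rewrite /toGraph toHalf_tau ?flipK //; apply: Jpt => // tx.
by apply: np; rewrite -tx tauK.
Qed.

(** The value at a common endpoint of two pieces is taken from only one of the
    two edges, so that restriction after gluing is the identity only almost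
    everywhere. *)
Lemma toGraphK_aeeq u : aeeq D (toGraph (toHalf u)) u.
Proof.
move=> e; have N : leb.-negligible [set rho e (pt e)].
  by apply/negligibleP => //; exact: lebesgue_measure_set1.
apply: negligibleS N => x /= /not_implyP[Dx h]; apply: contrapT => np.
by apply: h; exact: toGraphK.
Qed.

Lemma measurable_comp_flip c (k : 'I_2) (A : set R) (h : R -> 'cV[R[i]]_2) :
  (forall k : 'I_2, measurable_fun A (fun x => Re (h x k 0)) /\
                    measurable_fun A (fun x => Im (h x k 0))) ->
  measurable_fun A (fun x => Re (flip c (h x) k 0)) /\
  measurable_fun A (fun x => Im (flip c (h x) k 0)).
Proof.
move=> mh; have [m1 m2] := mh k.
case: (boolP (c && (k == 1))) => ck.
  split.
    apply: eq_measurable_fun (measurable_funN m1) => x _ /=.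
    by rewrite flipE ck raddfN.
  apply: eq_measurable_fun (measurable_funN m2) => x _ /=.
  by rewrite flipE ck raddfN.
by split; [apply: eq_measurable_fun m1|apply: eq_measurable_fun m2] => x _ /=;
  rewrite flipE (negbTE ck).
Qed.

Lemma inL2_modification u v (p : E -> R) :
  (forall e x, D e x -> x <> p e -> u e x = v e x) -> inL2 D u -> inL2 D v.
Proof.
move=> uv uL e; have [mu fu] := uL e; have mDe := mD e.
have mset (h1 h2 : R -> R) : (forall x, D e x -> x <> p e -> h1 x = h2 x) ->
    measurable_fun (D e) h1 -> measurable_fun (D e) h2.
  move=> h12 m1; rewrite -(setDUK (@subIsetl _ (D e) [set p e])).
  have mp : measurable [set p e] by exact: measurable_set1.
  have mDp : measurable (D e `&` [set p e]) by exact: measurableI.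
  apply/measurable_funU => //; first exact: measurableD.
  split.
    apply: (@measurable_funS _ _ _ _ [set p e]) => //; exact: measurable_fun_set1.
  apply: (@eq_measurable_fun _ _ _ _ _ h1).
    move=> x; rewrite inE => -[Dx np]; apply: h12 => // xp.
    by apply: np; split.
  by apply: measurable_funS m1 => //; exact: subDsetl.
split.
  by move=> k; have [m1 m2] := mu k; split;
    [apply: mset m1|apply: mset m2] => x Dx np; rewrite uv.
have ms (w : spinor R E) : (forall k : 'I_2, measurable_fun (D e) (fun x => Re (w e x k 0)) /\
      measurable_fun (D e) (fun x => Im (w e x k 0))) ->
    measurable_fun (D e) (fun x => sqnorm2 (w e x)).
  move=> mw; rewrite /sqnorm2; apply: measurable_sum => k; have [? ?] := mw k.
  by apply: measurable_funD; exact: measurable_funX.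
have mv : measurable_fun (D e) (fun x => sqnorm2 (v e x)).
  by apply: mset (ms u mu) => x Dx np; rewrite uv.
rewrite (integral_ae mDe mv (ms u mu)) //.
have N : leb.-negligible [set p e].
  by apply/negligibleP => //; exact: lebesgue_measure_set1.
apply: negligibleS N => x /= /not_implyP[Dx h]; apply: contrapT => np.
by apply: h; rewrite uv.
Qed.

Lemma toGraph_L2 (u : spinor R unit) : inL2 D (toGraph u) <-> inL2 half u.
Proof.
split=> uL e.
  case: e; have mu k : measurable_fun H (fun y => Re (u tt y k 0)) /\
      measurable_fun H (fun y => Im (u tt y k 0)).
    have mJu e : forall k : 'I_2, measurable_fun (J e) (fun y => Re (u tt y k 0)) /\
                 measurable_fun (J e) (fun y => Im (u tt y k 0)).
      have [mu _] := uL e.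
      have mrho : measurable_fun (J e) (rho e).
        exact: measurable_funTS (measurable_line_isometry _ _).
      have sub : rho e @` J e `<=` D e by move=> x [y Jy <-]; exact: rhoD.
      have mc k' : measurable_fun (J e) (fun y => Re (toGraph u e (rho e y) k' 0)) /\
             measurable_fun (J e) (fun y => Im (toGraph u e (rho e y) k' 0)).
        have [m1 m2] := mu k'; split; first exact: (measurable_comp (mD e) sub m1 mrho).
        exact: (measurable_comp (mD e) sub m2 mrho).
      move=> k'; have := measurable_comp_flip (b e) k' mc.
      by rewrite /toGraph; under eq_fun do rewrite rhoK flipK;
         under [X in _ /\ measurable_fun _ X -> _]eq_fun do rewrite rhoK flipK.
    by split; apply: measurable_pieces => e; have [] := mJu e k.
  split => //.
  have ms : measurable_fun H (fun x => sqnorm2 (u tt x)).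
    rewrite /sqnorm2; apply: measurable_sum => k; have [? ?] := mu k.
    by apply: measurable_funD; exact: measurable_funX.
  rewrite (integral_pieces ms); elim/big_ind: _ => //; first exact: lte_add_pinfty.
  move=> e _; have [_] := uL e; rewrite /toGraph.
  by under eq_integral do rewrite sqnorm2_flip.
have [mu fu] := uL tt; have si := inL2_int tt uL; split.
  move=> k; apply: measurable_comp_flip => k'; have [m1 m2] := mu k'.
  by split; [have := @measurable_tau e _ m1|have := @measurable_tau e _ m2].
have := int_tau e si => /integrable_lty => /(_ (mD e)).
apply: le_lt_trans; rewrite le_eqVlt; apply/orP; left; apply/eqP/eq_integral => x _.
by rewrite /toGraph /= sqnorm2_flip.
Qed.

Lemma toHalf_L2 u : inL2 half (toHalf u) <-> inL2 D u.
Proof.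
rewrite -toGraph_L2; split; apply: (@inL2_modification _ _ (fun e => rho e (pt e))) => e x Dx np.
  exact: toGraphK.
by rewrite toGraphK.
Qed.

Lemma toGraph_rinner (u v : spinor R unit) : inL2 half u -> inL2 half v ->
  rinner D (toGraph u) (toGraph v) = rinner half u v.
Proof.
move=> uL vL; rewrite rinner_halfline.
rewrite (Rint_pieces (dot_int (@measurable_halfline R) tt uL vL)).
apply: eq_bigr => e _; apply: eq_Rintegral => x _; exact: dot_flip.
Qed.

Lemma toGraphZ a (u : spinor R unit) : (fun e x => a *: toGraph u e x) =
  toGraph (fun e x => a *: u e x).
Proof. by apply/funext => e; apply/funext => x; rewrite /toGraph flipZ. Qed.

Lemma toGraph_inner (u v : spinor R unit) : inL2 half u -> inL2 half v ->
  inner D (toGraph u) (toGraph v) = inner half u v.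
Proof.
move=> uL vL; rewrite !innerE toGraph_rinner // toGraphZ toGraph_rinner //.
exact: inL2Z (@measurable_halfline R) _ _ uL.
Qed.

Lemma toHalf_aeeq u v : aeeq D u v -> aeeq half (toHalf u) (toHalf v).
Proof.
move=> uv e; case: e.
pose N e := ~` [set x | D e x -> u e x = v e x].
have neg : leb.-negligible (\big[setU/set0]_(e <- enum E) (rho e @^-1` N e)).
  elim/big_ind: _ => [|A B|e _]; [exact: negligible_set0|exact: negligibleU|].
  by apply: negligible_isometry; [exact: sgnP|exact: uv].
apply: negligibleS neg => y /= /not_implyP[Hy h].
rewrite -bigcup_seq; exists (sel y); first by rewrite /= mem_enum.
move=> uv'; apply: h; rewrite /toHalf uv' //; apply: rhoD; exact/(Jsel _ Hy).
Qed.

Lemma toGraph_aeeq (u v : spinor R unit) : aeeq half u v ->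
  aeeq D (toGraph u) (toGraph v).
Proof.
move=> /(_ tt) uv e.
have neg : leb.-negligible (tau e @^-1` ~` [set x | half tt x -> u tt x = v tt x]).
  by apply: negligible_isometry; [exact: sgnP|exact: uv].
apply: negligibleS neg => x /=.
move=> /not_implyP[Dx h] uv'; apply: h; rewrite /toGraph uv' //; exact: tauH.
Qed.

Lemma pieces_equiv : spinor_equiv D half toHalf toGraph.
Proof.
have VL u : inL2 D u -> inL2 half (toHalf u) by move/toHalf_L2.
split.
- move=> a u v; apply/funext => e; apply/funext => y.
  by rewrite /toHalf flipD flipZ.
- move=> a u v; apply/funext => e; apply/funext => y.
  by rewrite /toGraph flipD flipZ.
- exact: toHalf_L2.
- exact: toGraph_L2.
- move=> u v uL vL; rewrite -toGraph_inner; [|exact: VL..].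
  apply: (eq_inner mD) => //; try exact: toGraphK_aeeq; apply/toGraph_L2; exact: VL.
- exact: toGraph_inner.
- exact: toHalf_aeeq.
- exact: toGraph_aeeq.
- exact: toGraphK_aeeq.
- by move=> u; rewrite toHalfK; exact: aeeq_refl.
Qed.

(** Integrability is essential: a divergent integral has the default value 0,
    and a divergence on one edge does not annihilate the sum over the edges. *)
Lemma potential_toGraph (F : R -> R) (u : spinor R unit) :
  leb.-integrable H (EFin \o (fun x => F (sqnorm2 (u tt x)))) ->
  \sum_e (\int[leb]_(x in D e) F (sqnorm2 (toGraph u e x)))%R =
  \sum_e (\int[leb]_(x in half e) F (sqnorm2 (u e x)))%R.
Proof.
move=> Fi; rewrite [RHS](bigD1 tt) //= [X in _ + X]big1 ?addr0; last by case.
rewrite (Rint_pieces Fi); apply: eq_bigr => e _; apply: eq_Rintegral => x _.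
by rewrite /toGraph sqnorm2_flip.
Qed.

End Pieces.

(** * Metric graphs isometric to the half-line *)

Section GraphMetric.
Context {R : realType} (G : mgraph R).

Lemma route_lipschitz (psi : edge G * R -> R) :
  (forall e x y, edge_dom e x -> edge_dom e y -> `|psi (e, x) - psi (e, y)| <= `|x - y|) ->
  (forall (d d' : edge G * bool) v, end_vert d = Some v -> end_vert d' = Some v ->
     psi (d.1, end_pos d) = psi (d'.1, end_pos d')) ->
  forall p q r, on_graph p -> route p q r -> on_graph q /\ `|psi p - psi q| <= r.
Proof.
move=> lip vtx p q r pG; elim=> [|e x y r' _ [xG IH] yG|d d' v r' _ [dG IH] dv dv'].
- by rewrite subrr normr0.
- split=> //; apply: le_trans (ler_distD (psi (e, x)) _ _) _; rewrite lerD //.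
  exact: lip.
- split; last by rewrite -(vtx _ _ _ dv dv').
  move: dv'; case: (d') => e [] /=; rewrite /on_graph /edge_dom /end_vert /end_pos /=;
    case: (tail e) (head e) => [t|] [h|] //= _; rewrite ?in_itv /= ?lexx ?ltW ?len_gt0 //.
Qed.

(** The distance is an infimum over routes; test functions that are 1-Lipschitz
    along edges and single-valued at vertices bound it from below. *)
Lemma gdist_ge (psi : edge G * R -> R) (p q : edge G * R) :
  (forall e x y, edge_dom e x -> edge_dom e y -> `|psi (e, x) - psi (e, y)| <= `|x - y|) ->
  (forall (d d' : edge G * bool) v, end_vert d = Some v -> end_vert d' = Some v ->
     psi (d.1, end_pos d) = psi (d'.1, end_pos d')) ->
  on_graph p -> (`|psi p - psi q|%:E <= gdist p q)%E.
Proof.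
move=> lip vtx pG; apply: le_ereal_inf_tmp => _ [r pqr <-]; rewrite lee_fin.
by have [] := route_lipschitz lip vtx pG pqr.
Qed.

Lemma gdist_le (p q : edge G * R) r : route p q r -> (gdist p q <= r%:E)%E.
Proof. by move=> pqr; apply: ereal_inf_lbound; exists r. Qed.

(** Let [a] be the position on the half-line of the point of coordinate 0.  The
    points of coordinates [a + 1] and [- (a + 1)] are both at distance [a + 1]
    from it, hence both at position [2 * a + 1], but they are different. *)
Lemma isometric_no_line (e : edge G) : isometric_to_halfline G ->
  tail e = None -> head e = None -> False.
Proof.
move=> [phi [phi0 phiE _]] te he.
have eG x : on_graph (e, x) by rewrite /on_graph /edge_dom /= te he.
pose psi (p : edge G * R) := if p.1 == e then p.2 else 0.
have lip e' x y : edge_dom e' x -> edge_dom e' y ->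
    `|psi (e', x) - psi (e', y)| <= `|x - y|.
  by move=> _ _; rewrite /psi /=; case: ifP => // _; rewrite subrr normr0.
have none (d : edge G * bool) v : end_vert d = Some v -> d.1 == e = false.
  move=> dv; apply/eqP => de; move: dv; rewrite /end_vert de.
  by case: (d.2); rewrite ?te ?he.
have vtx (d d' : edge G * bool) v : end_vert d = Some v -> end_vert d' = Some v ->
    psi (d.1, end_pos d) = psi (d'.1, end_pos d').
  by move=> /none h /none h'; rewrite /psi /= h h'.
have dist x y : `|phi (e, x) - phi (e, y)| = `|x - y|.
  apply/eqP; rewrite eq_le -!lee_fin -phiE //; apply/andP; split.
    have r1 : route (e, x) (e, y) (0 + `|x - y|).
      by apply: route_along; [exact: route_nil|exact: eG].
    by have := gdist_le r1; rewrite add0r.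
  have := @gdist_ge psi (e, x) (e, y) lip vtx (eG x).
  by rewrite /psi /= eqxx.
set a := phi (e, 0); have a0 : 0 <= a by exact: phi0.
have h1 := dist (a + 1) 0; have h2 := dist (- (a + 1)) 0.
have h3 := dist (a + 1) (- (a + 1)).
have p1 := phi0 _ (eG (a + 1)); have p2 := phi0 _ (eG (- (a + 1))).
move: h1 h2 h3 p1 p2; rewrite -/a !subr0 opprK normrN.
have -> : `|a + 1| = a + 1 by rewrite ger0_norm //; lra.
have -> : `|a + 1 + (a + 1)| = a + 1 + (a + 1) by rewrite ger0_norm //; lra.
move: (phi _) (phi _) => b c h1 h2 h3 b0 c0.
have far (x : R) : 0 <= x -> `|x - a| = a + 1 -> x = a + (a + 1).
  by move=> x0; case: (ger0P (x - a)) => h h'; lra.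
move: h3; rewrite (far _ b0 h1) (far _ c0 h2) subrr normr0 => h3.
by move: a0 h3; clear => a0 h3; lra.
Qed.

Definition near_end (d : edge G * bool) (r : R) : R :=
  end_pos d + (if d.2 then - r else r).

Lemma near_end_dom (d : edge G * bool) v r : end_vert d = Some v ->
  0 <= r -> r <= len d.1 -> edge_dom d.1 (near_end d r).
Proof.
case: d => e []; rewrite /end_vert /edge_dom /near_end /end_pos /=;
  case: (tail e) (head e) => [t|] [h|] //= _ r0 rl; rewrite ?in_itv /= ?andbT ?add0r //.
- by apply/andP; split; lra.
- by rewrite oppr_le0.
- by apply/andP; split; lra.
Qed.

Lemma near_end_far (d d' : edge G * bool) v v' r : end_vert d = Some v ->
  end_vert d' = Some v' -> d'.1 = d.1 -> 0 <= r -> r <= len d.1 / 3 ->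
  r <= `|end_pos d' - near_end d r| /\ (d' != d -> r <= `|near_end d' r - near_end d r|).
Proof.
case: d => e b; case: d' => e' b' /= dv dv' ee; rewrite {}ee in dv' *.
have l0 := len_gt0 e.
move: dv dv'; rewrite /end_vert /near_end /end_pos /=.
rewrite xpair_eqE eqxx /=.
case: b; case: b' => /=; case: (tail e) (head e) => [t|] [h|] //= _ _ r0 rl; split=> //;
  do ?[move=> _]; rewrite ler_normr; apply/orP; (try by left; lra); by right; lra.
Qed.

(** Three edge ends at a vertex give three different points at the same small
    distance [r] from it, whereas a point of a half-line has at most two such
    points.  Tent functions supported near each of the three points show that
    the distances are what they should be. *)
Lemma isometric_degree_le2 (v : vert G) : isometric_to_halfline G -> (degree v <= 2)%N.
Proof.
move=> [phi [phi0 phiE _]]; rewrite leqNgt; apply/negP => /card_gt2P.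
move=> [d1 [d2 [d3 [[/eqP v1 /eqP v2 /eqP v3] [n12 n23 n31]]]]].
(* The tents of radius [r] around the three points then reach neither a vertex nor
   each other. *)
pose r := Num.min (len d1.1) (Num.min (len d2.1) (len d3.1)) / 3.
have r0 : 0 < r by rewrite divr_gt0 // !lt_min !len_gt0.
have rl d : d \in [:: d1; d2; d3] -> r <= len d.1 / 3.
  by rewrite !inE => /or3P[] /eqP ->; rewrite ler_pM2r ?invr_gt0 // !ge_min lexx ?orbT.
have ev d : d \in [:: d1; d2; d3] -> end_vert d = Some v.
  by rewrite !inE => /or3P[] /eqP ->.
pose psi d (p : edge G * R) := if p.1 == d.1 then Num.max 0 (r - `|p.2 - near_end d r|) else 0.
have lip d e x y : edge_dom e x -> edge_dom e y ->
    `|psi d (e, x) - psi d (e, y)| <= `|x - y|.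
  move=> _ _; rewrite /psi /=; case: ifP => [_|]; last by rewrite subrr normr0.
  set n := near_end d r.
  have t1 : `|x - n| <= `|y - n| + `|x - y|.
    by rewrite [leRHS]addrC; exact: ler_distD.
  have t2 : `|y - n| <= `|x - n| + `|x - y|.
    by rewrite [leRHS]addrC (distrC x y); exact: ler_distD.
  have n0 := normr_ge0 (x - y).
  move: t1 t2 n0; move: (`|x - n|) (`|y - n|) (`|x - y|) => a b' c t1 t2 n0.
  rewrite ler_norml; case: (leP 0 (r - a)) => ?; case: (leP 0 (r - b')) => ?;
    by apply/andP; split; lra.
have psi0 d d' v' : d \in [:: d1; d2; d3] -> end_vert d' = Some v' ->
    psi d (d'.1, end_pos d') = 0.
  move=> dd dv'; rewrite /psi /=; case: eqP => // de.
  have [h _] := near_end_far (ev _ dd) dv' de (ltW r0) (rl _ dd).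
  by apply/max_idPl; rewrite subr_le0.
have vtx d (da db : edge G * bool) w : d \in [:: d1; d2; d3] ->
    end_vert da = Some w -> end_vert db = Some w ->
    psi d (da.1, end_pos da) = psi d (db.1, end_pos db).
  by move=> dd va vb; rewrite (psi0 d da w) // (psi0 d db w).
have rlen d : d \in [:: d1; d2; d3] -> r <= len d.1.
  by move=> /rl h; apply: le_trans h _; rewrite ler_pdivrMr // ler_peMr ?ltW ?len_gt0 //; lra.
have nG d : d \in [:: d1; d2; d3] -> on_graph (d.1, near_end d r).
  by move=> dd; apply: near_end_dom (ev _ dd) (ltW r0) (rlen _ dd).
have end_near d : end_pos d = near_end d 0.
  by rewrite /near_end; case: (d.2); rewrite ?oppr0 addr0.
have eG d : d \in [:: d1; d2; d3] -> on_graph (d.1, end_pos d).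
  move=> dd; rewrite end_near; apply: near_end_dom (ev _ dd) _ _ => //.
  exact: ltW (len_gt0 _).
have psin d : psi d (d.1, near_end d r) = r.
  by rewrite /psi /= eqxx subrr normr0 subr0; apply/max_idPr; rewrite ltW.
have d1in : d1 \in [:: d1; d2; d3] by rewrite mem_head.
pose o := phi (d1.1, end_pos d1).
have radius d : d \in [:: d1; d2; d3] -> `|o - phi (d.1, near_end d r)| = r.
  move=> dd; have dE := phiE _ _ (eG _ d1in) (nG _ dd).
  apply/eqP; rewrite eq_le -!lee_fin -dE; apply/andP; split.
    have r1 : route (d1.1, end_pos d1) (d.1, end_pos d) 0.
      by apply: (route_vertex (d := d1) (v := v)); [exact: route_nil|exact: ev|exact: ev].
    have r2 : route (d1.1, end_pos d1) (d.1, near_end d r) (0 + `|end_pos d - near_end d r|).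
      exact: route_along r1 (nG _ dd).
    apply: le_trans (gdist_le r2) _; rewrite lee_fin add0r /near_end opprD addNKr.
    by case: (d.2); rewrite ?opprK ?normrN ger0_norm // ltW.
  have := @gdist_ge (psi d) (d1.1, end_pos d1) (d.1, near_end d r) (@lip d)
     (fun da db w => vtx d da db w dd) (eG _ d1in).
  by rewrite (psi0 d d1 v) // psin sub0r normrN ger0_norm // ltW.
have apart d d' : d \in [:: d1; d2; d3] -> d' \in [:: d1; d2; d3] -> d != d' ->
    phi (d.1, near_end d r) != phi (d'.1, near_end d' r).
  move=> dd dd' ne; apply/eqP => pe.
  have := @gdist_ge (psi d) (d.1, near_end d r) (d'.1, near_end d' r) (@lip d)
     (fun da db w => vtx d da db w dd) (nG _ dd).
  rewrite (phiE _ _ (nG _ dd) (nG _ dd')) pe subrr normr0 lee_fin psin.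
  have -> : psi d (d'.1, near_end d' r) = 0.
    rewrite /psi /=; case: eqP => // de.
    have [_ h] := near_end_far (ev _ dd) (ev _ dd') de (ltW r0) (rl _ dd).
    by apply/max_idPl; rewrite subr_le0 h // eq_sym.
  by rewrite subr0 normr_le0 gt_eqF.
have d2in : d2 \in [:: d1; d2; d3] by rewrite !inE eqxx orbT.
have d3in : d3 \in [:: d1; d2; d3] by rewrite !inE eqxx !orbT.
have := radius _ d1in; have := radius _ d2in; have := radius _ d3in.
have /eqP := apart _ _ d1in d2in n12; have /eqP := apart _ _ d2in d3in n23.
have /eqP := apart _ _ d3in d1in n31.
move: (phi (d1.1, _)) (phi (d2.1, _)) (phi (d3.1, _)) => a b c ne1 ne2 ne3.
have two x : `|o - x| = r -> x = o - r \/ x = o + r.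
  by case: (ger0P (o - x)) => _ h; [left|right]; lra.
move=> h1 h2 h3; case: (two _ h1) => e1; case: (two _ h2) => e2; case: (two _ h3) => e3; congruence.
Qed.

End GraphMetric.

(** * The graph as a walk *)

Section Walks.
Context {R : realType} (G : mgraph R).
Implicit Types (a d : edge G * bool) (p : nat -> edge G * bool).

Definition opposite a : edge G * bool := (a.1, ~~ a.2).

Lemma oppositeK : involutive opposite.
Proof. by case=> e b; rewrite /opposite /= negbK. Qed.

Lemma end_opposite a : end_vert (opposite a) = opp_vert a.
Proof. by []. Qed.

Lemma opp_opposite a : opp_vert (opposite a) = end_vert a.
Proof. by rewrite -{2}(oppositeK a). Qed.

Lemma same_edge a d : a.1 = d.1 -> a = d \/ a = opposite d.
Proof.
case: a d => e [] [e' []] /= ->; by [left|right].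
Qed.

(** A walk through the whole graph that starts at a terminal vertex and ends with
    a half-line; [walk_ends] says that nothing else is attached to its
    vertices. *)
Record ray_walk p (vx : nat -> vert G) (n : nat) : Prop := RayWalk {
  walk_start : forall i, (i <= n)%N -> end_vert (p i) = Some (vx i);
  walk_next : forall i, (i < n)%N -> opp_vert (p i) = Some (vx i.+1);
  walk_last : opp_vert (p n) = None;
  walk_inj : forall i j, (i <= n)%N -> (j <= n)%N -> (p i).1 = (p j).1 -> i = j;
  walk_ends : forall i a, (i <= n)%N -> end_vert a = Some (vx i) ->
    a = p i \/ exists2 j, i = j.+1 & a = opposite (p j);
  walk_edge : forall e, exists2 i, (i <= n)%N & (p i).1 = e;
  walk_vert : forall v, exists2 i, (i <= n)%N & vx i = v }.

Definition linked p n := forall i, (i < n)%N -> exists w,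
  [/\ degree w = 2%N, opp_vert (p i) = Some w & end_vert (p i.+1) = Some w].

(** The walk already provides two edge ends at each inner vertex, and one at the
    initial vertex; by the degree bounds these are all of them.  The set of the
    vertices visited is thus closed under adjacency, hence it is everything by
    connectedness. *)
Lemma ray_walk_exists p n v0 : generalized_star G ->
  (forall v : vert G, (degree v <= 2)%N) -> linked p n ->
  (forall i j, (i <= n)%N -> (j <= n)%N -> (p i).1 = (p j).1 -> i = j) ->
  opp_vert (p n) = None -> end_vert (p 0) = Some v0 -> degree v0 != 2%N ->
  exists vx, ray_walk p vx n.
Proof.
move=> [ebh _ _ conn _] deg2 lk inj lastN start deg0.
pose vx i := odflt v0 (end_vert (p i)).
have st i : (i <= n)%N -> end_vert (p i) = Some (vx i).
  rewrite /vx; case: i => [|i] lein; first by rewrite start.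
  by have [w [_ _ ->]] := lk _ lein.
have nx i : (i < n)%N -> opp_vert (p i) = Some (vx i.+1).
  by move=> lin; have [w [_ -> wE]] := lk _ lin; rewrite -wE; exact: st.
have vx0 : vx 0%N = v0 by rewrite /vx start.
have ends i a : (i <= n)%N -> end_vert a = Some (vx i) ->
    a = p i \/ exists2 j, i = j.+1 & a = opposite (p j).
  move=> lein ai; case: (eqVneq a (p i)) => [->|ne]; [by left|right].
  case: i lein ai ne => [_ ai ne|i lin ai ne].
    have : (1 < degree v0)%N.
      apply/card_gt1P; exists a, (p 0%N); split=> //; rewrite inE ?ai ?vx0 //.
      by rewrite st // vx0.
    by rewrite ltn_neqAle eq_sym; move: (deg2 v0) deg0; case: (degree v0) => [|[|[]]].
  exists i => //; apply/eqP; apply: contraT => ne2.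
  have : (2 < degree (vx i.+1))%N.
    apply/card_gt2P; exists a, (p i.+1), (opposite (p i)); split; last first.
      split=> //; last by rewrite eq_sym.
      apply/eqP => /(congr1 fst)/= /(inj _ _ lin (ltnW lin)) /eqP.
      by rewrite (gtn_eqF (ltnSn i)).
    split; rewrite inE ?ai // ?end_opposite ?nx //; first by rewrite st.
  by rewrite ltnNge deg2.
have vert_in v : exists2 i, (i <= n)%N & vx i = v.
  have := conn v0 v; case/connectP => s; elim/last_ind: s v => [|s z IH] v.
    by move=> _ ->; exists 0%N.
  rewrite rcons_path last_rcons => /andP[ps /existsP[a /andP[/eqP av /eqP aw]]] ->.
  have [i lein ie] := IH _ ps erefl; rewrite -ie in av.
  case: (ends _ _ lein av) => [ap|[j ij ap]]; rewrite ap in aw.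
    case: (ltnP i n) => [lin|len]; first by exists i.+1 => //; move: aw; rewrite nx // => -[].
    by move: aw; have -> : i = n by [apply/eqP; rewrite eqn_leq lein]; rewrite lastN.
  have ljn : (j <= n)%N by apply: ltnW; rewrite -ij.
  by exists j => //; move: aw; rewrite opp_opposite st // => -[].
exists vx; split=> // e.
have [a ae [v av]] : exists2 a, a.1 = e & exists v, end_vert a = Some v.
  move: (ebh e); rewrite /bounded_edge /halfline_edge.
  case te: (tail e) => [t|]; first by exists (e, false) => //; exists t.
  by case he: (head e) => [h|] // _; exists (e, true) => //; exists h.
have [i lein iv] := vert_in v; rewrite -iv in av.
case: (ends _ _ lein av) => [ap|[j ij ap]]; first by exists i => //; rewrite -ae ap.
by exists j; [apply: ltnW; rewrite -ij|rewrite -ae ap].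
Qed.

End Walks.

Section Reduction.
Context {R : realType} (G G' : mgraph R).

Lemma path_mem_prev (T : eqType) (r : rel T) x s y : path r x s ->
  y \in x :: s -> y = x \/ exists z, r z y.
Proof.
elim: s x => [|z s IH] x /=; first by rewrite inE => _ /eqP; left.
case/andP=> xz ps; rewrite inE => /orP[/eqP|ys]; [by left|right].
by case: (IH _ ps ys) => [->|//]; exists x.
Qed.

Lemma path_mem_next (T : eqType) (r : rel T) x s y : path r x s ->
  y \in x :: s -> y = last x s \/ exists z, r y z.
Proof.
elim: s x => [|z s IH] x /=; first by rewrite inE => _ /eqP; left.
case/andP=> xz ps; rewrite inE => /orP[/eqP ->|ys]; first by right; exists z.
exact: IH.
Qed.

Lemma uniq_in_flatten (T : eqType) (ss : seq (seq T)) s :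
  uniq (flatten ss) -> s \in ss -> uniq s.
Proof.
elim: ss => [|s' ss IH] //=; rewrite cat_uniq => /and3P[us' _ uss].
by rewrite inE => /orP[/eqP ->|/(IH uss)].
Qed.

(** A vertex of degree different from 2 is a vertex of the reduction, where its
    edge ends are the extremities of the chains ending there: an edge in the
    interior of a chain only meets vertices of degree 2.  Hence the degree does
    not increase when passing back to the graph. *)
Lemma reduction_degree_le2 : essential_reduction G G' -> isometric_to_halfline G' ->
  forall v : vert G, (degree v <= 2)%N.
Proof.
move=> [vmap [chain [vinj vdeg perm ch]]] iso v.
case: (eqVneq (degree v) 2%N) => [->//|dv].
have [v' vE] := (vdeg v).2 dv; apply: leq_trans (isometric_degree_le2 v' iso).
pose ends' := [pred d : edge G' * bool | end_vert d == Some v'].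
have [a0 _|none] := pickP [pred d : edge G * bool | end_vert d == Some v]; last first.
  by rewrite [degree v]eq_card0.
pose g (d : edge G' * bool) :=
  if d.2 then opposite (last a0 (chain d.1)) else seq.head a0 (chain d.1).
apply: (@leq_trans #|[seq g d | d in ends']|); last exact: leq_image_card.
apply/subset_leq_card/fintype.subsetP => a; rewrite inE => /eqP av; apply/fintype.imageP.
have : a.1 \in flatten [seq map fst (chain e) | e <- enum (edge G')].
  by rewrite (perm_mem perm) mem_enum.
case/flattenP => _ /mapP[e' _ ->] /mapP[d dch ad].
have [h [s [hs ps tE hE _]]] := ch e'.
have gE b : g (e', b) = if b then opposite (last h s) else h.
  by rewrite /g /= hs.
have omapP (o : option (vert G')) : Some v = omap vmap o -> o = Some v'.
  by case: o => //= w [vw]; rewrite (vinj w v') // -vw.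
rewrite hs in dch.
case: (same_edge ad) => aE.
  exists (e', false); last first.
    rewrite gE aE; case: (path_mem_prev ps dch) => // -[z /existsP[w]].
    by case/and3P=> dw _; rewrite -aE av => /eqP[vw]; rewrite vw dw in dv.
  rewrite inE /end_vert /=; apply/eqP/omapP; rewrite -tE -av aE.
  case: (path_mem_prev ps dch) => [->//|[z /existsP[w]]].
  by case/and3P=> dw _; rewrite -aE av => /eqP[vw]; rewrite vw dw in dv.
have al : a = opposite (last h s).
  rewrite aE; case: (path_mem_next ps dch) => [->//|[z /existsP[w]]].
  case/and3P=> dw; rewrite -end_opposite -aE av => /eqP[vw] _.
  by rewrite vw dw in dv.
exists (e', true); last by rewrite gE.
by rewrite inE /end_vert /=; apply/eqP/omapP; rewrite -hE -av al.
Qed.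

(** The chain containing some half-line is the whole graph.  It has an extremity
    without vertex, which may be its beginning, in which case it is reversed; its
    other extremity has a vertex, as otherwise the reduction would contain a
    line. *)
Lemma reduction_ray_walk : generalized_star G -> essential_reduction G G' ->
  isometric_to_halfline G' -> exists p vx n, @ray_walk R G p vx n.
Proof.
move=> hG hG' iso; have deg2 := reduction_degree_le2 hG' iso.
case: hG' => [vmap [chain [vinj vdeg perm ch]]].
have [_ _ [e eH] _ _] := hG.
have : e \in flatten [seq map fst (chain e) | e <- enum (edge G')].
  by rewrite (perm_mem perm) mem_enum.
case/flattenP => _ /mapP[e' _ ->] /mapP[d dch ed].
have [h [s [hs ps tE hE _]]] := ch e'.
pose p i := nth h (h :: s) i; pose n := size s.
have lk : linked p n.
  move=> i lin; have /(pathP h)/(_ i lin)/existsP[w /and3P[/eqP dw /eqP ow /eqP ew]] := ps.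
  by exists w.
have inj i j : (i <= n)%N -> (j <= n)%N -> (p i).1 = (p j).1 -> i = j.
  have : uniq (map fst (chain e')).
    have : uniq (flatten [seq map fst (chain e) | e <- enum (edge G')]).
      by rewrite (perm_uniq perm) enum_uniq.
    move/uniq_in_flatten; apply; apply/mapP; exists e' => //; exact: mem_enum.
  rewrite hs => u lin ljn pij.
  apply/eqP; rewrite -(nth_uniq h.1 _ _ u) ?size_map //; apply/eqP.
  by rewrite !(nth_map h) ?size_map.
have p0 : p 0%N = h by [].
have pn : p n = last h s by rewrite /p (last_nth h).
have not2 v' : degree (vmap v') != 2%N by apply/vdeg; exists v'.
have lastN_start : opp_vert (last h s) = None -> exists v', end_vert h = Some (vmap v').
  rewrite hE tE; case te: (tail e') => [t|]; first by exists t.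
  by case he: (head e') => // _; case: (isometric_no_line iso te he).
have startN_last : end_vert h = None -> exists v', opp_vert (last h s) = Some (vmap v').
  rewrite hE tE; case he: (head e') => [t|]; first by exists t.
  by case te: (tail e') => // _; case: (isometric_no_line iso te he).
rewrite hs in dch.
have [lN|hN] : opp_vert (last h s) = None \/ end_vert h = None.
  have : end_vert d = None \/ opp_vert d = None.
    move: eH; rewrite ed /halfline_edge /opp_vert /end_vert /=.
    by case: (d.2); case: (tail _); case: (head _) => //=; auto.
  case=> dN.
    case: (path_mem_prev ps dch) => [<-|[z /existsP[w]]]; first by right.
    by rewrite dN => /and3P[].
  case: (path_mem_next ps dch) => [<-|[z /existsP[w]]]; first by left.
  by rewrite dN => /and3P[].
- have [v' sv] := lastN_start lN.
  have [vx w] := @ray_walk_exists _ G p n (vmap v') hG deg2 lk inj (etrans (congr1 _ pn) lN) sv (not2 v').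
  by exists p, vx, n.
have [v' sv] := startN_last hN.
pose q i := opposite (p (n - i)%N).
have [||||vx w] := @ray_walk_exists _ G q n (vmap v') hG deg2 _ _ _ _ (not2 v').
- move=> i lin; have [|w [dw ow ew]] := lk (n - i.+1)%N; first by rewrite ltn_subrL /= (leq_ltn_trans _ lin).
  by exists w; split; rewrite /q ?opp_opposite ?end_opposite // -ew subnSK.
- move=> i j lin ljn /(inj _ _ (leq_subr _ _) (leq_subr _ _)) /eqP.
  by rewrite eqn_sub2lE // => /eqP.
- by rewrite /q subnn opp_opposite.
- by rewrite /q subn0 end_opposite pn.
by exists q, vx, n.
Qed.

End Reduction.

(** * Primitives and isometries *)

Section ComplexIntegral.
Context {R : realType}.
Implicit Types (A : set R) (h : R -> R[i]).

Definition cintegrable A h :=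
  leb.-integrable A (EFin \o (fun t => Re (h t))) /\
  leb.-integrable A (EFin \o (fun t => Im (h t))).

Lemma complex_eq (z w : R[i]) : Re z = Re w -> Im z = Im w -> z = w.
Proof. by case: z w => [a b] [a' b'] /= -> ->. Qed.

Lemma Re_realM (r : R) (z : R[i]) : Re (r%:C * z) = r * Re z.
Proof. by case: z => a b /=; rewrite mul0r subr0. Qed.

Lemma Im_realM (r : R) (z : R[i]) : Im (r%:C * z) = r * Im z.
Proof. by case: z => a b /=; rewrite mul0r addr0. Qed.

Lemma cintegrableZ A h (r : R) : measurable A -> cintegrable A h ->
  cintegrable A (fun t => r%:C * h t).
Proof.
move=> mA [i1 i2]; split.
  by have := intZ mA r i1; under eq_fun do rewrite -Re_realM.
by have := intZ mA r i2; under eq_fun do rewrite -Im_realM.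
Qed.

Lemma cintZ A h (r : R) : measurable A -> cintegrable A h ->
  cint A (fun t => r%:C * h t) = r%:C * cint A h.
Proof.
move=> mA [i1 i2]; apply: complex_eq.
  rewrite Re_realM /= -(RintZ mA r i1); apply: eq_Rintegral => t _; exact: Re_realM.
rewrite Im_realM /= -(RintZ mA r i2); apply: eq_Rintegral => t _; exact: Im_realM.
Qed.

Lemma eq_cint A h h' : {in A, h =1 h'} -> cint A h = cint A h'.
Proof.
by move=> hh; apply: complex_eq => /=; apply: eq_Rintegral => t At; rewrite hh.
Qed.

Lemma eq_cint_bndo (x y : R) h h' : cintegrable `[x, y] h ->
  {in `[x, y[, h =1 h'} -> cint `[x, y] h = cint `[x, y] h'.
Proof.
have r (f g : R -> R) : leb.-integrable `[x, y] (EFin \o f) ->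
    {in (`[x, y[%classic : set R), f =1 g} ->
    (\int[leb]_(t in `[x, y]) f t = \int[leb]_(t in `[x, y]) g t)%R.
  move=> fi fg; have mO : measurable (`[x, y[%classic : set R) by exact: measurable_itv.
  have fi' : leb.-integrable `[x, y[ (EFin \o f).
    apply: intS fi; [exact: measurable_itv|exact: mO|].
    by move=> t /=; rewrite !in_itv /= => /andP[-> /ltW].
  have gi' := eq_int mO fg fi'.
  rewrite -(Rintegral_itv_bndo_bndc fi') -(Rintegral_itv_bndo_bndc gi').
  exact: eq_Rintegral.
move=> [i1 i2] hh; apply: complex_eq => /=; apply: r => // t.
  by rewrite inE /= => /hh ->.
by rewrite inE /= => /hh ->.
Qed.

Lemma cint_split (x y z : R) h : x <= y -> y <= z ->
  cintegrable `[x, z] h ->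
  cint `[x, z] h = cint `[x, y] h + cint `[y, z] h.
Proof.
move=> xy yz hi.
have r (f : R -> R) : leb.-integrable `[x, z] (EFin \o f) ->
    (\int[leb]_(t in `[x, z]) f t =
     \int[leb]_(t in `[x, y]) f t + \int[leb]_(t in `[y, z]) f t)%R.
  move=> fi; have fi' : leb.-integrable `]y, z] (EFin \o f).
    apply: intS fi; [exact: measurable_itv|exact: measurable_itv|].
    by move=> t /=; rewrite !in_itv /= => /andP[h1 ->]; rewrite andbT (le_trans xy) // ltW.
  have e1 := @Rintegral_itvB R f (BLeft x) (BRight z) y fi.
  rewrite !bnd_simp in e1; have {}e1 := e1 xy yz.
  by rewrite -(Rintegral_itv_obnd_cbnd fi') -e1 addrC subrK.
have [i1 i2] := hi; apply: complex_eq; [have := r _ i1|have := r _ i2];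
  by rewrite /cint /=.
Qed.

Lemma itv_isometry (s t x y : R) : s = 1 \/ s = -1 -> x <= y ->
  line_isometry s t @^-1`
    `[Num.min (line_isometry s t x) (line_isometry s t y),
      Num.max (line_isometry s t x) (line_isometry s t y)] = `[x, y]%classic.
Proof.
move=> hs xy; apply/seteqP; split => r; rewrite /line_isometry /= !in_itv /=;
  case: hs => ->; rewrite !(mul1r, mulN1r) ?ge_min ?le_max;
  [move=> /andP[]|move=> /andP[]|move=> /andP[h1 h2]|move=> /andP[h1 h2]].
- by rewrite !lerD2r => /orP[h1|h1] /orP[h2|h2]; apply/andP; split; lra.
- by rewrite !lerD2r !lerN2 => /orP[h1|h1] /orP[h2|h2]; apply/andP; split; lra.
- by rewrite !lerD2r h1 h2 orbT.
- by rewrite !lerD2r !lerN2 h1 h2 orbT.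
Qed.

Lemma primitive_isometry (s t x y : R) (U h : R -> R[i]) :
  s = 1 \/ s = -1 -> x <= y ->
  let lo := Num.min (line_isometry s t x) (line_isometry s t y) in
  let hi := Num.max (line_isometry s t x) (line_isometry s t y) in
  U hi - U lo = cint `[lo, hi] h -> cintegrable `[lo, hi] h ->
  U (line_isometry s t y) - U (line_isometry s t x) =
    cint `[x, y] (fun r => s%:C * h (line_isometry s t r)).
Proof.
move=> hs xy lo hi Uh ih.
have mI : measurable (`[lo, hi]%classic : set R) by exact: measurable_itv.
have e1 : cint `[x, y] (fun r => s%:C * h (line_isometry s t r)) =
    s%:C * cint `[lo, hi] h.
  rewrite -(cintZ s mI ih); have [i1 i2] := cintegrableZ s mI ih.
  rewrite -(itv_isometry t hs xy) /cint.
  have f1 := integral_isometry t hs mI (int_measurable i1).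
  have f2 := integral_isometry t hs mI (int_measurable i2).
  by rewrite /Rintegral; apply: complex_eq; [rewrite /= -f1|rewrite /= -f2].
rewrite e1 -Uh /lo /hi /line_isometry; case: hs => ->.
  by rewrite rmorph1 !mul1r max_r ?lerD2r // min_l ?lerD2r.
by rewrite rmorphN1 !mulN1r opprB max_l ?lerD2r ?lerN2 // min_r ?lerD2r ?lerN2.
Qed.

End ComplexIntegral.

Section FlippedPrimitives.
Context {R : realType} {E : finType} (D : E -> set R).
Context (mD : forall e, measurable (D e)).
Implicit Types u g : spinor R E.

(** By [|t| <= 1 + t ^+ 2]. *)
Lemma inL2_integrable g e k (x y : R) : inL2 D g -> `[x, y] `<=` D e ->
  cintegrable `[x, y] (fun t => g e t k 0).
Proof.
move=> gL sub; have mI : measurable (`[x, y]%classic : set R) by exact: measurable_itv.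
have sq := intS (mD e) mI sub (inL2_int e gL).
have fl : (leb (`[x, y]%classic : set R) < +oo)%E.
  by rewrite lebesgue_measure_itv /=; case: ifP => // _; exact: ltry.
have one : leb.-integrable `[x, y] (EFin \o (fun _ : R => 1)).
  by apply/integrableP; split; [exact: measurable_cst|
     rewrite (_ : (fun x => _) = (fun=> 1%E)); [rewrite integral_cst //; rewrite mul1e|
       by apply/funext => ? /=; rewrite normr1]].
have dom := intD mI one sq.
have [mg _] := gL e; have [m1 m2] := mg k.
have bnd (t N : R) : t ^+ 2 <= N -> `|t| <= 1 + N by case: (ger0P t) => _; nra.
have le t : Re (g e t k 0) ^+ 2 + Im (g e t k 0) ^+ 2 <= sqnorm2 (g e t).
  by rewrite /sqnorm2 (bigD1 k) //= lerDl sumr_ge0 // => j _; rewrite addr_ge0 ?sqr_ge0.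
split; apply: (int_le mI _ _ dom).
- by apply: measurable_funS m1 => //; exact: mD.
- by move=> t _; apply/bnd/(le_trans _ (le t)); rewrite lerDl sqr_ge0.
- by apply: measurable_funS m2 => //; exact: mD.
- by move=> t _; apply/bnd/(le_trans _ (le t)); rewrite lerDr sqr_ge0.
Qed.

Lemma flip_integrable b g e k (x y : R) : inL2 D g -> `[x, y] `<=` D e ->
  cintegrable `[x, y] (fun t => flip b (g e t) k 0).
Proof.
move=> gL sub; have gi := inL2_integrable k gL sub.
have mI : measurable (`[x, y]%classic : set R) by exact: measurable_itv.
have -> : (fun t => flip b (g e t) k 0) =
    (fun t => (if b && (k == 1) then -1 else 1)%:C * g e t k 0).
  by apply/funext => t; rewrite flipE; case: ifP; rewrite ?rmorphN1 ?rmorph1 ?mulN1r ?mul1r.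
exact: cintegrableZ.
Qed.

Lemma flip_primitive b u g e k (x y : R) : primitive_of D u g -> inL2 D g ->
  x <= y -> `[x, y] `<=` D e ->
  flip b (u e y) k 0 - flip b (u e x) k 0 = cint `[x, y] (fun t => flip b (g e t) k 0).
Proof.
move=> pug gL xy sub; have gi := inL2_integrable k gL sub.
have mI : measurable (`[x, y]%classic : set R) by exact: measurable_itv.
have Dx : D e x by apply: sub; rewrite /= in_itv /= lexx.
have Dy : D e y by apply: sub; rewrite /= in_itv /= lexx andbT.
have E1 z : flip b z k 0 = (if b && (k == 1) then -1 else 1)%:C * z k 0.
  by rewrite flipE; case: ifP; rewrite ?rmorphN1 ?rmorph1 ?mulN1r ?mul1r.
rewrite !E1 -mulrBr (pug e k x y Dx Dy xy) -(cintZ _ mI gi).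
by apply: eq_cint => t _; rewrite E1.
Qed.

End FlippedPrimitives.

(** * Arclength along the walk *)

Section RayPieces.
Context {R : realType} (G : mgraph R) (p : nat -> edge G * bool) (vx : nat -> vert G) (n : nat).
Context (w : ray_walk p vx n).

Definition edge_rank (e : edge G) : nat := s2val (cid2 (walk_edge w e)).

Lemma edge_rank_le e : (edge_rank e <= n)%N.
Proof. exact: (s2valP (cid2 (walk_edge w e))). Qed.

Lemma edge_rankE e : (p (edge_rank e)).1 = e.
Proof. exact: (s2valP' (cid2 (walk_edge w e))). Qed.

Lemma edge_rank_walk i : (i <= n)%N -> edge_rank (p i).1 = i.
Proof. by move=> lein; apply: (walk_inj w) => //; rewrite ?edge_rank_le ?edge_rankE. Qed.

Definition offset (i : nat) : R := \sum_(j < i) len (p j).1.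

Lemma offset0 : offset 0 = 0.
Proof. by rewrite /offset big_ord0. Qed.

Lemma offsetS i : offset i.+1 = offset i + len (p i).1.
Proof. by rewrite /offset big_ord_recr. Qed.

Lemma offset_ltS i : offset i < offset i.+1.
Proof. by rewrite offsetS ltrDl len_gt0. Qed.

Lemma offset_le i j : (i <= j)%N -> offset i <= offset j.
Proof.
elim: j => [|j IH]; first by rewrite leqn0 => /eqP ->.
rewrite leq_eqVlt => /orP[/eqP -> //|]; rewrite ltnS => /IH h.
exact: le_trans h (ltW (offset_ltS j)).
Qed.

Lemma offset_ge0 i : 0 <= offset i.
Proof. by rewrite -offset0; exact: offset_le. Qed.

Definition piece (e : edge G) : set R :=
  if edge_rank e == n then `[offset n, +oo[%classic
  else `[offset (edge_rank e), offset (edge_rank e).+1[%classic.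
Definition closed_piece (e : edge G) : set R :=
  if edge_rank e == n then `[offset n, +oo[%classic
  else `[offset (edge_rank e), offset (edge_rank e).+1]%classic.
(** The choice is forced on the half-line, which the pieces partition. *)
Definition piece_edge (y : R) : edge G := xget (p 0).1 [set e | piece e y].
Definition reversed (e : edge G) : bool := (p (edge_rank e)).2.
Definition piece_start (e : edge G) : R := offset (edge_rank e).
Definition piece_end (e : edge G) : R := offset (edge_rank e).+1.
Definition edge_start (e : edge G) : R := end_pos (p (edge_rank e)).

Lemma piece_bounds e y : piece e y ->
  offset (edge_rank e) <= y /\ ((edge_rank e < n)%N -> y < offset (edge_rank e).+1).
Proof.
rewrite /piece; case: eqP => [->|ne] /=; rewrite in_itv /= ?andbT.
  by move=> ->; rewrite ltnn.
by move=> /andP[-> ->].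
Qed.

Lemma closed_piece_bounds e y : closed_piece e y <->
  offset (edge_rank e) <= y /\ ((edge_rank e < n)%N -> y <= offset (edge_rank e).+1).
Proof.
rewrite /closed_piece; case: eqP => [->|/eqP ne] /=; rewrite in_itv /= ?andbT.
  by rewrite ltnn; split=> [|[]].
have ltn : (edge_rank e < n)%N by rewrite ltn_neqAle ne edge_rank_le.
by rewrite ltn; split=> [/andP[]|[-> /(_ isT) ->]].
Qed.

Lemma piece_uniq e e' y : piece e y -> piece e' y -> e = e'.
Proof.
move=> /piece_bounds[l1 u1] /piece_bounds[l2 u2]; rewrite -(edge_rankE e) -(edge_rankE e').
congr ((p _).1); apply/eqP; rewrite eqn_leq; apply/andP; split; rewrite leqNgt;
  apply/negP => h.
  have := u2 (leq_trans h (edge_rank_le e)); apply/negP; rewrite -leNgt.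
  exact: le_trans (offset_le h) l1.
have := u1 (leq_trans h (edge_rank_le e')); apply/negP; rewrite -leNgt.
exact: le_trans (offset_le h) l2.
Qed.

Lemma piece_cover y : 0 <= y -> exists e, piece e y.
Proof.
move=> y0; have below k : (k <= n)%N -> y < offset k -> exists e, piece e y.
  elim: k => [_|k IH ltkn yk]; first by rewrite offset0 ltNge y0.
  case: (ltP y (offset k)) => [|ky]; first by apply: IH; exact: ltnW.
  exists (p k).1; rewrite /piece edge_rank_walk; last exact: ltnW.
  by rewrite ltn_eqF //= in_itv /= ky.
case: (ltP y (offset n)) => [|ny]; first exact: below.
by exists (p n).1; rewrite /piece edge_rank_walk // eqxx /= in_itv /= ny.
Qed.

Lemma measurable_piece e : measurable (piece e).
Proof. by rewrite /piece; case: ifP => _; exact: measurable_itv. Qed.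

Lemma measurable_closed_piece e : measurable (closed_piece e).
Proof. by rewrite /closed_piece; case: ifP => _; exact: measurable_itv. Qed.

Lemma closed_piece_half e : closed_piece e `<=` @halfline_dom R tt.
Proof.
move=> y /closed_piece_bounds[h _]; rewrite /halfline_dom /= in_itv /= andbT.
exact: le_trans (offset_ge0 _) h.
Qed.

Lemma piece_closed e : piece e `<=` closed_piece e.
Proof.
by move=> y /piece_bounds[h1 h2]; apply/closed_piece_bounds; split=> // /h2 /ltW.
Qed.

Lemma closed_piece_endpoint e y : closed_piece e y -> y <> piece_end e -> piece e y.
Proof.
rewrite /closed_piece /piece; case: eqP => // _ /=; rewrite !in_itv /= => /andP[-> yle] ne.
by rewrite lt_neqAle yle andbT; apply/eqP.
Qed.

Lemma piece_lt e x y : closed_piece e x -> closed_piece e y -> x < y -> piece e x.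
Proof.
rewrite /closed_piece /piece; case: eqP => // _ /=; rewrite !in_itv /=.
by move=> /andP[-> _] /andP[_ yle] xy; exact: lt_le_trans yle.
Qed.

Lemma closed_piece_last e y : edge_rank e = n -> closed_piece e y -> piece e y.
Proof. by rewrite /closed_piece /piece => ->; rewrite eqxx. Qed.

Lemma closed_piece_offset i : (i <= n)%N -> closed_piece (p i).1 (offset i).
Proof.
move=> lein; apply/closed_piece_bounds; rewrite edge_rank_walk //.
by split=> // _; exact: offset_le.
Qed.

Lemma closed_piece_offsetS i : (i < n)%N -> closed_piece (p i).1 (offset i.+1).
Proof.
move=> ltin; apply/closed_piece_bounds; rewrite edge_rank_walk ?(ltnW ltin) //.
by split=> //; exact: offset_le.
Qed.

Lemma piece_offset i : (i <= n)%N -> piece (p i).1 (offset i).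
Proof.
move=> lein; apply: closed_piece_endpoint; first exact: closed_piece_offset.
rewrite /piece_end edge_rank_walk // => /eqP; rewrite lt_eqF //; exact: offset_ltS.
Qed.

Lemma piece_edgeP e y : @halfline_dom R tt y -> piece e y <-> piece_edge y = e.
Proof.
rewrite /halfline_dom /= in_itv /= andbT => y0; have ex := piece_cover y0.
have : piece (piece_edge y) y by exact: (xgetPex _ ex).
by split=> [|<- //]; exact: piece_uniq.
Qed.

Lemma edge_dom_piece e : edge_dom e =
  tau reversed piece_start edge_start e @^-1` closed_piece e.
Proof.
have := walk_start w (edge_rank_le e).
have nx : (edge_rank e < n)%N -> opp_vert (p (edge_rank e)) = Some (vx (edge_rank e).+1) by exact: walk_next.
have lst : edge_rank e = n -> opp_vert (p (edge_rank e)) = None by move=> ->; exact: (walk_last w).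
have pE := edge_rankE e; have oS := offsetS (edge_rank e); rewrite pE in oS.
rewrite /opp_vert /end_vert pE in nx lst *.
rewrite /tau /line_isometry /sgn /reversed /edge_start /end_pos /piece_start.
rewrite /closed_piece /edge_dom pE.
case: eqP => [en|/eqP ne].
  have {nx lst} := lst en; rewrite en /=; move: (offset n) => o.
  case: (p n).2 => /= -> ->; apply/seteqP; split=> x /=; rewrite !in_itv /= ?andbT => h; lra.
have ltn : (edge_rank e < n)%N by rewrite ltn_neqAle ne edge_rank_le.
have {nx lst} := nx ltn; rewrite oS /=; move: (offset (edge_rank e)) (len e) => o l.
case: (p (edge_rank e)).2 => /= -> ->; apply/seteqP; split=> x /=; rewrite !in_itv /= => /andP[h1 h2];
  apply/andP; split; lra.
Qed.

End RayPieces.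

(** * The Dirac operator along the walk *)

Section FlipDirac.
Context {R : realType} (m c : R).
Implicit Types (z : 'cV[R[i]]_2) (b : bool).

Definition dirac_form (z' z : 'cV[R[i]]_2) : 'cV[R[i]]_2 :=
  - ('i%C * c%:C) *: (sigma1 R *m z') + (m * c ^+ 2)%:C *: (sigma3 R *m z).

Lemma flip_sigma1 b z :
  flip b (sigma1 R *m z) = (@sgn R b)%:C *: (sigma1 R *m flip b z).
Proof.
apply/colP => k; rewrite [RHS]mxE flipE !sigma1E flipE.
case: b; rewrite /sgn ?rmorphN1 ?rmorph1 ?mulN1r ?mul1r //=.
by elim/ord2P: k => /=; rewrite ?opprK.
Qed.

Lemma flip_sigma3 b z : flip b (sigma3 R *m z) = sigma3 R *m flip b z.
Proof.
by apply/colP => k; rewrite flipE !sigma3E flipE; case: ifP => // _; rewrite mulrN.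
Qed.

(** Reversing an edge reverses the sign of the derivative, which the Dirac
    operator absorbs in the change of sign of the second component. *)
Lemma flip_dirac_form b z' z :
  flip b (dirac_form z' z) = dirac_form ((@sgn R b)%:C *: flip b z') (flip b z).
Proof.
rewrite /dirac_form flipD !flipZ flip_sigma1 flip_sigma3 -scalemxAr.
by [].
Qed.

Lemma is_interval_minmax (S : set R) (x y : R) : is_interval S -> S x -> S y ->
  `[Num.min x y, Num.max x y] `<=` S.
Proof.
move=> iS Sx Sy z /=; rewrite in_itv /=; case: (leP x y) => xy zxy.
  exact: iS Sx Sy _ zxy.
exact: iS Sy Sx _ zxy.
Qed.

Lemma is_interval_sub (S : set R) (x y : R) : is_interval S -> S x -> S y ->
  `[x, y] `<=` S.
Proof. by move=> iS Sx Sy z /=; rewrite in_itv; exact: iS. Qed.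

Lemma halfline_interval e : is_interval (@halfline_dom R e).
Proof. exact: interval_is_interval. Qed.

Lemma edge_dom_interval (G : mgraph R) (e : edge G) : is_interval (edge_dom e).
Proof.
rewrite /edge_dom; case: (tail e) (head e) => [?|] [?|] //; exact: interval_is_interval.
Qed.

End FlipDirac.

Section RayDirac.
Context {R : realType} (G : mgraph R) (p : nat -> edge G * bool) (vx : nat -> vert G) (n : nat).
Context (w : ray_walk p vx n).
Context (m c : R).

Local Notation D := (@edge_dom R G).
Local Notation H := (@halfline_dom R).
Local Notation b := (reversed w).
Local Notation off := (piece_start w).
Local Notation pos := (edge_start w).
Local Notation J := (piece w).
Local Notation Jc := (closed_piece w).
Local Notation tG := (toGraph b off pos).
Local Notation tH := (toHalf b off pos (piece_edge w)).
Local Notation tauG := (tau b off pos).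
Local Notation rhoG := (rho b off pos).

Lemma tau_start i : (i <= n)%N -> tauG (p i).1 (end_pos (p i)) = offset p i.
Proof.
move=> lein; rewrite /tau /line_isometry /piece_start /edge_start edge_rank_walk //.
by rewrite addrC subrK.
Qed.

Lemma tau_end i : (i < n)%N -> tauG (p i).1 (end_pos (opposite (p i))) = offset p i.+1.
Proof.
move=> ltin; have lein := ltnW ltin.
rewrite /tau /line_isometry /piece_start /edge_start edge_rank_walk // /reversed edge_rank_walk //.
rewrite offsetS; move: (walk_start w lein) (walk_next w ltin).
rewrite /opp_vert /end_vert /end_pos /= /sgn.
by case: (p i) => e [] /=; case: (tail e) (head e) => [t|] [h|] //= _ _; ring.
Qed.

Lemma sum_ends i (F : edge G * bool -> R[i]) : (i <= n)%N ->
  \sum_(d : edge G * bool | end_vert d == Some (vx i)) F d =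
  F (p i) + (if i is j.+1 then F (opposite (p j)) else 0).
Proof.
move=> lein; rewrite (bigD1 (p i)) /=; last by rewrite (walk_start w).
congr (_ + _); case: i lein => [|j] lein.
  apply: big1 => d /andP[/eqP dv /eqP ne].
  by case: (walk_ends w lein dv) => [//|[j]].
have ne : opposite (p j) != p j.+1.
  apply/eqP => /(congr1 fst)/(walk_inj w (ltnW lein) lein)/eqP.
  by rewrite ltn_eqF.
rewrite (bigD1 (opposite (p j))) /=; last by rewrite ne andbT end_opposite (walk_next w).
rewrite big1 ?addr0 // => d /andP[/andP[/eqP dv /eqP n1] /eqP n2].
by case: (walk_ends w lein dv) => [//|[j' [<-]]].
Qed.

(** At a transmissive vertex the Dirac-Kirchhoff condition is the continuity of
    the spinor once the components are flipped on the reversed edges; at the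
    terminal vertex it is the boundary condition of the half-line. *)
Lemma kirchhoff_ray (u : spinor R (edge G)) :
  dirac_kirchhoff u <->
  u (p 0).1 (end_pos (p 0)) 1 0 = 0 /\
  forall i, (i < n)%N ->
    flip (p i).2 (u (p i).1 (end_pos (opposite (p i)))) =
    flip (p i.+1).2 (u (p i.+1).1 (end_pos (p i.+1))).
Proof.
split=> [K|[K0 KS] v].
  split.
    have [_] := K (vx 0); rewrite sum_ends // addr0; case: (p 0).2 => /=.
      by move/eqP; rewrite mulN1r oppr_eq0 => /eqP.
    by rewrite mul1r.
  move=> i ltin; have [K1 K2] := K (vx i.+1).
  have e1 : end_vert (p i.+1) = Some (vx i.+1) by rewrite (walk_start w).
  have e2 : end_vert (opposite (p i)) = Some (vx i.+1).
    by rewrite end_opposite (walk_next w).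
  have {}K1 := K1 _ _ e2 e1; move: K2; rewrite sum_ends //= => K2.
  apply/colP => k; rewrite !flipE; elim/ord2P: k => /=; first by rewrite !andbF.
  rewrite !andbT; move: K2; case: (p i).2; case: (p i.+1).2 => /= /eqP;
    rewrite ?mulN1r ?mul1r ?addr_eq0 ?opprK => /eqP h; rewrite ?h ?opprK //.
have [i lein <-] := walk_vert w v.
have KS1 i' : (i' < n)%N -> u (p i').1 (end_pos (opposite (p i'))) 0 0 =
    u (p i'.+1).1 (end_pos (p i'.+1)) 0 0.
  move=> lt'; have /colP/(_ 0) := KS i' lt'.
  by rewrite !flipE !andbF.
split.
  have e0 d : end_vert d = Some (vx i) -> u d.1 (end_pos d) 0 0 = u (p i).1 (end_pos (p i)) 0 0.
    move=> dv; case: (walk_ends w lein dv) => [->//|[j ij ->]].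
    by rewrite ij in lein *; exact: KS1.
  by move=> d d' /e0 -> /e0 ->.
rewrite sum_ends //; case: i lein => [|i] lein; first by rewrite K0 mulr0 addr0.
have /colP/(_ 1) := KS i lein; rewrite !flipE !andbT => h.
have E b' (z : R[i]) : (if b' then -1 else 1) * z = if b' then - z else z.
  by case: b'; rewrite ?mulN1r ?mul1r.
by rewrite !E -h /=; case: (p i).2; rewrite /= ?addrN ?addNr.
Qed.

Lemma ray_equiv : spinor_equiv D H tH tG.
Proof.
apply: (@pieces_equiv _ _ _ _ _ _ J Jc (piece_end w));
  [exact: measurable_piece|exact: measurable_closed_piece|exact: closed_piece_half|
   exact: piece_closed|exact: closed_piece_endpoint|
   exact: piece_edgeP|exact: edge_dom_piece].
Qed.

Lemma measurable_edge_dom e : measurable (D e).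
Proof. exact: mD (@measurable_closed_piece _ _ _ _ _ w) (edge_dom_piece w) e. Qed.

(** A primitive on the half-line restricts to a primitive on every edge, and its
    continuity gives the vertex conditions. *)
Lemma dirac_toGraph (u v : spinor R unit) :
  dirac_halfline m c u v -> dirac_graph m c (tG u) (tG v).
Proof.
have DE := edge_dom_piece w; have JcH := @closed_piece_half _ _ _ _ _ w.
have L2 (y : spinor R unit) : inL2 H y -> inL2 D (tG y) by move/(equiv_L2' ray_equiv).
have aeG := equiv_aeeq' ray_equiv.
move=> [uL vL [ut [u' [uut u'L pu bc vE]]]].
split; [exact: L2|exact: L2|].
exists (tG ut), (fun e x => (sgn (b e))%:C *: tG u' e x); split.
- exact: aeG.
- by move=> e; exact: (inL2Z measurable_edge_dom (sgn (b e))%:C (L2 _ u'L) e).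
- move=> e k x y Dx Dy xy.
  have tx := tauH JcH DE Dx; have ty := tauH JcH DE Dy.
  have sub := is_interval_minmax (@halfline_interval R tt) tx ty.
  have lohi : Num.min (tauG e x) (tauG e y) <= Num.max (tauG e x) (tauG e y).
    by rewrite ge_min !le_max lexx.
  have P := flip_primitive (@measurable_halfline R) (b e) k pu u'L lohi sub.
  have I := flip_integrable (@measurable_halfline R) (b e) k u'L sub.
  have Q := @primitive_isometry R _ _ x y (fun z => flip (b e) (ut tt z) k 0)
    (fun z => flip (b e) (u' tt z) k 0) (sgnP (b e)) xy P I.
  apply: etrans Q _.
  by apply: eq_cint => t _; rewrite [RHS]mxE.
- apply/kirchhoff_ray.
  have at0 i : (i <= n)%N -> tG ut (p i).1 (end_pos (p i)) = flip (p i).2 (ut tt (offset p i)).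
    by move=> lein; rewrite /toGraph tau_start // /reversed edge_rank_walk.
  have at1 i : (i < n)%N ->
      tG ut (p i).1 (end_pos (opposite (p i))) = flip (p i).2 (ut tt (offset p i.+1)).
    by move=> ltin; rewrite /toGraph tau_end // /reversed edge_rank_walk // ltnW.
  split; first by rewrite at0 // flipE offset0 bc oppr0; case: ifP.
  by move=> i ltin; rewrite at1 // at0 // !flipK.
apply: aeeq_trans (aeG _ _ vE) _; apply: eq_aeeq => e x Dx.
exact: flip_dirac_form.
Qed.

(** Conversely the vertex conditions make the primitives on the edges match at
    the common endpoints of the pieces; by induction along the walk the glued
    spinor is a primitive on the whole half-line. *)
Lemma dirac_toHalf (u v : spinor R (edge G)) :
  dirac_graph m c u v -> dirac_halfline m c (tH u) (tH v).
Proof.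
have DE := edge_dom_piece w; have JcH := @closed_piece_half _ _ _ _ _ w.
have Jsel := @piece_edgeP _ _ _ _ _ w.
have JJc := @piece_closed _ _ _ _ _ w.
have L2 (y : spinor R (edge G)) : inL2 D y -> inL2 H (tH y) by move/(equiv_L2 ray_equiv).
have aeH := equiv_aeeq ray_equiv.
move=> [uL vL [ut [u' [uut u'L pu /kirchhoff_ray[bc0 bcS] vE]]]].
pose g : spinor R (edge G) := fun e x => (sgn (b e))%:C *: u' e x.
have gL : inL2 D g by move=> e; exact: (inL2Z measurable_edge_dom (sgn (b e))%:C u'L e).
have HL := L2 _ gL.
have H0 y : H tt y -> 0 <= y by rewrite /halfline_dom /= in_itv /= andbT.
(* The two values at an inner vertex agree, so that the glued spinor is given
   by the formula of each edge up to its right endpoint included. *)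
have onpiece e y : Jc e y -> tH ut tt y = flip (b e) (ut e (rhoG e y)).
  move=> Jy; have Hy := JcH _ _ Jy; case: (pselect (J e y)) => [Jy'|nJ].
    by rewrite /toHalf ((Jsel e y Hy).1 Jy').
  have yE : y = piece_end w e.
    by apply: contrapT => ne; apply: nJ; exact: closed_piece_endpoint.
  have ltn : (edge_rank w e < n)%N.
    rewrite ltn_neqAle edge_rank_le andbT; apply/eqP => en; apply: nJ.
    exact: closed_piece_last.
  set i := edge_rank w e in ltn yE *; rewrite yE /piece_end in Hy *.
  have sE := (Jsel _ _ Hy).1 (piece_offset w ltn).
  rewrite /toHalf sE -(tau_start ltn) tauK -[RHS]/(flip (p i).2 _).
  rewrite (tau_start ltn) -(tau_end ltn) (edge_rankE w e : (p i).1 = e) tauK.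
  by rewrite /reversed edge_rank_walk // -bcS // (edge_rankE w e : (p i).1 = e).
have prim_piece e k x y : Jc e x -> Jc e y -> x <= y ->
    tH ut tt y k 0 - tH ut tt x k 0 = cint `[x, y] (fun t => tH g tt t k 0).
  move=> Jx Jy xy.
  have rD z : Jc e z -> D e (rhoG e z) by rewrite DE /= rhoK.
  have sub := is_interval_minmax (@edge_dom_interval R G e) (rD _ Jx) (rD _ Jy).
  have lohi : Num.min (rhoG e x) (rhoG e y) <= Num.max (rhoG e x) (rhoG e y).
    by rewrite ge_min !le_max lexx.
  have P := flip_primitive measurable_edge_dom (b e) k pu u'L lohi sub.
  have I := flip_integrable measurable_edge_dom (b e) k u'L sub.
  rewrite !(onpiece e) //.
  have Q := @primitive_isometry R _ _ x y (fun z => flip (b e) (ut e z) k 0)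
    (fun z => flip (b e) (u' e z) k 0) (sgnP (b e)) xy P I.
  apply: etrans Q _.
  apply/esym/eq_cint_bndo.
    apply: (inL2_integrable (@measurable_halfline R) _ HL).
    exact: (is_interval_sub (@halfline_interval R tt) (JcH _ _ Jx) (JcH _ _ Jy)).
  move=> t; rewrite in_itv /= => /andP[xt ty].
  have Jt : J e t.
    have [h1 _] := (closed_piece_bounds w e x).1 Jx.
    have [_ h2] := (closed_piece_bounds w e y).1 Jy.
    apply: (piece_lt _ Jy ty); apply/closed_piece_bounds.
    by split=> [|/h2 h3]; [exact: le_trans xt|exact: le_trans (ltW ty) h3].
  rewrite /toHalf ((Jsel e t (JcH _ _ (JJc _ _ Jt))).1 Jt) /g flipZ [LHS]mxE.
  by [].
have int0 k y : 0 <= y -> cintegrable `[0, y] (fun t => tH g tt t k 0).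
  move=> y0; apply: (inL2_integrable (@measurable_halfline R) _ HL).
  have Hz z : 0 <= z -> H tt z by rewrite /halfline_dom /= in_itv /= andbT.
  exact: (is_interval_sub (@halfline_interval R tt) (Hz _ (lexx 0)) (Hz _ y0)).
have prim0 k i y : (i <= n)%N -> Jc (p i).1 y ->
    tH ut tt y k 0 - tH ut tt 0 k 0 = cint `[0, y] (fun t => tH g tt t k 0).
  elim: i y => [|i IH] y lein Jy.
    apply: prim_piece Jy (H0 _ (JcH _ _ Jy)).
    by have := closed_piece_offset w lein; rewrite offset0.
  have oy : offset p i.+1 <= y.
    by have /closed_piece_bounds[] := Jy; rewrite edge_rank_walk.
  have h1 := IH _ (ltnW lein) (closed_piece_offsetS w lein).
  have h2 := prim_piece _ k _ _ (closed_piece_offset w lein) Jy oy.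
  rewrite (cint_split (offset_ge0 _ _) oy) -?h1 -?h2.
    by rewrite [RHS]addrC subrKA.
  by apply: int0; exact: le_trans (offset_ge0 _ _) oy.
have primH k y : H tt y ->
    tH ut tt y k 0 - tH ut tt 0 k 0 = cint `[0, y] (fun t => tH g tt t k 0).
  move=> /H0 y0; have [e Jy] := piece_cover w y0.
  by apply: (prim0 k (edge_rank w e)); rewrite ?edge_rank_le // edge_rankE; exact: JJc.
split; [exact: L2|exact: L2|].
exists (tH ut), (tH g); split.
- exact: aeH.
- exact: HL.
- move=> [] k x y Hx Hy xy; have x0 := H0 _ Hx.
  have := primH k y Hy; rewrite (cint_split x0 xy) -?(primH k x) //; last exact: int0 (H0 _ Hy).
  by move=> h; apply: (addrI (tH ut tt x k 0 - tH ut tt 0 k 0)); rewrite -h [LHS]addrC subrKA.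
- have H00 : Jc (p 0).1 0 by have := closed_piece_offset w (leq0n n); rewrite offset0.
  have r0 : rhoG (p 0).1 0 = end_pos (p 0).
    by rewrite -(offset0 p) -(tau_start (leq0n n)) tauK.
  by rewrite (onpiece _ _ H00) r0 flipE bc0 oppr0; case: ifP.
apply: aeeq_trans (aeH _ _ vE) _; apply: eq_aeeq => e y Hy.
rewrite {1}/toHalf -/(dirac_form m c _ _) flip_dirac_form /g /toHalf flipZ.
by [].
Qed.

End RayDirac.

(** * Equality of the action levels *)

Section RayLevel.
Context {R : realType} (G : mgraph R) (p : nat -> edge G * bool) (vx : nat -> vert G) (n : nat).
Context (w : ray_walk p vx n).
Context (m c : R) (hm : 0 < m) (hc : 0 < c) (f : R -> R).
Context (hF1 : F1 f) (hF2 : F2 f) (hF4 : F4 f).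

Local Notation D := (@edge_dom R G).
Local Notation H := (@halfline_dom R).
Local Notation tG := (toGraph (reversed w) (piece_start w) (edge_start w)).
Local Notation tH := (toHalf (reversed w) (piece_start w) (edge_start w) (piece_edge w)).

Lemma dirac_halfline_toGraph (u v : spinor R unit) :
  dirac_halfline m c u v <-> dirac_graph m c (tG u) (tG v).
Proof.
split; first exact: dirac_toGraph.
by move/(dirac_toHalf w); rewrite !toHalfK.
Qed.

Lemma dirac_op_aeeq {E : finType} (D0 : E -> set R) bc (u v u1 v1 : spinor R E) :
  inL2 D0 u1 -> inL2 D0 v1 -> aeeq D0 u u1 -> aeeq D0 v v1 ->
  dirac_op D0 m c bc u v -> dirac_op D0 m c bc u1 v1.
Proof.
move=> uL vL uu vv [_ _ [ut [u' [h1 h2 h3 h4 h5]]]]; split=> //.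
exists ut, u'; split=> //; first exact: aeeq_trans (aeeq_sym uu) h1.
exact: aeeq_trans (aeeq_sym vv) h5.
Qed.

(** Gluing followed by restriction may change the values at the vertices, hence
    the recourse to [dirac_op_aeeq] for the converse. *)
Lemma dirac_graph_toHalf (u v : spinor R (edge G)) :
  dirac_graph m c u v <-> dirac_halfline m c (tH u) (tH v).
Proof.
split; first exact: dirac_toHalf.
move=> h; have [uL vL _] := h.
apply: dirac_op_aeeq (dirac_toGraph w h); try exact: (equivK (ray_equiv w)).
  exact/(equiv_L2 (ray_equiv w)).
exact/(equiv_L2 (ray_equiv w)).
Qed.

(** The embedding of the form domain makes the potential integrable, whence its
    additivity over the edges. *)
Lemma potential_ray (u : spinor R unit) P :
  spectral_measure_of H (dirac_halfline m c) P -> calc_dom H P (@sqrt_abs R) u ->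
  \sum_e (\int[leb]_(x in D e) primF f (Num.sqrt (sqnorm2 (tG u e x))))%R =
  \sum_e (\int[leb]_(x in H e) primF f (Num.sqrt (sqnorm2 (u e x))))%R.
Proof.
move=> hS ud.
apply: (@potential_toGraph R _ D _ _ _ (piece w) (closed_piece w) (piece_end w)
  (piece_edge w) _ _ _ _ _ _ _ (fun S => primF f (Num.sqrt S))).
- exact: measurable_piece.
- exact: measurable_closed_piece.
- exact: closed_piece_half.
- exact: piece_closed.
- exact: closed_piece_endpoint.
- exact: piece_edgeP.
- exact: edge_dom_piece.
- exact: (primF_integrable hF1 hF2 hF4 hm hc hS ud).
Qed.

(** Two applications of [transport_level]; in the second one the spectral measure
    on the half-line that the embedding requires is the transported one. *)
Lemma ray_level lam : d_graph G m c f lam = d_halfline m c f lam.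
Proof.
have mF := measurable_primF_sqrt hF1 hF4.
have mD := measurable_edge_dom w; have mH := @measurable_halfline R.
have eqv := ray_equiv w.
apply/eqP; rewrite eq_le; apply/andP; split.
  apply: (transport_level mH mD (spinor_equiv_sym eqv) dirac_graph_toHalf lam mF).
  by move=> P u hS ud; exact: potential_ray hS ud.
apply: (transport_level mD mH eqv dirac_halfline_toGraph lam mF) => P u hS ud.
have [hP _] := hS; have [uL _] := ud.
have hS' := transport_spectral mD mH eqv dirac_halfline_toGraph hP hS.
have tL : inL2 D (tG (tH u)) by exact/(equiv_L2' eqv)/(equiv_L2 eqv).
have ud' := (transport_calc_dom eqv P (@sqrt_abs R) (tH u)).2
  (calc_dom_aeeq mD hP tL (aeeq_sym (equivK eqv u)) ud).
rewrite -(potential_ray hS' ud'); apply: eq_bigr => e _.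
have m1 := @measurable_potential _ _ _ _ mF _ e tL.
have m2 := @measurable_potential _ _ _ _ mF _ e uL.
apply: (Rint_ae (mD e) m1 m2).
by apply: ae_mono1 (equivK eqv u e) => x ux Dx; rewrite ux.
Qed.

End RayLevel.

Theorem proposition1p3 (R : realType) (m c : R) (hm : 0 < m) (hc : 0 < c)
  (f : R -> R) (hC1 : C1_nonneg f) (hF1 : F1 f) (hF2 : F2 f) (hF3 : F3 f)
  (hF4 : F4 f)
  (G : mgraph R) (hG : generalized_star G)
  (G' : mgraph R) (hG' : essential_reduction G G')
  (hiso : isometric_to_halfline G')
  (lam : R) (hlam : - (m * c ^+ 2) < lam < m * c ^+ 2) :
  d_graph G m c f lam = d_halfline m c f lam.
Proof.
have [p [vx [n w]]] := reduction_ray_walk hG hG' hiso.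
exact: (ray_level w hm hc hF1 hF2 hF4).
Qed.
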